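(* Let the integer $\eta\ge 0$, the expansive integer matrix $\tilde M\in M_2(\mathbb{Z})$ and the digit set $\tilde D\subset\mathbb{Z}^2$ be obtained from an expansive integer matrix $M$ and a digit set $D$ by the construction described in the context, and let $\mu_{\tilde M,\tilde D}$ be the associated self-affine measure. If $\eta=0$, then the following statements are equivalent: (i) $\mu_{\tilde M,\tilde D}$ is a spectral measure; (ii) $\tilde M\in M_2(2\mathbb{Z})$; (iii) $\tilde M\mathring{\mathcal{F}}_2^2\subset\mathbb{Z}^2$; (iv) $(\tilde M,\tilde D)$ is admissible.
   Context: Construction. Let $M\in M_2(\mathbb{Z})$ be expansive (all eigenvalues of modulus strictly greater than one) and let $D=\{(0,0)^t,(\alpha_1,\alpha_2)^t,(\beta_1,\beta_2)^t,(-\alpha_1-\beta_1,-\alpha_2-\beta_2)^t\}\subset\mathbb{Z}^2$ with $\alpha_1\beta_2-\alpha_2\beta_1\ne0$ and $\gcd(\alpha_1,\alpha_2,\beta_1,\beta_2)=1$. Write $\alpha_1\beta_2-\alpha_2\beta_1=2^\eta\gamma$ with $\eta\ge0$ an integer and $\gamma$ odd. It is assumed that $\alpha:=\gcd(\alpha_1,\alpha_2)$ is odd. Write $\alpha_1=\alpha t_1$, $\alpha_2=\alpha t_2$ with $\gcd(t_1,t_2)=1$, choose $p,q\in\mathbb{Z}$ with $pt_1+qt_2=1$, and put $\omega=p\beta_1+q\beta_2$ and $\beta=\gamma/\alpha$ (an odd integer). Let $Q=\begin{pmatrix}p&q\\-t_2&t_1\end{pmatrix}$ (so $\det Q=1$).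 Define $$\tilde M=QMQ^{-1}\in M_2(\mathbb{Z}),\qquad \tilde D=QD=\left\{\begin{pmatrix}0\\0\end{pmatrix},\begin{pmatrix}\alpha\\0\end{pmatrix},\begin{pmatrix}\omega\\2^\eta\beta\end{pmatrix},\begin{pmatrix}-\alpha-\omega\\-2^\eta\beta\end{pmatrix}\right\}\subset\mathbb{Z}^2.$$ Self-affine measure: for expansive $M\in M_n(\mathbb{R})$ and finite $D\subset\mathbb{R}^n$, $\mu_{M,D}$ is the unique Borel probability measure with $\mu_{M,D}=\frac{1}{\#D}\sum_{d\in D}\mu_{M,D}\circ\phi_d^{-1}$, $\phi_d(x)=M^{-1}(x+d)$. A compactly supported Borel probability measure $\mu$ on $\mathbb{R}^n$ is a spectral measure if there is a countable set $\Lambda\subset\mathbb{R}^n$ such that $\{e^{2\pi i\langle\lambda,x\rangle}:\lambda\in\Lambda\}$ is an orthonormal basis of $L^2(\mu)$. Admissible: for an expansive integer matrix $M\in M_n(\mathbb{Z})$ and a finite set $D\subset\mathbb{Z}^n$ with $\#D=N$, the pair $(M,D)$ is admissible if there is $S\subset\mathbb{Z}^n$ with $\#S=N$ such that the matrix $\frac{1}{\sqrt N}\left(e^{2\pi i\langle M^{-1}d,s\rangle}\right)_{d\in D,s\in S}$ is unitary. $M_2(2\mathbb{Z})$ is the set of $2\times2$ matrices with even integer entries. $\mathring{\mathcal{F}}_2^2=\left\{\frac12(l_1,l_2)^t: l_1,l_2\in\{0,1\}\right\}\setminus\{(0,0)^t\}$. *)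

(* Defs.v *)
From HB Require Import structures.
From mathcomp Require Import all_boot all_order all_algebra.
From mathcomp Require Import finmap complex ring.
From mathcomp Require Import all_classical all_reals all_analysis.

Set Implicit Arguments.
Unset Strict Implicit.
Unset Printing Implicit Defensive.

Import Order.TTheory GRing.Theory Num.Theory.
Import numFieldNormedType.Exports.

Local Open Scope fset_scope.
Local Open Scope classical_set_scope.
Local Open Scope ring_scope.
Local Open Scope complex_scope.

Definition col2 {T : Type} (x y : T) : 'cV[T]_2 :=
  \col_i (if i == 0 then x else y).

Definition mx2 {T : Type} (a b c d : T) : 'M[T]_2 :=
  \matrix_(i, j) (if i == 0 then (if j == 0 then a else b)
                  else (if j == 0 then c else d)).

Section Expansive.
Variables (R : realType) (n : nat).

Definition expansive (M : 'M[R]_n) : Prop :=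
  forall z : R[i], eigenvalue (map_mx (real_complex R) M) z -> 1 < `|z|.

End Expansive.

Section SpectralMeasures.
Variables (R : realType) (n : nat).

(* R^n, as column vectors, with its Borel sigma-algebra *)
Definition borelRn := g_sigma_algebraType (@open 'cV[R]_n).

Definition dot (u v : 'cV[R]_n) : R := \sum_i u i 0 * v i 0.

Definition affine_map (M : 'M[R]_n) (d x : 'cV[R]_n) : 'cV[R]_n :=
  invmx M *m (x + d).

Definition self_affine_measure (M : 'M[R]_n) (D : {fset 'cV[R]_n})
    (mu : probability borelRn R) : Prop :=
  forall A : set borelRn, measurable A ->
    mu A = ((#|` D|%:R^-1)%:E *
            \sum_(d <- D) mu (affine_map M d @^-1` A))%E.

(* exp (i t) *)
Definition cis (t : R) : R[i] := cos t +i* sin t.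

Definition expo (l x : 'cV[R]_n) : R[i] := cis (2 * pi * dot l x).

Definition Cintegral (mu : probability borelRn R) (f : borelRn -> R[i]) : R[i] :=
  (\int[mu]_x complex.Re (f x)) +i* (\int[mu]_x complex.Im (f x)).

Definition inL2 (mu : probability borelRn R) (f : borelRn -> R[i]) : Prop :=
  [/\ measurable_fun setT (fun x => complex.Re (f x)),
      measurable_fun setT (fun x => complex.Im (f x)) &
      (\int[mu]_x ((Normc.normc (f x) ^+ 2)%:E) < +oo)%E].

Definition L2dot (mu : probability borelRn R) (f g : borelRn -> R[i]) : R[i] :=
  Cintegral mu (fun x => f x * (g x)^*).

Definition orthonormal_exp (mu : probability borelRn R)
    (L : set 'cV[R]_n) : Prop :=
  forall l l', L l -> L l' -> L2dot mu (expo l) (expo l') = (l == l')%:R.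

(* the linear span of the exponentials is dense in L^2(mu) *)
Definition total_exp (mu : probability borelRn R) (L : set 'cV[R]_n) : Prop :=
  forall f : borelRn -> R[i], inL2 mu f -> forall e : R, 0 < e ->
    exists (F : {fset 'cV[R]_n}) (c : 'cV[R]_n -> R[i]),
      [set` F] `<=` L /\
      (\int[mu]_x
        ((Normc.normc (f x - \sum_(l <- F) c l * expo l x) ^+ 2)%:E) < e%:E)%E.

Definition orthonormal_basis_exp (mu : probability borelRn R)
    (L : set 'cV[R]_n) : Prop := orthonormal_exp mu L /\ total_exp mu L.

Definition compactly_supported (mu : probability borelRn R) : Prop :=
  exists2 K : set 'cV[R]_n, compact K & mu (~` K) = 0%E.

Definition spectral_measure (mu : probability borelRn R) : Prop :=
  compactly_supported mu /\
  exists2 L : set 'cV[R]_n, countable L & orthonormal_basis_exp mu L.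

End SpectralMeasures.

Section Admissible.
Variables (R : realType) (n : nat).

(* Rows and columns follow the enumerations of D and S; the choice of the
   enumerations does not affect unitarity. *)
Definition hadamard_mx (M : 'M[int]_n) (D S : {fset 'cV[int]_n}) :
    'M[R[i]]_(#|` D|, #|` S|) :=
  \matrix_(i, j) ((Num.sqrt (#|` D|%:R : R))^-1%:C *
    expo (invmx (map_mx intr M) *m map_mx intr (nth 0 D i))
         (map_mx intr (nth 0 S j))).

Definition admissible (M : 'M[int]_n) (D : {fset 'cV[int]_n}) : Prop :=
  exists2 S : {fset 'cV[int]_n}, #|` S| = #|` D| &
    hadamard_mx M D S \is unitarymx.

End Admissible.

Definition even_mx (n : nat) (M : 'M[int]_n) : Prop :=
  forall i j, (2 %| M i j)%Z.

Definition integer_points (R : realType) (n : nat) : set 'cV[R]_n :=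
  range (fun z : 'cV[int]_n => map_mx intr z).

(* the nonzero points of {0, 1/2}^2 *)
Definition half_points (R : realType) : set 'cV[R]_2 :=
  [set 2^-1 *: col2 l1%:R l2%:R | l1 in [set 0%N; 1%N] & l2 in [set 0%N; 1%N]]
    `\ 0.

Definition digits (a1 a2 b1 b2 : int) : {fset 'cV[int]_2} :=
  [fset 0; col2 a1 a2; col2 b1 b2; col2 (- a1 - b1) (- a2 - b2)].

Definition Qmx (p q t1 t2 : int) : 'M[int]_2 := mx2 p q (- t2) t1.

Lemma det_Qmx (p q t1 t2 : int) : p * t1 + q * t2 = 1 -> \det (Qmx p q t1 t2) = 1.
Proof. by move=> <-; rewrite (expand_det_row _ 0) !big_ord_recl big_ord0 /cofactor !det_mx11 !mxE /=; ring. Qed.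

Definition tilde_mx (Q M : 'M[int]_2) : 'M[int]_2 := Q *m M *m invmx Q.

Definition tilde_digits (Q : 'M[int]_2) (D : {fset 'cV[int]_2}) :
  {fset 'cV[int]_2} := [fset Q *m d | d in D].

Lemma tilde_digitsE (a1 a2 b1 b2 a t1 t2 p q gamma : int) (eta : nat) :
  a != 0 -> a1 = a * t1 -> a2 = a * t2 -> p * t1 + q * t2 = 1 ->
  a1 * b2 - a2 * b1 = 2 ^+ eta * gamma -> ~~ (2 %| a)%Z ->
  tilde_digits (Qmx p q t1 t2) (digits a1 a2 b1 b2) =
  digits a 0 (p * b1 + q * b2) (2 ^+ eta * (gamma %/ a)%Z).
Proof.
move=> a0 -> -> ptq det odda.
have gE : gamma = (gamma %/ a)%Z * a.
  apply/esym/eqP; rewrite -/(is_true _) -dvdz_eq.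
  rewrite -(@Gauss_dvdzr _ (2 ^+ eta)); last first.
    apply: coprimezXr.
    rewrite coprimezE; move: odda; rewrite dvdzE dvdn2 negbK => odda.
    by rewrite coprime_sym coprime2n.
  by rewrite -det; apply/dvdzP; exists (t1 * b2 - t2 * b1); ring.
have tE : 2 ^+ eta * (gamma %/ a)%Z = t1 * b2 - t2 * b1.
  apply: (mulIf a0); rewrite -mulrA -gE -det; ring.
have QE x y : Qmx p q t1 t2 *m col2 x y = col2 (p * x + q * y) (t1 * y - t2 * x).
  apply/matrixP => i j; rewrite !mxE !big_ord_recl big_ord0 !mxE /=.
  by case: (i == 0) => /=; ring.
rewrite /tilde_digits /digits !imfsetU !imfset_fset1 mulmx0 !QE tE.
have -> : p * (a * t1) + q * (a * t2) = a by rewrite -[RHS]mulr1 -ptq; ring.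
have -> : t1 * (a * t2) - t2 * (a * t1) = 0 by ring.
have -> : p * (- (a * t1) - b1) + q * (- (a * t2) - b2) = - a - (p * b1 + q * b2).
  by rewrite -[X in _ = - X - _]mulr1 -ptq; ring.
by have -> : t1 * (- (a * t2) - b2) - t2 * (- (a * t1) - b1)
   = - 0 - (t1 * b2 - t2 * b1) by ring.
Qed.
Arguments integer_points : clear implicits.
Arguments half_points : clear implicits.

(* Main.v *)
Require Import Defs.
From HB Require Import structures.
From mathcomp Require Import all_boot all_order all_algebra.
From mathcomp Require Import finmap complex ring lra zify.
From mathcomp Require Import all_classical all_reals all_analysis.
From mathcomp Require Import measurable_realfun.

Set Implicit Arguments.
Unset Strict Implicit.
Unset Printing Implicit Defensive.

Import Order.TTheory GRing.Theory Num.Theory.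
Import numFieldNormedType.Exports.

Local Open Scope fset_scope.
Local Open Scope classical_set_scope.
Local Open Scope ring_scope.
Local Open Scope complex_scope.

(** The measure enters through its Fourier transform
    [fourier mu xi = dmask (T xi) * dmask (T^2 xi) * ...], where [T] is the
    inverse transpose of the matrix and [dmask xi] is the average of the
    characters of frequency [xi] over the four digits. Differences of frequencies
    of an orthogonal set of characters are zeros of [fourier mu], so everything
    rests on the zeros of [dmask]. Four unimodular numbers with product [1] sum
    to [0] only when they are signs, two of each; hence [dmask xi = 0] exactly
    when the products of [2 xi] with the two digits that span are integers, not
    both even ([dmask_eq0], [dmask_half0]). Since the determinant of these
    digits is odd when [eta = 0], the digits represent the four classes modulo
    [2], and the four translates of [dmask] by half-integers have squared
    moduli that sum to [1] ([dmask_unit_square]).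

    The equivalence of evenness with integrality at the half points is
    elementary. If the matrix is even, its transpose maps the four half points
    to integer vectors, and these form an admissible set of frequencies
    ([admissible_of_even]). Conversely an admissible set has four elements whose
    differences lie in the zero set, so they fill all parity classes, and this
    forces every entry of the matrix to be even ([even_of_admissible]).

    If [mu] is spectral, then the matrix is even ([spectral_even]). A single
    level of the measure does not suffice, because its pieces may overlap. In a
    generic direction [u], however, one second-level piece reaches further than
    the other fifteen, and a half-space cuts off a set [U] that meets this piece
    only ([isolated_piece]). Parseval's identity for the indicator of [U] says
    that the rescaled frequencies [T^2 l] carry sixteen times the mass of the
    rescaled set ([isolated_parseval]). They split into sixteen classes
    according to the parities left by two successive levels of the zero set;
    each class is orthogonal, hence carries at most the mass once by Bessel's
    inequality. So no class is empty, and the classes that are trivial at the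
    first level and arbitrary at the second give evenness.

    If the matrix is even, then [mu] is spectral ([spectral_of_even]). The
    transpose of the matrix maps half-integer vectors to integer ones, so the
    four-element spectra of the levels compose to spectra of the convolutions
    of finitely many factors of [mu] ([spec_compose]). An increasing union
    of them is an orthogonal set for [mu], but completeness may be lost in the
    limit. It is kept when the rescaled frequencies stay where [fourier mu] is
    bounded below ([tower_parseval]), and each frequency may be translated
    by images of the lattice [gam] of common periods of the masks to achieve this
    ([tower]). Such translations exist because [fourier mu] does not vanish
    identically on a translate of [gam]: a point where it did would have, among
    its four preimages modulo integer vectors, exactly one of the same kind, the mask
    having modulus [1] there; doing this twice lands in [gam], where
    [fourier mu] takes the value [1] at a translate, namely at [0]
    ([no_periodic_zero]). Compactness of the unit square makes the bound uniform
    ([uniform_reach]).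

    Passing from Parseval's identity for all characters to totality in [L^2]
    needs the density of trigonometric polynomials for a measure of bounded
    support ([cspan_L2]). The real functions by which the closed span is stable
    contain sines, hence, by a polynomial threshold, the indicators of
    half-spaces; they are closed under bounded pointwise limits, so they contain
    all indicators of Borel sets. *)

(** * The circle *)

Lemma ord2P (i : 'I_2) : i \in [:: 0; 1].
Proof. by case: i => -[|[|//]] /= ?; rewrite !inE. Qed.

Section Exponentials.
Variable R : realType.
Implicit Types (z w : R[i]) (t : R).

Definition sqn z : R := complex.Re z ^+ 2 + complex.Im z ^+ 2.

Lemma normc_sqn z : Normc.normc z ^+ 2 = sqn z.
Proof. by case: z => a b; rewrite /sqn /= sqr_sqrtr // addr_ge0 ?sqr_ge0. Qed.

Lemma sqn_ge0 z : 0 <= sqn z.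
Proof. by rewrite addr_ge0 ?sqr_ge0. Qed.

Lemma sqnM z w : sqn (z * w) = sqn z * sqn w.
Proof. by case: z w => a b [c d]; rewrite /sqn /=; ring. Qed.

Lemma sqn0 : sqn 0 = 0.
Proof. by rewrite /sqn /= expr0n addr0. Qed.

Lemma sqn1 : sqn 1 = 1.
Proof. by rewrite /sqn /= expr0n expr1n addr0. Qed.

Lemma sqnN z : sqn (- z) = sqn z.
Proof. by case: z => a b; rewrite /sqn /=; ring. Qed.

Lemma sqnJ z : sqn (conjc z) = sqn z.
Proof. by case: z => a b; rewrite /sqn /=; ring. Qed.

Lemma sqn_eq0 z : (sqn z == 0) = (z == 0).
Proof.
by case: z => a b; rewrite /sqn eq_complex /= paddr_eq0 ?sqr_ge0 // !sqrf_eq0.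
Qed.

Lemma mulJ_sqn z : z * conjc z = (sqn z)%:C.
Proof. by case: z => a b; rewrite /sqn; simpc; congr (_ +i* _); ring. Qed.

Lemma sqn_real t : sqn t%:C = t ^+ 2.
Proof. by rewrite /sqn /= expr0n addr0. Qed.

Lemma sqnD_le z w : sqn (z + w) <= 2 * sqn z + 2 * sqn w.
Proof.
case: z w => a b [c d]; rewrite /sqn /= -subr_ge0.
have -> : 2 * (a ^+ 2 + b ^+ 2) + 2 * (c ^+ 2 + d ^+ 2) -
  ((a + c) ^+ 2 + (b + d) ^+ 2) = (a - c) ^+ 2 + (b - d) ^+ 2 by ring.
by rewrite addr_ge0 ?sqr_ge0.
Qed.

Lemma cis0 : cis 0 = 1 :> R[i].
Proof. by rewrite /cis cos0 sin0. Qed.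

Lemma cisD t u : cis (t + u) = cis t * cis u.
Proof. by rewrite /cis cosD sinD; simpc; congr (_ +i* _); ring. Qed.

Lemma cisN t : cis (- t) = conjc (cis t).
Proof. by rewrite /cis cosN sinN. Qed.

Lemma sqn_cis t : sqn (cis t) = 1.
Proof. by rewrite /sqn /= cos2Dsin2. Qed.

Lemma cisJ t : cis t * conjc (cis t) = 1.
Proof. by rewrite mulJ_sqn sqn_cis. Qed.

Lemma cis_2pi_nat (n : nat) : cis (2 * pi * n%:R) = 1 :> R[i].
Proof.
elim: n => [|n IH]; first by rewrite mulr0 cis0.
rewrite -[n.+1%:R]natr1 mulrDr mulr1 cisD IH mul1r.
by rewrite /cis mulrC mulr_natr cos2pi sin2pi.
Qed.

Lemma cis_2pi_int (m : int) : cis (2 * pi * m%:~R) = 1 :> R[i].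
Proof.
case: m => n; first exact: cis_2pi_nat.
by rewrite NegzE mulrNz mulrN cisN cis_2pi_nat conjc1.
Qed.

(** Away from the integers the half angle has a nonzero sine. *)
Lemma cis_eq1 t : cis (2 * pi * t) = 1 -> exists m : int, t = m%:~R.
Proof.
move=> tE; exists (Num.floor t).
set r := t - (Num.floor t)%:~R.
have r0 : 0 <= r by rewrite subr_ge0 floor_le.
have r1 : r < 1 by rewrite ltrBlDl -intrD1 floorD1_gt.
have rE : cis (2 * pi * r) = 1.
  by rewrite /r mulrBr cisD tE mul1r -mulrN -intrN cis_2pi_int.
suff : r = 0 by move/eqP; rewrite subr_eq0 => /eqP.
apply/eqP; case: (eqVneq r 0) => // rn0; exfalso.
have rp : 0 < r by rewrite lt_neqAle eq_sym rn0.
have : 0 < sin (pi * r).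
  apply: sin_gt0_pi; rewrite mulr_gt0 ?pi_gt0 //=.
  by rewrite -[ltRHS]mulr1 ltr_pM2l ?pi_gt0.
have : cos (2 * pi * r) = 1 by case: rE.
have -> : 2 * pi * r = (pi * r) *+ 2 by rewrite -mulrA mulr_natl.
rewrite cos_mulr2n cos2sin2 => E.
have : sin (pi * r) ^+ 2 = 0 by lra.
by move/eqP; rewrite sqrf_eq0 => /eqP ->; rewrite ltxx.
Qed.

Lemma cis_lip t u :
  `|cos t - cos u| <= `|t - u| /\ `|sin t - sin u| <= `|t - u|.
Proof.
wlog tu : t u / t < u.
  move=> H; case: (ltgtP t u) => [|tu|->]; first exact: H.
    by have [] := H u t tu; rewrite !(distrC u) (distrC (cos u)) (distrC (sin u)).
  by rewrite !subrr normr0.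
have cC (f : R -> R) : continuous f -> {within `[t, u], continuous f}.
  by move=> cf; exact: continuous_subspaceT.
split.
  have [c _ E] := MVT tu (fun x _ => is_derive_cos x) (cC _ (@continuous_cos R)).
  rewrite (distrC t) (distrC (cos t)) E normrM normrN.
  by rewrite ler_piMl ?sin_max.
have [c _ E] := MVT tu (fun x _ => is_derive_sin x) (cC _ (@continuous_sin R)).
rewrite (distrC t) (distrC (sin t)) E normrM.
by rewrite ler_piMl ?cos_max.
Qed.

End Exponentials.

(** * Borel measurability on the space of column vectors *)

Section RealFunctions.
Variables (R : realType) (n : nat).
Local Notation X := (borelRn R n).

Lemma continuous_borel (f : 'cV[R]_n -> R) :
  continuous f -> measurable_fun setT (f : X -> R).
Proof.
move=> /continuousP cf.
apply: (measurability _ (RGenOpens.measurableE R)).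
move=> _ [_ [a [b ->] <-]]; rewrite setTI.
by apply: sub_sigma_algebra; apply: cf; exact: interval_open.
Qed.

Lemma continuous_dot (u : 'cV[R]_n) : continuous (dot u).
Proof.
move=> x; rewrite /dot.
have FF : Filter (nbhs x) := nbhs_filter x.
apply: (@cvg_big _ _ +%R 0 xpredT) => [|i _].
  exact: add_continuous.
by apply: cvgM; [exact: cvg_cst | exact: coord_continuous].
Qed.

Lemma measurable_dot (u : 'cV[R]_n) : measurable_fun setT (dot u : X -> R).
Proof. by apply: continuous_borel; exact: continuous_dot. Qed.

Lemma continuous_coordP (T : topologicalType) (f : T -> 'cV[R]_n) :
  (forall i, continuous (fun x => f x i 0)) -> continuous f.
Proof.
move=> cf x A [P xP PA].
have : \forall y \near x, forall i, P i 0 (f y i 0).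
  have FF : Filter (nbhs x) := nbhs_filter x.
  apply: (@filter_forall _ _ (fun i y => P i 0 (f y i 0)) (nbhs x)) => i.
  by apply: (cf i x); exact: xP.
apply: filterS => y Py; apply: PA => i j; rewrite (ord1 j); exact: Py.
Qed.

Lemma measurable_affine (M : 'M[R]_n) (d : 'cV[R]_n) :
  measurable_fun setT (affine_map M d : X -> X).
Proof.
apply: (@measurability _ _ X X setT _ (@open 'cV[R]_n)) => //.
move=> _ [A oA <-]; rewrite setTI; apply: sub_sigma_algebra.
have /continuousP : continuous (affine_map M d : 'cV[R]_n -> 'cV[R]_n).
  apply: (@continuous_coordP 'cV[R]_n) => i x.
  have -> : (fun y => affine_map M d y i 0) =
            (fun y => dot (\col_j invmx M i j) y + (invmx M *m d) i 0).
    apply/funext => y; rewrite /affine_map mulmxDr mxE; congr (_ + _).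
    by rewrite mxE /dot; apply: eq_bigr => j _; rewrite mxE.
  apply: (@continuousD _ _ _ (dot _) (fun=> _) x); last exact: cst_continuous.
  exact: continuous_dot.
exact.
Qed.

End RealFunctions.

(** * Integrals of bounded complex functions *)

Section ComplexIntegral.
Variables (R : realType) (n : nat) (mu : probability (borelRn R n) R).
Local Notation X := (borelRn R n).
Implicit Types f g : X -> R[i].

(** Boundedness and measurability together give integrability against a
    probability measure, and both are stable by the algebraic operations;
    all integrals of products below are taken in this class, and general
    square-integrable functions are reached by approximation. *)
Definition bmr (f : X -> R) : Prop :=
  measurable_fun setT f /\ exists C : R, forall x, `|f x| <= C.

Definition bmc f : Prop :=
  bmr (fun x => complex.Re (f x)) /\ bmr (fun x => complex.Im (f x)).

Lemma bmr_integrable (f : X -> R) : bmr f -> mu.-integrable setT (EFin \o f).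
Proof.
case=> mf [C fC]; apply: measurable_bounded_integrable => //.
  exact: le_lt_trans (probability_le1 mu measurableT) (ltry 1).
exists C; split; first exact: num_real.
by move=> D CD x _; apply: le_trans (fC x) (ltW CD).
Qed.

Lemma bmr_cst (c : R) : bmr (fun=> c).
Proof. by split; [exact: measurable_cst | exists `|c|]. Qed.

Lemma bmrD (f g : X -> R) : bmr f -> bmr g -> bmr (fun x => f x + g x).
Proof.
case=> mf [C fC] [mg [D gD]]; split; first exact: measurable_funD.
by exists (C + D) => x; apply: le_trans (ler_normD _ _) (lerD _ _).
Qed.

Lemma bmrM (f g : X -> R) : bmr f -> bmr g -> bmr (fun x => f x * g x).
Proof.
case=> mf [C fC] [mg [D gD]]; split; first exact: measurable_funM.
by exists (C * D) => x; rewrite normrM ler_pM.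
Qed.

Lemma bmrN (f : X -> R) : bmr f -> bmr (fun x => - f x).
Proof.
move=> bf; have := bmrM (bmr_cst (-1)) bf.
by congr bmr; apply/funext => x; rewrite mulN1r.
Qed.

Lemma bmrB (f g : X -> R) : bmr f -> bmr g -> bmr (fun x => f x - g x).
Proof. by move=> bf bg; apply: bmrD => //; exact: bmrN. Qed.

Lemma bmc_cst (c : R[i]) : bmc (fun=> c).
Proof. by split; exact: bmr_cst. Qed.

Lemma bmcD f g : bmc f -> bmc g -> bmc (fun x => f x + g x).
Proof.
case=> fr fi [gr gi]; split.
  have := bmrD fr gr; congr bmr; apply/funext => x.
  by case: (f x) (g x) => ? ? [].
have := bmrD fi gi; congr bmr; apply/funext => x.
by case: (f x) (g x) => ? ? [].
Qed.

Lemma bmcM f g : bmc f -> bmc g -> bmc (fun x => f x * g x).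
Proof.
case=> fr fi [gr gi]; split.
  have := bmrB (bmrM fr gr) (bmrM fi gi); congr bmr; apply/funext => x.
  by case: (f x) (g x) => ? ? [].
have := bmrD (bmrM fr gi) (bmrM fi gr); congr bmr; apply/funext => x.
by case: (f x) (g x) => ? ? [].
Qed.

Lemma bmcN f : bmc f -> bmc (fun x => - f x).
Proof.
move=> bf; have := bmcM (bmc_cst (-1)) bf.
by congr bmc; apply/funext => x; rewrite mulN1r.
Qed.

Lemma bmcB f g : bmc f -> bmc g -> bmc (fun x => f x - g x).
Proof. by move=> bf bg; apply: bmcD => //; exact: bmcN. Qed.

Lemma bmcJ f : bmc f -> bmc (fun x => conjc (f x)).
Proof.
case=> fr fi; split.
  by have := fr; congr bmr; apply/funext => x; case: (f x).
by have := bmrN fi; congr bmr; apply/funext => x; case: (f x).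
Qed.

Lemma bmc_sum (I : Type) (s : seq I) (F : I -> X -> R[i]) :
  (forall i, bmc (F i)) -> bmc (fun x => \sum_(i <- s) F i x).
Proof.
move=> bF; elim: s => [|i s IH].
  by have := bmc_cst 0; congr bmc; apply/funext => x; rewrite big_nil.
have := bmcD (bF i) IH.
by congr bmc; apply/funext => x; rewrite big_cons.
Qed.

Lemma bmc_real (f : X -> R) : bmr f -> bmc (fun x => (f x)%:C).
Proof. by move=> bf; split => //; exact: bmr_cst. Qed.

Lemma bmr_indic (E : set X) : measurable E -> bmr (\1_E : X -> R).
Proof.
move=> mE; split; first exact: measurable_indic.
by exists 1 => x; rewrite indicE; case: (_ \in _); rewrite ?normr1 ?normr0.
Qed.

Lemma bmc_indic (E : set X) : measurable E -> bmc (fun x => (\1_E x : R)%:C).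
Proof. by move=> mE; apply: bmc_real; exact: bmr_indic. Qed.

Lemma bmc_expo (l : 'cV[R]_n) : bmc (expo l).
Proof.
have m2 : measurable_fun setT (fun x : X => 2 * pi * dot l x).
  by apply: measurable_funM => //; exact: measurable_dot.
split; split.
- apply: (@measurableT_comp _ _ _ _ _ _ (@cos R)) => //.
  by apply: continuous_measurable_fun; exact: continuous_cos.
- by exists 1 => x /=; rewrite cos_max.
- apply: (@measurableT_comp _ _ _ _ _ _ (@sin R)) => //.
  by apply: continuous_measurable_fun; exact: continuous_sin.
- by exists 1 => x /=; rewrite sin_max.
Qed.

Lemma bmc_comp f (phi : X -> X) :
  measurable_fun setT phi -> bmc f -> bmc (fun x => f (phi x)).
Proof.
move=> mphi [[mr [C rC]] [mi [D iD]]]; split; split.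
- exact: (measurableT_comp mr mphi).
- by exists C => x; exact: rC.
- exact: (measurableT_comp mi mphi).
- by exists D => x; exact: iD.
Qed.

Lemma Cintegral_add f g : bmc f -> bmc g ->
  Cintegral mu (fun x => f x + g x) = Cintegral mu f + Cintegral mu g.
Proof.
case=> fr fi [gr gi]; rewrite /Cintegral; simpc.
rewrite -!RintegralD //; try exact: bmr_integrable.
congr (_ +i* _); apply: eq_Rintegral => x _; by case: (f x) (g x) => ? ? [].
Qed.

Lemma Cintegral_scale (c : R[i]) f : bmc f ->
  Cintegral mu (fun x => c * f x) = c * Cintegral mu f.
Proof.
case: c => a b [fr fi]; rewrite /Cintegral; simpc.
have bI (h : X -> R) (k : R) : bmr h -> mu.-integrable setT (EFin \o (fun x => k * h x)).
  by move=> bh; apply: bmr_integrable; apply: bmrM => //; exact: bmr_cst.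
rewrite -!RintegralZl //; try exact: bmr_integrable.
rewrite -RintegralB //; try exact: bI.
rewrite -RintegralD //; try exact: bI.
congr (_ +i* _); apply: eq_Rintegral => x _; by case: (f x).
Qed.

Lemma Cintegral_opp f : bmc f ->
  Cintegral mu (fun x => - f x) = - Cintegral mu f.
Proof.
move=> bf; rewrite -mulN1r -Cintegral_scale //.
by congr Cintegral; apply/funext => x; rewrite mulN1r.
Qed.

Lemma Cintegral_conj f : bmc f ->
  Cintegral mu (fun x => conjc (f x)) = conjc (Cintegral mu f).
Proof.
case=> fr fi; rewrite /Cintegral /=; congr (_ +i* _).
  by apply: eq_Rintegral => x _; case: (f x).
rewrite -mulN1r -RintegralZl //; last exact: bmr_integrable.
by apply: eq_Rintegral => x _; case: (f x) => ? ?; rewrite mulN1r.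
Qed.

Lemma Rintegral_prob_cst (c : R) : \int[mu]_x c = c.
Proof.
have mu1 : fine (mu setT) = 1 by rewrite (@probability_setT _ _ _ mu).
by rewrite Rintegral_cst // mu1 mulr1.
Qed.

Lemma Cintegral_cst (c : R[i]) : Cintegral mu (fun=> c) = c.
Proof. by rewrite /Cintegral !Rintegral_prob_cst; case: c. Qed.

Lemma Cintegral_sum (I : Type) (s : seq I) (F : I -> X -> R[i]) :
  (forall i, bmc (F i)) ->
  Cintegral mu (fun x => \sum_(i <- s) F i x) =
  \sum_(i <- s) Cintegral mu (F i).
Proof.
move=> bF; elim: s => [|i s IH].
  rewrite big_nil -[RHS](Cintegral_cst 0).
  by congr Cintegral; apply/funext => x; rewrite big_nil.
rewrite big_cons -IH -Cintegral_add //; last exact: bmc_sum.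
by congr Cintegral; apply/funext => x; rewrite big_cons.
Qed.

Lemma Cintegral_real (f : X -> R) :
  Cintegral mu (fun x => (f x)%:C) = (\int[mu]_x f x)%:C.
Proof. by rewrite /Cintegral /= Rintegral_prob_cst. Qed.

Lemma Cintegral_indic (E : set X) : measurable E ->
  Cintegral mu (fun x => (\1_E x : R)%:C) = (fine (mu E))%:C.
Proof.
move=> mE; rewrite Cintegral_real /Rintegral integral_indic // setIT //.
Qed.

End ComplexIntegral.

(** * Characters *)

Section Characters.
Variables (R : realType) (n : nat).
Implicit Types (l x y : 'cV[R]_n).

Lemma dotDl l l' x : dot (l + l') x = dot l x + dot l' x.
Proof.
by rewrite /dot -big_split; apply: eq_bigr => i _; rewrite mxE mulrDl.
Qed.

Lemma dotDr l x y : dot l (x + y) = dot l x + dot l y.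
Proof.
by rewrite /dot -big_split; apply: eq_bigr => i _; rewrite mxE mulrDr.
Qed.

Lemma dotNl l x : dot (- l) x = - dot l x.
Proof. by rewrite /dot -sumrN; apply: eq_bigr => i _; rewrite mxE mulNr. Qed.

Lemma dotBl l l' x : dot (l - l') x = dot l x - dot l' x.
Proof. by rewrite dotDl dotNl. Qed.

Lemma dot0l x : dot 0 x = 0.
Proof. by rewrite /dot big1 // => i _; rewrite mxE mul0r. Qed.

Lemma dot0r l : dot l 0 = 0.
Proof. by rewrite /dot big1 // => i _; rewrite mxE mulr0. Qed.

Lemma dotZl (k : R) l x : dot (k *: l) x = k * dot l x.
Proof. by rewrite /dot mulr_sumr; apply: eq_bigr => i _; rewrite mxE mulrA. Qed.

Lemma dotZr (k : R) l x : dot l (k *: x) = k * dot l x.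
Proof. by rewrite /dot mulr_sumr; apply: eq_bigr => i _; rewrite mxE mulrCA. Qed.

Lemma dotC l x : dot l x = dot x l.
Proof. by apply: eq_bigr => i _; rewrite mulrC. Qed.

Lemma dot_delta i x : dot (delta_mx i 0) x = x i 0.
Proof.
rewrite /dot (bigD1 i) //= big1 ?addr0 => [|j /negbTE ji].
  by rewrite mxE !eqxx mul1r.
by rewrite mxE ji mul0r.
Qed.

Lemma dotE l x : dot l x = (l^T *m x) 0 0.
Proof. by rewrite mxE; apply: eq_bigr => i _; rewrite mxE. Qed.

Lemma dot_mulmx (B : 'M[R]_n) l x : dot l (B *m x) = dot (B^T *m l) x.
Proof. by rewrite !dotE trmx_mul trmxK mulmxA. Qed.

Lemma expoD l l' x : expo (l + l') x = expo l x * expo l' x.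
Proof. by rewrite /expo dotDl mulrDr cisD. Qed.

Lemma expoDr l x y : expo l (x + y) = expo l x * expo l y.
Proof. by rewrite /expo dotDr mulrDr cisD. Qed.

Lemma expoN l x : expo (- l) x = conjc (expo l x).
Proof. by rewrite /expo dotNl mulrN cisN. Qed.

Lemma expoB l l' x : expo (l - l') x = expo l x * conjc (expo l' x).
Proof. by rewrite expoD expoN. Qed.

Lemma expo0 x : expo 0 x = 1.
Proof. by rewrite /expo dot0l mulr0 cis0. Qed.

Lemma expo0r l : expo l 0 = 1.
Proof. by rewrite /expo dot0r mulr0 cis0. Qed.

Lemma expo_mulmx (B : 'M[R]_n) l x : expo l (B *m x) = expo (B^T *m l) x.
Proof. by rewrite /expo dot_mulmx. Qed.

Lemma sqn_expo l x : sqn (expo l x) = 1.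
Proof. exact: sqn_cis. Qed.

Lemma expoC l x : expo l x = expo x l.
Proof. by rewrite /expo dotC. Qed.

End Characters.

(** * Fourier coefficients, Pythagoras and Bessel *)

Section Orthogonality.
Variables (R : realType) (n : nat) (mu : probability (borelRn R n) R).
Local Notation X := (borelRn R n).
Implicit Types (f g : X -> R[i]) (l : 'cV[R]_n).

Definition fourier l : R[i] := Cintegral mu (expo l).

Definition coef f l : R[i] := Cintegral mu (fun x => f x * conjc (expo l x)).

Lemma L2dot_expo l l' : L2dot mu (expo l) (expo l') = fourier (l - l').
Proof. by congr Cintegral; apply/funext => x; rewrite expoB. Qed.

Lemma coef_expo l l' : coef (expo l) l' = fourier (l - l').
Proof. exact: L2dot_expo. Qed.

Lemma fourier0 : fourier 0 = 1.
Proof.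
rewrite /fourier -[RHS](Cintegral_cst mu).
by congr Cintegral; apply/funext => x; rewrite expo0.
Qed.

Lemma fourierN l : fourier (- l) = conjc (fourier l).
Proof.
rewrite /fourier -Cintegral_conj; last exact: bmc_expo.
by congr Cintegral; apply/funext => x; rewrite expoN.
Qed.

(** Characters have norm [1], so orthonormality of distinct characters
    amounts to the vanishing of the transform at the differences. *)
Definition orth_freq (s : seq 'cV[R]_n) : Prop :=
  uniq s /\ {in s &, forall l l', l != l' -> fourier (l - l') = 0}.

Lemma bmr_sqn f : bmc f -> bmr (fun x => sqn (f x)).
Proof.
by case=> fr fi; rewrite /sqn; apply: bmrD; rewrite /GRing.exp /=; apply: bmrM.
Qed.

Lemma Cintegral_sqn f :
  Cintegral mu (fun x => f x * conjc (f x)) = (\int[mu]_x sqn (f x))%:C.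
Proof.
rewrite -Cintegral_real; congr Cintegral; apply/funext => x.
by rewrite mulJ_sqn.
Qed.

Lemma conjcM (a c : R[i]) : (conjc (a * c)) = conjc a * conjc c.
Proof. exact: rmorphM. Qed.

Lemma conjcD (a c : R[i]) : conjc (a + c) = conjc a + conjc c.
Proof. exact: rmorphD. Qed.

Lemma conjcN (a : R[i]) : conjc (- a) = - conjc a.
Proof. exact: rmorphN. Qed.

Lemma conjcB (a c : R[i]) : (conjc (a - c)) = conjc a - conjc c.
Proof. exact: rmorphB. Qed.

Lemma conjc_sum (I : Type) (s : seq I) (F : I -> R[i]) :
  (conjc (\sum_(i <- s) F i)) = \sum_(i <- s) (conjc (F i)).
Proof. exact: rmorph_sum. Qed.

Lemma sqnB_expand (a c : R[i]) :
  (sqn (c - a))%:C = (sqn a)%:C - conjc c * a - conjc ((conjc c) * a) + (sqn c)%:C.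
Proof.
case: a c => a1 a2 [c1 c2]; rewrite /sqn; simpc.
by congr (_ +i* _); rewrite /=; ring.
Qed.

(** The Pythagorean identity: the distance from [f] to a combination of
    orthonormal characters splits into the distance to the projection and the
    error made on the coefficients. *)
Lemma pythagoras f (c : 'cV[R]_n -> R[i]) s : bmc f -> orth_freq s ->
  \int[mu]_x sqn (f x - \sum_(l <- s) c l * expo l x) =
  \int[mu]_x sqn (f x) - \sum_(l <- s) sqn (coef f l)
    + \sum_(l <- s) sqn (c l - coef f l).
Proof.
move=> bf [us os]; apply: complexI.
have bce l : bmc (fun x : X => c l * expo l x).
  by apply: bmcM; [exact: bmc_cst | exact: bmc_expo].
set g := fun x : X => \sum_(l <- s) c l * expo l x.
have gJ x : (conjc (g x)) = \sum_(l <- s) (conjc (c l * expo l x)) by exact: conjc_sum.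
have bg : bmc g by apply: bmc_sum.
have fgE : Cintegral mu (fun x => f x * conjc (g x)) =
           \sum_(l <- s) (conjc (c l)) * coef f l.
  rewrite /coef.
  under eq_bigr => l _.
    rewrite -Cintegral_scale; last by apply: bmcM => //; apply/bmcJ/bmc_expo.
    over.
  rewrite -Cintegral_sum.
    congr Cintegral; apply/funext => x; rewrite gJ mulr_sumr.
    by apply: eq_bigr => l _; rewrite conjcM mulrCA.
  move=> l; apply: bmcM; first exact: bmc_cst.
  by apply: bmcM => //; apply/bmcJ/bmc_expo.
have gfE : Cintegral mu (fun x => g x * conjc (f x)) =
           \sum_(l <- s) (conjc ((conjc (c l)) * coef f l)).
  rewrite -conjc_sum -fgE -Cintegral_conj.
    by congr Cintegral; apply/funext => x; rewrite conjcM conjcK mulrC.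
  by apply: bmcM => //; exact: bmcJ.
have ggE : Cintegral mu (fun x => g x * conjc (g x)) = \sum_(l <- s) (sqn (c l))%:C.
  transitivity (\sum_(l <- s) \sum_(l' <- s) c l * conjc (c l') * fourier (l - l')).
    rewrite /fourier.
    under eq_bigr => l _.
      under eq_bigr => l' _.
        rewrite -Cintegral_scale; last exact: bmc_expo.
        over.
      rewrite -Cintegral_sum; last first.
        by move=> l'; apply: bmcM; [exact: bmc_cst | exact: bmc_expo].
      over.
    rewrite -Cintegral_sum; last first.
      move=> l; apply: bmc_sum => l'.
      by apply: bmcM; [exact: bmc_cst | exact: bmc_expo].
    congr Cintegral; apply/funext => x; rewrite gJ mulr_suml.
    apply: eq_bigr => l _; rewrite mulr_sumr; apply: eq_bigr => l' _.
    by rewrite expoB conjcM; ring.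
  apply: eq_big_seq => l sl; rewrite (bigD1_seq l) //= big_seq_cond big1.
    by rewrite addr0 subrr fourier0 mulr1 mulJ_sqn.
  by move=> l' /andP[sl' nl']; rewrite os ?mulr0 // eq_sym.
transitivity (Cintegral mu (fun x => f x * conjc (f x))
    - Cintegral mu (fun x => f x * conjc (g x))
    - Cintegral mu (fun x => g x * conjc (f x))
    + Cintegral mu (fun x => g x * conjc (g x))).
  have bffJ := bmcM bf (bmcJ bf).
  have bfgJ := bmcM bf (bmcJ bg).
  have bgfJ := bmcM bg (bmcJ bf).
  have bggJ := bmcM bg (bmcJ bg).
  rewrite -Cintegral_sqn -!Cintegral_opp // -!Cintegral_add //.
  - by congr Cintegral; apply/funext => x; rewrite -/(g x) conjcB; ring.
  - by apply: bmcD; [apply: bmcD => //|]; exact: bmcN.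
  - by apply: bmcD => //; exact: bmcN.
  - exact: bmcN.
  - exact: bmcN.
rewrite Cintegral_sqn fgE gfE ggE rmorphD rmorphB !rmorph_sum /=.
under [X in _ = _ + X]eq_bigr do rewrite sqnB_expand.
rewrite !big_split /= !sumrN; ring.
Qed.

Lemma bessel f s : bmc f -> orth_freq s ->
  \sum_(l <- s) sqn (coef f l) <= \int[mu]_x sqn (f x).
Proof.
move=> bf os; rewrite -subr_ge0.
have := pythagoras (coef f) bf os.
rewrite [X in _ = _ + X]big1 ?addr0 => [<-|l _]; last by rewrite subrr sqn0.
by apply: Rintegral_ge0 => x _; exact: sqn_ge0.
Qed.

Lemma sqn_Cintegral_le f : bmc f ->
  sqn (Cintegral mu f) <= \int[mu]_x sqn (f x).
Proof.
move=> bf; have os : orth_freq [:: 0].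
  by split => // l l' /[!inE] /eqP -> /eqP ->; rewrite eqxx.
have := bessel bf os; rewrite big_seq1; congr (_ <= _).
by congr (sqn (Cintegral mu _)); apply/funext => x; rewrite expo0 conjc1 mulr1.
Qed.

Lemma sqn_fourier_le1 l : sqn (fourier l) <= 1.
Proof.
apply: le_trans (sqn_Cintegral_le (bmc_expo l)) _.
rewrite (@eq_Rintegral _ _ _ mu _ (fun=> 1)).
  by rewrite Rintegral_prob_cst.
by move=> x _; rewrite sqn_expo.
Qed.

End Orthogonality.

(** * The closed span of a set of characters *)

Section ClosedSpan.
Variables (R : realType) (n : nat) (mu : probability (borelRn R n) R).
Local Notation X := (borelRn R n).
Implicit Types (f g h : X -> R[i]) (L : set 'cV[R]_n) (E : set X).

Definition cmeas f : Prop :=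
  measurable_fun setT (fun x => complex.Re (f x)) /\
  measurable_fun setT (fun x => complex.Im (f x)).

Lemma bmc_cmeas f : bmc f -> cmeas f.
Proof. by case=> -[mr _] [mi _]; split. Qed.

Lemma cmeasD f g : cmeas f -> cmeas g -> cmeas (fun x => f x + g x).
Proof.
case=> fr fi [gr gi]; split.
  have := measurable_funD fr gr; congr (measurable_fun _); apply/funext => x.
  by rewrite /=; case: (f x) (g x) => ? ? [].
have := measurable_funD fi gi; congr (measurable_fun _); apply/funext => x.
by rewrite /=; case: (f x) (g x) => ? ? [].
Qed.

Lemma cmeasM f g : cmeas f -> cmeas g -> cmeas (fun x => f x * g x).
Proof.
case=> fr fi [gr gi]; split.
  have := measurable_funB (measurable_funM fr gr) (measurable_funM fi gi).
  congr (measurable_fun _); apply/funext => x.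
  by rewrite /=; case: (f x) (g x) => ? ? [].
have := measurable_funD (measurable_funM fr gi) (measurable_funM fi gr).
congr (measurable_fun _); apply/funext => x.
by rewrite /=; case: (f x) (g x) => ? ? [].
Qed.

Lemma cmeasN f : cmeas f -> cmeas (fun x => - f x).
Proof.
move=> mf; have := cmeasM (bmc_cmeas (bmc_cst n (-1))) mf.
by congr cmeas; apply/funext => x; rewrite mulN1r.
Qed.

Lemma cmeasB f g : cmeas f -> cmeas g -> cmeas (fun x => f x - g x).
Proof. by move=> mf mg; apply: cmeasD => //; exact: cmeasN. Qed.

Lemma measurable_sqn f : cmeas f -> measurable_fun setT (fun x => sqn (f x)).
Proof.
case=> mr mi; rewrite /sqn.
by apply: measurable_funD; apply: measurable_funX.
Qed.

(** Squared norm of [L^2(mu)], possibly infinite. *)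
Definition nrm2 f : \bar R := (\int[mu]_x (sqn (f x))%:E)%E.

Lemma measurable_sqnE f : cmeas f -> measurable_fun setT (fun x => (sqn (f x))%:E).
Proof. by move=> mf; apply/measurable_EFinP; exact: measurable_sqn. Qed.

Lemma nrm2Z (c : R) f : 0 <= c -> cmeas f ->
  (\int[mu]_x (c * sqn (f x))%:E)%E = (c%:E * nrm2 f)%E.
Proof.
move=> c0 mf; rewrite /nrm2 -ge0_integralZl //.
- exact: measurable_sqnE.
- by move=> x _; rewrite lee_fin sqn_ge0.
Qed.

Lemma nrm2D f g : cmeas f -> cmeas g ->
  (nrm2 (fun x => f x + g x)%R <= 2%:E * nrm2 f + 2%:E * nrm2 g)%E.
Proof.
move=> mf mg; rewrite -!nrm2Z // -ge0_integralD //.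
- apply: ge0_le_integral => //.
  + by move=> x _; rewrite lee_fin sqn_ge0.
  + by apply: measurable_sqnE; exact: cmeasD.
  + apply: emeasurable_funD; apply/measurable_EFinP;
      apply: measurable_funM => //; exact: measurable_sqn.
  + by move=> x _; rewrite -EFinD lee_fin sqnD_le.
- by move=> x _; rewrite lee_fin mulr_ge0 ?sqn_ge0.
- by apply/measurable_EFinP; apply: measurable_funM => //; exact: measurable_sqn.
- by move=> x _; rewrite lee_fin mulr_ge0 ?sqn_ge0.
- by apply/measurable_EFinP; apply: measurable_funM => //; exact: measurable_sqn.
Qed.

Lemma nrm2_scale (c : R[i]) f : cmeas f ->
  nrm2 (fun x => c * f x) = ((sqn c)%:E * nrm2 f)%E.
Proof.
move=> mf; rewrite -nrm2Z ?sqn_ge0 //; apply: eq_integral => x _.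
by rewrite sqnM.
Qed.

Lemma nrm2_bmc f : bmc f -> nrm2 f = (\int[mu]_x sqn (f x))%:E.
Proof.
move=> bf; rewrite /nrm2 /Rintegral fineK //.
by apply: integrable_fin_num => //; apply: bmr_integrable; exact: bmr_sqn.
Qed.

Definition expo_comb L f : Prop :=
  exists (F : {fset 'cV[R]_n}) (c : 'cV[R]_n -> R[i]),
    [set` F] `<=` L /\ f = fun x => \sum_(l <- F) c l * expo l x.

Lemma bmc_tcomb L f : expo_comb L f -> bmc f.
Proof.
case=> F [c [_ ->]]; apply: bmc_sum => l.
by apply: bmcM; [exact: bmc_cst | exact: bmc_expo].
Qed.

Lemma expo_comb_cmeas L f : expo_comb L f -> cmeas f.
Proof. by move=> /bmc_tcomb/bmc_cmeas. Qed.

Lemma expo_combD L f g : expo_comb L f -> expo_comb L g -> expo_comb L (fun x => f x + g x).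
Proof.
case=> F [c [FL ->]] [G [d [GL ->]]].
pose cF l := if l \in F then c l else 0; pose dG l := if l \in G then d l else 0.
have ext (A B : {fset 'cV[R]_n}) (a : 'cV[R]_n -> R[i]) x : (A `<=` B)%fset ->
  \sum_(l <- A) a l * expo l x =
  \sum_(l <- B) (if l \in A then a l else 0) * expo l x.
  move=> AB; transitivity
      (\sum_(l <- A) (if l \in A then a l else 0) * expo l x).
    by apply: eq_big_seq => l ->.
  apply: big_fset_incl => // l _ /negbTE ->; by rewrite mul0r.
exists (F `|` G)%fset, (fun l => cF l + dG l); split.
  by move=> l /=; rewrite inE => /orP[]; [exact: FL | exact: GL].
apply/funext => x; rewrite (ext F (F `|` G)%fset) ?fsubsetUl //.
rewrite (ext G (F `|` G)%fset) ?fsubsetUr // -big_split /=.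
by apply: eq_bigr => l _; rewrite mulrDl.
Qed.

Lemma expo_combZ L (a : R[i]) f : expo_comb L f -> expo_comb L (fun x => a * f x).
Proof.
case=> F [c [FL ->]]; exists F, (fun l => a * c l); split => //.
by apply/funext => x; rewrite mulr_sumr; apply: eq_bigr => l _; rewrite mulrA.
Qed.

Lemma expo_comb0 L : expo_comb L (fun=> 0).
Proof.
exists fset0, (fun=> 0); split; first by move=> l; rewrite /= inE.
by apply/funext => x; rewrite big_seq_fset0.
Qed.

(** The closure in [L^2(mu)] of the linear span of the characters of [L]. *)
Definition cspan L f : Prop :=
  cmeas f /\ forall e : R, 0 < e -> exists g, expo_comb L g /\
    (nrm2 (fun x => f x - g x)%R < e%:E)%E.

(** The epsilon management common to all closure properties: weights [a] and
    [b] on two errors. *)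
Lemma lte_nrm2D (a b e : R) (u v w : \bar R) : 0 <= a -> 0 <= b -> 0 < e ->
  (u <= a%:E * v + b%:E * w -> v < (e / (2 * (a + 1)))%:E ->
   w < (e / (2 * (b + 1)))%:E -> u < e%:E)%E.
Proof.
move=> a0 b0 e0 uvw ve we.
apply: le_lt_trans uvw _.
apply: (@le_lt_trans _ _ (a%:E * (e / (2 * (a + 1)))%:E +
                          b%:E * (e / (2 * (b + 1)))%:E)%E).
  by apply: leeD; apply: lee_wpmul2l; rewrite ?lee_fin // ltW.
rewrite -!EFinM -EFinD lte_fin.
have half c : 0 <= c -> c * (e / (2 * (c + 1))) < e / 2 :> R.
  move=> c0; have c1 : 0 < c + 1 by rewrite ltr_wpDl.
  have -> : c * (e / (2 * (c + 1))) = e / 2 * (c / (c + 1)).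
    by field; rewrite gt_eqF.
  by rewrite gtr_pMr ?divr_gt0 // ltr_pdivrMr // mul1r ltrDl.
by have := half a a0; have := half b b0; lra.
Qed.

Lemma cspan_tcomb L f : expo_comb L f -> cspan L f.
Proof.
move=> tf; split; first exact: expo_comb_cmeas tf.
move=> e e0; exists f; split=> //.
rewrite /nrm2; under eq_integral => x _ do rewrite subrr sqn0.
by rewrite integral0.
Qed.

Lemma cspan_lim L f : cmeas f ->
  (forall e : R, 0 < e -> exists g, cspan L g /\
    (nrm2 (fun x => f x - g x)%R < e%:E)%E) -> cspan L f.
Proof.
move=> mf H; split=> // e e0.
have e4 : 0 < e / (2 * (2 + 1)) :> R by rewrite divr_gt0 // mulr_gt0 // addr_gt0.
have [g [[mg cg] fg]] := H _ e4.
have [h [th gh]] := cg _ e4; exists h; split=> //.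
apply: (@lte_nrm2D 2 2 e _ _ _ _ _ e0 _ fg gh) => //.
have -> : (fun x => f x - h x) = (fun x => (f x - g x) + (g x - h x)).
  by apply/funext => x; rewrite addrA subrK.
by apply: nrm2D; apply: cmeasB => //; exact: expo_comb_cmeas th.
Qed.

Lemma cspanD L f g : cspan L f -> cspan L g -> cspan L (fun x => f x + g x).
Proof.
case=> mf cf [mg cg]; split; first exact: cmeasD.
move=> e e0.
have e4 : 0 < e / (2 * (2 + 1)) :> R by rewrite divr_gt0 // mulr_gt0 // addr_gt0.
have [f' [tf ff]] := cf _ e4; have [g' [tg gg]] := cg _ e4.
exists (fun x => f' x + g' x); split; first exact: expo_combD.
apply: (@lte_nrm2D 2 2 e _ _ _ _ _ e0 _ ff gg) => //.
have -> : (fun x => f x + g x - (f' x + g' x)) =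
          (fun x => (f x - f' x) + (g x - g' x)).
  by apply/funext => x; rewrite opprD addrACA.
by apply: nrm2D; apply: cmeasB => //; [exact: expo_comb_cmeas tf | exact: expo_comb_cmeas tg].
Qed.

Lemma cspanZ L (a : R[i]) f : cspan L f -> cspan L (fun x => a * f x).
Proof.
case=> mf cf; split; first by apply: cmeasM => //; exact: bmc_cmeas (bmc_cst n a).
move=> e e0.
have a1 : 0 < sqn a + 1 by rewrite ltr_wpDl // sqn_ge0.
have [f' [tf ff]] := cf (e / (sqn a + 1)) (divr_gt0 e0 a1).
exists (fun x => a * f' x); split; first exact: expo_combZ.
have -> : (fun x => a * f x - a * f' x) = (fun x => a * (f x - f' x)).
  by apply/funext => x; rewrite mulrBr.
rewrite nrm2_scale; last by apply: cmeasB => //; exact: expo_comb_cmeas tf.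
apply: (@le_lt_trans _ _ ((sqn a)%:E * (e / (sqn a + 1))%:E)%E).
  by apply: lee_wpmul2l; rewrite ?lee_fin ?sqn_ge0 // ltW.
rewrite -EFinM lte_fin mulrA ltr_pdivrMr // mulrC ltr_pM2l //.
by rewrite ltrDl.
Qed.

Lemma cspan_sum L (I : Type) (s : seq I) (F : I -> X -> R[i]) :
  (forall i, cspan L (F i)) -> cspan L (fun x => \sum_(i <- s) F i x).
Proof.
move=> cF; elim: s => [|i s IH].
  have := cspan_tcomb (expo_comb0 L).
  by congr cspan; apply/funext => x; rewrite big_nil.
have := cspanD (cF i) IH.
by congr cspan; apply/funext => x; rewrite big_cons.
Qed.

End ClosedSpan.

(** * Polynomials approximating a threshold *)

Section Threshold.
Variable R : realType.
Implicit Types (q x : R) (m k : nat).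

Lemma bernoulli_add x k : 0 <= x -> 1 + k%:R * x <= (1 + x) ^+ k.
Proof.
move=> x0; elim: k => [|k IH]; first by rewrite mul0r addr0 expr0.
rewrite exprS; apply: le_trans (ler_wpM2l _ IH); last by rewrite addr_ge0.
rewrite -[k.+1%:R]natr1 -subr_ge0.
have -> : (1 + x) * (1 + k%:R * x) - (1 + (k%:R + 1) * x) = k%:R * (x * x).
  by ring.
by rewrite !mulr_ge0.
Qed.

Lemma bernoulli_sub x k : 0 <= x <= 1 -> 1 - k%:R * x <= (1 - x) ^+ k.
Proof.
case/andP=> x0 x1; elim: k => [|k IH]; first by rewrite mul0r subr0 expr0.
rewrite exprS; apply: le_trans (ler_wpM2l _ IH); last by rewrite subr_ge0.
rewrite -[k.+1%:R]natr1 -subr_ge0.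
have -> : (1 - x) * (1 - k%:R * x) - (1 - (k%:R + 1) * x) = k%:R * (x * x).
  by ring.
by rewrite !mulr_ge0.
Qed.

(** Polynomials in [q] that tend boundedly to the indicator of [q < 1/2]: the
    exponent [m * 2 ^ m] is [o(q ^- m)] exactly when [q < 1/2]. *)
Definition thr m q : R := (1 - q ^+ m) ^+ (m * 2 ^ m).

Lemma thr_ge0 m q : 0 <= q <= 1 -> 0 <= thr m q.
Proof. by case/andP=> q0 q1; rewrite exprn_ge0 // subr_ge0 exprn_ile1. Qed.

Lemma thr_le1 m q : 0 <= q <= 1 -> thr m q <= 1.
Proof.
case/andP=> q0 q1; rewrite exprn_ile1 // ?subr_ge0 ?exprn_ile1 //.
by rewrite gerBl exprn_ge0.
Qed.

(** The factor [m] is absorbed by half of the geometric decay, by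
    Bernoulli's inequality for the square root of [r]. *)
Lemma cvg_mul_expr r : 0 <= r < 1 -> (fun m : nat => m%:R * r ^+ m) @ \oo --> (0 : R).
Proof.
case/andP=> r0 r1; case: (eqVneq r 0) => [->|rn0].
  apply: cvg_near_cst; near=> m.
  have : (0 < m)%N by near: m; exact: nbhs_infty_gt.
  by move=> m0; rewrite expr0n eqn0Ngt m0 /= mulr0.
have rp : 0 < r by rewrite lt_neqAle eq_sym rn0.
pose s := Num.sqrt r.
have sp : 0 < s by rewrite sqrtr_gt0.
have s1 : s < 1 by rewrite -sqrtr1 ltr_sqrt.
have ss : s ^+ 2 = r by rewrite sqr_sqrtr.
pose C := s / (1 - s).
have s1' : 0 < 1 - s by rewrite subr_gt0.
have ms m : m%:R * s ^+ m <= C.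
  have : 1 + m%:R * (s^-1 - 1) <= s^-1 ^+ m.
    rewrite -[X in _ <= X ^+ _](subrK 1) [_ - 1 + 1]addrC.
    by apply: bernoulli_add; rewrite subr_ge0 invf_ge1 // ltW.
  rewrite exprVn => H.
  have {}H : m%:R * (s^-1 - 1) <= (s ^+ m)^-1.
    by apply: le_trans H; rewrite lerDr.
  have sm : 0 < s ^+ m by rewrite exprn_gt0.
  rewrite /C ler_pdivlMr //.
  have -> : m%:R * s ^+ m * (1 - s) = (m%:R * (s^-1 - 1)) * s ^+ m * s.
    by field; rewrite gt_eqF.
  rewrite -[leRHS]mul1r ler_pM2r //.
  by rewrite -ler_pdivlMr // div1r.
have sC : (fun m : nat => C * s ^+ m) @ \oo --> (0 : R).
  rewrite -(mulr0 C); apply: cvgM; first exact: cvg_cst.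
  by apply: cvg_expr; rewrite gtr0_norm.
apply: (@squeeze_cvgr nat \oo eventually_filter R (fun=> 0) (fun m : nat => C * s ^+ m)) => //;
  last exact: cvg_cst.
near=> m; apply/andP; split.
  by rewrite mulr_ge0 // exprn_ge0.
by rewrite -ss -exprM mul2n -addnn exprD mulrA ler_wpM2r // exprn_ge0 // ltW.
Unshelve. all: by end_near. Qed.

Lemma thr_cvg1 q : 0 <= q < 2^-1 -> (fun m => thr m q) @ \oo --> (1 : R).
Proof.
case/andP=> q0 q1.
have qq : 0 <= q <= 1 by rewrite q0 /=; lra.
have lo : (fun m : nat => 1 - m%:R * (2 * q) ^+ m) @ \oo --> (1 : R).
  rewrite -[X in _ --> X]subr0; apply: cvgB; first exact: cvg_cst.
  by apply: cvg_mul_expr; apply/andP; split; lra.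
apply: (@squeeze_cvgr nat \oo eventually_filter R (fun m : nat => 1 - m%:R * (2 * q) ^+ m)
  (fun=> 1)) => //; last exact: cvg_cst.
near=> m; apply/andP; split.
  rewrite exprMn mulrA -natrX -natrM; apply: bernoulli_sub.
  by rewrite exprn_ge0 // exprn_ile1 //; case/andP: qq.
exact: thr_le1.
Unshelve. all: by end_near. Qed.

(** From [(1 - y) ^+ k * (1 + y) ^+ k <= 1] and Bernoulli's inequality, the
    threshold is at most [1 / (1 + k * y)], with [k * y >= m]. *)
Lemma thr_cvg0 q : 2^-1 <= q <= 1 -> (fun m => thr m q) @ \oo --> (0 : R).
Proof.
case/andP=> q0 q1.
have qq : 0 <= q <= 1 by rewrite q1 andbT; lra.
have qp : 0 < q by lra.
apply: (@squeeze_cvgr nat \oo eventually_filter R (fun=> 0) harmonic) => //;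
  [| exact: cvg_cst | exact: cvg_harmonic].
near=> m; apply/andP; split.
  exact: thr_ge0.
set y := q ^+ m; set k := (m * 2 ^ m)%N.
have y0 : 0 <= y by rewrite exprn_ge0 // ltW.
have y1 : y <= 1 by rewrite exprn_ile1 // ltW.
have ky : m%:R <= k%:R * y.
  rewrite /k natrM natrX -mulrA -exprMn ler_peMr // exprn_ege1 //; lra.
have prod1 : thr m q * (1 + y) ^+ k <= 1.
  rewrite /thr -exprMn exprn_ile1 //.
    by rewrite mulr_ge0 ?subr_ge0 // addr_ge0.
  have -> : (1 - y) * (1 + y) = 1 - y ^+ 2 by ring.
  by rewrite gerBl exprn_ge0.
rewrite /harmonic /= -[leRHS]mul1r ler_pdivlMr ?ltr0Sn //.
apply: le_trans prod1; apply: ler_wpM2l; first exact: thr_ge0.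
apply: le_trans (bernoulli_add k y0).
by rewrite -natr1 addrC lerD2l.
Unshelve. all: by end_near. Qed.

End Threshold.

(** * Multipliers of the closed span *)

Section Multipliers.
Variables (R : realType) (n : nat) (mu : probability (borelRn R n) R).
Variable L : set 'cV[R]_n.
Hypothesis expo_cspan : forall l, cspan mu L (expo l).
Local Notation X := (borelRn R n).
Implicit Types (f : X -> R[i]) (g h : X -> R) (E : set X).

(** A function that multiplies the closed span into itself; these functions
    form an algebra, closed under bounded pointwise limits, and sines belong
    to it. *)
Definition mult g : Prop :=
  bmr g /\ forall f, cspan mu L f -> cspan mu L (fun x => (g x)%:C * f x).

Lemma cspan_expoM l f : cspan mu L f -> cspan mu L (fun x => expo l x * f x).
Proof.
case=> mf cf; apply: cspan_lim.
  by apply: cmeasM => //; apply: bmc_cmeas; exact: bmc_expo.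
move=> e e0; have [g [tg fg]] := cf e e0.
exists (fun x => expo l x * g x); split.
  case: tg => F [c [_ ->]].
  have := @cspan_sum R n mu L _ F (fun l' x => c l' * expo (l + l') x)
    (fun l' => cspanZ (c l') (expo_cspan (l + l'))).
  congr cspan; apply/funext => x; rewrite mulr_sumr.
  by apply: eq_bigr => l' _; rewrite expoD mulrCA.
apply: le_lt_trans fg; rewrite le_eqVlt; apply/orP; left; apply/eqP.
by apply: eq_integral => x _; rewrite -mulrBr sqnM sqn_expo mul1r.
Qed.

Lemma mult_cst (c : R) : mult (fun=> c).
Proof. by split; [exact: bmr_cst | move=> f; exact: cspanZ]. Qed.

Lemma multD g h : mult g -> mult h -> mult (fun x => g x + h x).
Proof.
case=> bg cg [bh ch]; split; first exact: bmrD.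
move=> f cf; have := cspanD (cg f cf) (ch f cf).
by congr cspan; apply/funext => x; rewrite rmorphD mulrDl.
Qed.

Lemma multM g h : mult g -> mult h -> mult (fun x => g x * h x).
Proof.
case=> bg cg [bh ch]; split; first exact: bmrM.
move=> f cf; have := cg _ (ch f cf).
by congr cspan; apply/funext => x; rewrite rmorphM mulrA.
Qed.

Lemma multB g h : mult g -> mult h -> mult (fun x => g x - h x).
Proof.
move=> mg mh; have := multD mg (multM (mult_cst (-1)) mh).
by congr mult; apply/funext => x; rewrite mulN1r.
Qed.

Lemma multX g k : mult g -> mult (fun x => g x ^+ k).
Proof.
move=> mg; elim: k => [|k IH].
  by have := mult_cst 1; congr mult; apply/funext => x; rewrite expr0.
have := multM mg IH.
by congr mult; apply/funext => x; rewrite exprS.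
Qed.

Lemma mult_sin (u : 'cV[R]_n) (t : R) :
  mult (fun x => sin (2 * pi * dot u x + t)).
Proof.
split.
  split; last by exists 1 => x; exact: sin_max.
  apply: (@measurableT_comp _ _ _ _ _ _ (@sin R)).
    by apply: continuous_measurable_fun; exact: continuous_sin.
  apply: measurable_funD => //; apply: measurable_funM => //.
  exact: measurable_dot.
move=> f cf; pose k : R[i] := 0 -i* 2^-1.
have := cspanD (cspanZ (k * cis t) (cspan_expoM u cf))
  (cspanZ (conjc (k * cis t)) (cspan_expoM (- u) cf)).
congr cspan; apply/funext => x; rewrite !mulrA -mulrDl; congr (_ * _).
rewrite expoN /expo /k /cis sinD; simpc.
by congr (_ +i* _); rewrite /=; field.
Qed.

Lemma nrm2_le_mul (k : R) (F G : X -> R[i]) : cmeas F -> cmeas G -> 0 <= k ->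
  (forall x, sqn (F x) <= k * sqn (G x)) -> (nrm2 mu F <= k%:E * nrm2 mu G)%E.
Proof.
move=> mF mG k0 FG; rewrite -nrm2Z //; apply: ge0_le_integral => //.
- by move=> x _; rewrite lee_fin sqn_ge0.
- exact: measurable_sqnE.
- by apply/measurable_EFinP; apply: measurable_funM => //; exact: measurable_sqn.
- by move=> x _; rewrite lee_fin.
Qed.

(** An element [f] of the closed span is first replaced by a trigonometric
    polynomial [p], which is bounded: the error [(g - h) p] is then
    controlled by the distance of [h] to [g]. *)
Lemma mult_lim g : bmr g -> (forall e : R, 0 < e -> exists h, mult h /\
    (\int[mu]_x (((g x - h x) ^+ 2)%:E) < e%:E)%E) -> mult g.
Proof.
move=> bg H; split=> // f cf.
have mg : cmeas (fun x => (g x)%:C) by apply: bmc_cmeas; exact: bmc_real.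
have mf : cmeas f by case: cf.
have [C gC] := bg.2.
apply: cspan_lim; first exact: cmeasM.
move=> e e0.
have a0 : 0 <= 2 * C ^+ 2 by rewrite mulr_ge0 ?sqr_ge0.
have e1 : 0 < e / (2 * (2 * C ^+ 2 + 1)).
  by rewrite divr_gt0 // mulr_gt0 // ltr_wpDl.
have [p [tp fp]] := cf.2 _ e1.
have bp := bmc_tcomb tp; have mp := bmc_cmeas bp.
have [D pD] := (bmr_sqn bp).2.
have b0 : 0 <= 2 * `|D| by rewrite mulr_ge0.
have e2 : 0 < e / (2 * (2 * `|D| + 1)).
  by rewrite divr_gt0 // mulr_gt0 // ltr_wpDl.
have [h [mh gh]] := H _ e2.
have mch : cmeas (fun x => (h x)%:C) by apply: bmc_cmeas; apply: bmc_real; case: mh.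
exists (fun x => (h x)%:C * p x); split.
  by apply: mh.2; apply: cspan_tcomb.
apply: (@lte_nrm2D _ (2 * C ^+ 2) (2 * `|D|) e _ _ _ a0 b0 e0 _ fp gh).
have -> : (fun x => (g x)%:C * f x - (h x)%:C * p x) =
    (fun x => (g x)%:C * (f x - p x) + ((g x)%:C - (h x)%:C) * p x).
  by apply/funext => x; ring.
have m1 : cmeas (fun x => (g x)%:C * (f x - p x)) by apply: cmeasM => //; exact: cmeasB.
have m2 : cmeas (fun x => ((g x)%:C - (h x)%:C) * p x).
  by apply: cmeasM => //; exact: cmeasB.
apply: le_trans (nrm2D mu m1 m2) _.
rewrite (EFinM 2 (C ^+ 2)) (EFinM 2 `|D|) -!muleA; apply: leeD; apply: lee_wpmul2l => //.
- apply: nrm2_le_mul => //; [exact: cmeasB | exact: sqr_ge0 |] => x.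
  rewrite sqnM ler_wpM2r ?sqn_ge0 // sqn_real.
  rewrite -[X in X <= _]real_normK ?num_real // lerXn2r ?nnegrE //.
  exact: le_trans (normr_ge0 _) (gC x).
- have -> : (\int[mu]_x ((g x - h x) ^+ 2)%:E)%E =
      nrm2 mu (fun x => (g x)%:C - (h x)%:C).
    by apply: eq_integral => x _; rewrite -rmorphB sqn_real.
  apply: nrm2_le_mul => //; first exact: cmeasB.
  move=> x; rewrite sqnM mulrC ler_wpM2r ?sqn_ge0 //.
  by apply: le_trans (ler_norm _) _; apply: le_trans (pD x) (ler_norm _).
Qed.

Lemma mult_cvg (g_ : nat -> X -> R) g (N : set X) :
  (forall k, mult (g_ k)) -> bmr g ->
  (exists C : R, forall k x, `|g_ k x| <= C) ->
  measurable N -> mu N = 0%E ->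
  (forall x, ~ N x -> g_ ^~ x @ \oo --> g x) -> mult g.
Proof.
move=> mg_ bg [C gC] mN N0 cvg_g; apply: mult_lim => // e e0.
have [D gD] := bg.2.
pose F k x := ((g x - g_ k x) ^+ 2)%:E.
have bF k : bmr (fun x => (g x - g_ k x) ^+ 2).
  by rewrite /GRing.exp /=; apply: bmrM; apply: bmrB => //; case: (mg_ k).
have [] := @dominated_convergence _ X R mu setT measurableT F (cst 0%E)
  (cst ((D + C) ^+ 2)%:E).
- by move=> k; apply/measurable_EFinP; case: (bF k).
- exact: measurable_cst.
- exists N; split => // x /= /not_implyP[_]; apply: contra_notP => Nx.
  rewrite /F; apply: cvg_EFin; first by near=> k.
  have -> : (fine \o (fun k => ((g x - g_ k x) ^+ 2)%:E)) =
            (fun k => (g x - g_ k x) * (g x - g_ k x)) by [].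
  rewrite -[X in _ --> X](mulr0 (0 : R)).
  have c0 : (fun k => g x - g_ k x) @ \oo --> (0 : R).
    rewrite -(subrr (g x)); apply: cvgB; first exact: cvg_cst.
    exact: cvg_g.
  exact: cvgM.
- by apply: bmr_integrable; exact: bmr_cst.
- apply: aeW => x k _; rewrite /F /cst gee0_abs ?lee_fin ?sqr_ge0 //.
  rewrite -[X in X <= _]real_normK ?num_real // lerXn2r ?nnegrE //.
    rewrite addr_ge0 //; first exact: le_trans (normr_ge0 _) (gD x).
    exact: le_trans (normr_ge0 _) (gC 0%N x).
  by apply: le_trans (ler_normB _ _) (lerD _ _).
move=> _ _; rewrite integral0 => /fine_cvgP[finI /cvgr0Pnorm_lt /(_ e e0) small].
have [k [kfin ksmall]] : exists k, ([sequence \int[mu]_x F k x]_k k \is a fin_num)%E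
    /\ `|fine ([sequence \int[mu]_x F k x]_k k)%E| < e.
  have [k _ H] : \forall k \near \oo, ([sequence \int[mu]_x F k x]_k k \is a fin_num)%E
    /\ `|fine ([sequence \int[mu]_x F k x]_k k)%E| < e by near=> k; split; near: k.
  by exists k; exact: H (leqnn k).
exists (g_ k); split => //.
rewrite -[X in (X < _)%E](fineK kfin) lte_fin.
exact: le_lt_trans (ler_norm _) ksmall.
Unshelve. all: by end_near. Qed.

End Multipliers.

(** * Density of trigonometric polynomials *)

Section Density.
Variables (R : realType) (n : nat) (mu : probability (borelRn R n) R).
Variable L : set 'cV[R]_n.
Hypothesis expo_cspan : forall l, cspan mu L (expo l).
Local Notation X := (borelRn R n).
Implicit Types (f : X -> R[i]) (g h : X -> R) (E : set X).

Hypothesis mu_bounded : forall u : 'cV[R]_n,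
  exists C : R, mu [set x : X | C < `|dot u x| ] = 0%E.

(** The sets whose indicator is a multiplier; they form a sigma-algebra
    containing the half-spaces. *)
Definition mult_sets : set (set X) := [set E | measurable E /\ mult mu L (\1_E)].

Lemma mult_indicI E E' : mult_sets E -> mult_sets E' -> mult_sets (E `&` E').
Proof.
move=> [mE iE] [mE' iE']; split; first exact: measurableI.
have := multM iE iE'; congr (mult mu L).
by apply/funext => x; rewrite indicI.
Qed.

Lemma mult_indicC E : mult_sets E -> mult_sets (~` E).
Proof.
move=> [mE iE]; split; first exact: measurableC.
have := multB (mult_cst mu L 1) iE; congr (mult mu L).
by apply/funext => x; rewrite !indicE in_setC; case: (_ \in _); rewrite ?subrr ?subr0.
Qed.

Lemma mult_indic_bigcup (F : nat -> set X) :
  (forall k, mult_sets (F k)) -> mult_sets (\bigcup_k F k).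
Proof.
move=> mF; split; first by apply: bigcupT_measurable => k; case: (mF k).
pose G k x : R := 1 - \prod_(i < k) (1 - \1_(F i) x).
have P01 k x : 0 <= (\prod_(i < k) (1 - \1_(F i) x) : R) <= 1.
  elim: k => [|k IH]; first by rewrite big_ord0 ler01 lexx.
  rewrite big_ord_recr /= [\1_(F k) x]indicE; case: (_ \in _).
    by rewrite subrr mulr0 lexx ler01.
  by rewrite subr0 mulr1.
apply: (@mult_cvg R n mu L G _ set0).
- move=> k; apply: multB; first exact: mult_cst.
  elim: k => [|k IH].
    have := mult_cst mu L 1; congr (mult mu L); apply/funext => x.
    by rewrite big_ord0.
  have := multM IH (multB (mult_cst mu L 1) (mF k).2).
  by congr (mult mu L); apply/funext => x; rewrite big_ord_recr.
- by apply: bmr_indic; apply: bigcupT_measurable => k; case: (mF k).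
- exists 1 => k x; rewrite /G ler_norml; have /andP[] := P01 k x; lra.
- exact: measurable0.
- exact: measure0.
move=> x _; rewrite indicE; case: (pselect ((\bigcup_k F k) x)) => [Fx|Fx].
  rewrite mem_set //; case: Fx => i _ Fix.
  apply: cvg_near_cst; near=> k.
  have ik : (i < k)%N by near: k; exact: nbhs_infty_gt.
  rewrite /G (bigD1 (Ordinal ik)) //= indicE mem_set //.
  by rewrite subrr mul0r subr0.
rewrite memNset //; apply: cvg_near_cst; near=> k.
rewrite /G big1 ?subrr // => i _; rewrite indicE memNset ?subr0 //.
by move=> Fix; apply: Fx; exists i.
Unshelve. all: by end_near. Qed.

Lemma measurable_halfspace (u : 'cV[R]_n) (a : R) :
  measurable ([set x : X | a < dot u x]).
Proof.
have -> : [set x : X | a < dot u x] = setT `&` (dot u) @^-1` `]a, +oo[%classic.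
  by apply/seteqP; split => x /=; rewrite in_itv /= andbT // => -[].
exact: measurable_dot.
Qed.

(** On the support of [mu] the sign of [dot u x - a] is the sign of a sine,
    and thresholding a sine is a bounded limit of polynomials in it. *)
Lemma mult_sets_halfspace (u : 'cV[R]_n) (a : R) : mult_sets [set x : X | a < dot u x].
Proof.
split; first exact: measurable_halfspace.
have [C0 C0P] := mu_bounded u.
pose C := `|C0| + `|a| + 1.
have Cp : 0 < C by rewrite ltr_wpDl // addr_ge0.
(* the period of the sine is four times the bound on [dot u x - a] *)
pose s := (4 * C)^-1.
have sp : 0 < s by rewrite invr_gt0 mulr_gt0.
pose th x := 2 * pi * dot (s *: u) x + (- (2 * pi * (s * a))).
pose q x := 2^-1 - 4^-1 * sin (th x).
have q01 x : 0 <= q x <= 1.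
  by have := sin_le1 (th x); have := sin_geN1 (th x); rewrite /q; lra.
have mN : measurable [set x : X | C0 < `|dot u x| ].
  have -> : [set x : X | C0 < `|dot u x| ] =
      [set x : X | C0 < dot u x] `|` [set x : X | C0 < dot (- u) x].
    by apply/seteqP; split => x /=; rewrite lter_normr dotNl => /orP.
  by apply: measurableU; exact: measurable_halfspace.
apply: (@mult_cvg R n mu L (fun k x => thr k (q x)) _
          [set x : X | C0 < `|dot u x| ]) => //.
- move=> k; rewrite /thr; apply: multX; apply: multB; first exact: mult_cst.
  apply: multX; apply: multB; first exact: mult_cst.
  by apply: multM; [exact: mult_cst | exact: mult_sin].
- by apply: bmr_indic; exact: measurable_halfspace.
- by exists 1 => k x; rewrite ger0_norm ?thr_ge0 ?thr_le1.
move=> x /negP; rewrite -leNgt => xC.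
have thE : th x = (pi / 2) * ((dot u x - a) / C).
  by rewrite /th dotZl /s; field; rewrite gt_eqF.
have small : `|(dot u x - a) / C| < 1.
  rewrite normrM normfV (gtr0_norm Cp) ltr_pdivrMr // mul1r.
  apply: le_lt_trans (ler_normB _ _) _; rewrite /C.
  by have := ler_norm C0; have := xC; lra.
rewrite indicE; have [ax|xa] := ltP a (dot u x).
  rewrite mem_set //; apply: thr_cvg1.
  case/andP: (q01 x) => -> _ /=; rewrite /q gtrBl mulr_gt0 //.
  apply: sin_gt0_pi; rewrite thE; apply/andP; split.
    by rewrite !mulr_gt0 ?pi_gt0 ?invr_gt0 // subr_gt0.
  have : (dot u x - a) / C < 1 by apply: le_lt_trans (ler_norm _) small.
  have := pi_gt0 R; nra.
rewrite memNset /=; last by apply/negP; rewrite -leNgt.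
apply: thr_cvg0; case/andP: (q01 x) => _ ->; rewrite andbT /q.
have : 0 <= sin (- th x); last by rewrite sinN; lra.
apply: sin_ge0_pi; rewrite thE; apply/andP; split.
  by rewrite -mulrN -mulNr opprB mulr_ge0 // divr_ge0 ?pi_ge0 ?subr_ge0 // ltW.
have : - ((dot u x - a) / C) < 1.
  by apply: le_lt_trans (ler_norm _) _; rewrite normrN.
have := pi_gt0 R; nra.
Qed.

Lemma mult_sets_sigma : sigma_algebra setT mult_sets.
Proof.
have s0 : mult_sets set0.
  split; first exact: measurable0.
  have := mult_cst mu L 0; congr (mult mu L); apply/funext => x.
  by rewrite indic0.
by split => // [A sA|F sF]; [rewrite setTD; exact: mult_indicC |
  exact: mult_indic_bigcup].
Qed.

Lemma mult_setsT : mult_sets setT.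
Proof.
by have [s0 sD _] := mult_sets_sigma; have := sD _ s0; rewrite setD0.
Qed.

(** A countable base of the topology. *)
Definition rbox (c : 'cV[rat]_n) (k : nat) : set X :=
  [set x | forall i, `|x i 0 - ratr (c i 0)| < k.+1%:R^-1].

Lemma mult_sets_rbox c k : mult_sets (rbox c k).
Proof.
have -> : rbox c k = [set x | forall i, i \in enum 'I_n ->
    `|x i 0 - ratr (c i 0)| < k.+1%:R^-1].
  apply/seteqP; split => x xP i; first by move=> _; exact: xP.
  by apply: xP; rewrite mem_enum.
move: (_^-1) => r.
elim: (enum _) => [|i s IH].
  by have := mult_setsT; congr mult_sets; apply/seteqP; split => x.
have := mult_indicI (mult_indicI
  (mult_sets_halfspace (1 *: delta_mx i 0) (ratr (c i 0) - r))
  (mult_sets_halfspace (-1 *: delta_mx i 0) (- (ratr (c i 0) + r)))) IH.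
congr mult_sets; apply/seteqP; split => x /=; rewrite !dotZl !dot_delta mul1r mulN1r.
  move=> [[lo hi] xs] j; rewrite inE => /predU1P[->|/xs //].
  rewrite ltr_norml; lra.
move=> xs; split; last by move=> j js; apply: xs; rewrite inE js orbT.
by have := xs i (mem_head _ _); rewrite ltr_norml; lra.
Qed.

(** An open set is the union of the countably many rational boxes that it
    contains. *)
Lemma mult_sets_open (E : set 'cV[R]_n) : open E -> mult_sets E.
Proof.
move=> oE.
pose F m : set X := if (choice.unpickle m : option ('cV[rat]_n * nat)%type) is Some (c, k) then
  (if `[< rbox c k `<=` E >] then rbox c k else set0) else set0.
have -> : E = \bigcup_m F m.
  apply/seteqP; split => [x Ex|x [m _]]; last first.
    rewrite /F; case: (choice.unpickle m) => // -[c k].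
    by case: ifPn => // /asboolP; apply.
  have /nbhs_ballP[e /= e0 eE] : nbhs (x : 'cV[R]_n) E.
    exact: open_nbhs_nbhs.
  have [k ke] : exists k : nat, k.+1%:R^-1 < e / 2.
    have [k _ H] : \forall k \near \oo, k.+1%:R^-1 < e / 2 :> R.
      by near=> k; near: k; exact: near_infty_natSinv_lt (PosNum (divr_gt0 e0 (ltr0Sn R 1))).
    by exists k; exact: H (leqnn k).
  move: ke; set r := k.+1%:R^-1 => ke.
  have kp : 0 < r by rewrite invr_gt0 ltr0Sn.
  have /choice[c cP] : forall i, exists q : rat,
      `|x i 0 - ratr q| < r.
    move=> i; have [|q] := @rat_in_itvoo R (x i 0 - r) (x i 0 + r).
      by rewrite ltrBlDr -addrA ltrDl addr_gt0.
    by rewrite in_itv /= => /andP[? ?]; exists q; rewrite ltr_norml; lra.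
  exists (choice.pickle (\col_i c i, k)) => //; rewrite /F choice.pickleK.
  have xb : rbox (\col_i c i) k x by move=> i; rewrite mxE; exact: cP.
  case: asboolP => // -[]; move=> y yb; apply: eE; split => // i j.
  rewrite (ord1 j) /ball /=.
  have := yb i; have := xb i; rewrite -/r !ltr_norml; lra.
apply: mult_indic_bigcup => m; rewrite /F.
have [s0 _ _] := mult_sets_sigma.
by case: (choice.unpickle m) => // -[c k]; case: ifPn => // _; exact: mult_sets_rbox.
Unshelve. all: by end_near. Qed.

Lemma cspan_indic E : measurable E -> cspan mu L (fun x => (\1_E x : R)%:C).
Proof.
move=> mE.
have [_ iE] : mult_sets E.
  by move: mE; apply: smallest_sub; [exact: mult_sets_sigma | exact: mult_sets_open].
have := iE.2 _ (expo_cspan 0).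
by congr cspan; apply/funext => x; rewrite expo0 mulr1.
Qed.

Import HBNNSimple.

Lemma cspan_nnsfun (h : {nnsfun X >-> R}) : cspan mu L (fun x => (h x)%:C).
Proof.
have mh (y : R) : measurable (h @^-1` [set y]) by exact: measurable_funPTI.
have := @cspan_sum R n mu L _ (fset_set (range h))
  (fun y x => y%:C * (\1_(h @^-1` [set y]) x : R)%:C)
  (fun y => cspanZ y%:C (cspan_indic (mh y))).
congr cspan; apply/funext => x.
rewrite (fimfunE h x) fsbig_finite; last exact: fimfunP.
by rewrite /= rmorph_sum; apply: eq_bigr => y _; rewrite rmorphM.
Qed.

(** Monotone approximation by simple functions, with [g ^+ 2] as the
    dominating function. *)
Lemma cspan_ge0 g : measurable_fun setT g -> (forall x, 0 <= g x) ->
  (\int[mu]_x ((g x ^+ 2)%:E) < +oo)%E -> cspan mu L (fun x => (g x)%:C).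
Proof.
move=> mg g0 gfin.
have mge : measurable_fun setT (EFin \o g) by exact/measurable_EFinP.
have ge0 x : setT x -> (0 <= (EFin \o g) x)%E by rewrite /= lee_fin.
pose h k := nnsfun_approx measurableT mge k.
have hg k x : 0 <= h k x <= g x.
  rewrite fun_ge0 /= -lee_fin /h nnsfun_approxE.
  exact: (@le_approx _ _ _ setT (EFin \o g)).
have mg2 : measurable_fun setT (fun x => (g x ^+ 2)%:E).
  by apply/measurable_EFinP; exact: measurable_funX.
apply: cspan_lim.
  by split => //=; exact: measurable_cst.
move=> e e0.
pose F k x := ((g x - h k x) ^+ 2)%:E.
have [] := @dominated_convergence _ X R mu setT measurableT F (cst 0%E)
  (fun x => (g x ^+ 2)%:E).
- move=> k; apply/measurable_EFinP; apply: measurable_funX.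
  by apply: measurable_funB => //; exact: measurable_funP.
- exact: measurable_cst.
- apply: aeW => x _; apply: cvg_EFin; first by near=> k.
  have -> : (fine \o (fun k => F k x)) =
            (fun k => (g x - h k x) * (g x - h k x)) by [].
  rewrite -[X in _ --> X](mulr0 (0 : R)).
  have c0 : (fun k => g x - h k x) @ \oo --> (0 : R).
    rewrite -(subrr (g x)); apply: cvgB; first exact: cvg_cst.
    have := cvg_nnsfun_approx measurableT mge ge0 (x := x) I.
    by move/fine_cvgP => [].
  exact: cvgM.
- apply/integrableP; split => //.
  by under eq_integral => x _ do rewrite gee0_abs ?lee_fin ?sqr_ge0 //.
- apply: aeW => x k _; rewrite /F gee0_abs ?lee_fin ?sqr_ge0 //.
  have /andP[h0 hgx] := hg k x.
  by rewrite lerXn2r ?nnegrE ?subr_ge0 // gerBl.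
move=> _ _; rewrite integral0 => /fine_cvgP[finI /cvgr0Pnorm_lt /(_ e e0) small].
have [k [kfin ksmall]] : exists k, ([sequence \int[mu]_x F k x]_k k \is a fin_num)%E
    /\ `|fine ([sequence \int[mu]_x F k x]_k k)%E| < e.
  have [k _ H] : \forall k \near \oo, ([sequence \int[mu]_x F k x]_k k \is a fin_num)%E
    /\ `|fine ([sequence \int[mu]_x F k x]_k k)%E| < e by near=> k; split; near: k.
  by exists k; exact: H (leqnn k).
exists (fun x => (h k x)%:C); split; first exact: cspan_nnsfun.
have -> : nrm2 mu (fun x => (g x)%:C - (h k x)%:C) = (\int[mu]_x F k x)%E.
  by apply: eq_integral => x _; rewrite -rmorphB sqn_real.
rewrite -[X in (X < _)%E](fineK kfin) lte_fin.
exact: le_lt_trans (ler_norm _) ksmall.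
Unshelve. all: by end_near. Qed.

Lemma cspan_L2 f : cmeas f -> (nrm2 mu f < +oo)%E -> cspan mu L f.
Proof.
move=> mf ffin.
have part g : measurable_fun setT g -> (forall x, g x ^+ 2 <= sqn (f x)) ->
    cspan mu L (fun x => (g x)%:C).
  move=> mg gf.
  have pos g' : measurable_fun setT g' -> (forall x, g' x ^+ 2 <= sqn (f x)) ->
      cspan mu L (fun x => (Num.max (g' x) 0)%:C).
    move=> mg' gf'; apply: cspan_ge0.
    - by apply: measurable_maxr => //; exact: measurable_cst.
    - by move=> x; rewrite le_max lexx orbT.
    apply: le_lt_trans ffin; apply: ge0_le_integral => //.
    - by move=> x _; rewrite lee_fin sqr_ge0.
    - apply/measurable_EFinP; apply: measurable_funX.
      by apply: measurable_maxr => //; exact: measurable_cst.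
    - exact: measurable_sqnE.
    - move=> x _; rewrite lee_fin; apply: le_trans (gf' x).
      by case: (lerP (g' x) 0) => _ //; rewrite expr0n sqr_ge0.
  have mNg : measurable_fun setT (fun x => - g x) by exact: measurableT_comp.
  have Ngf x : (- g x) ^+ 2 <= sqn (f x) by rewrite sqrrN.
  have := cspanD (pos g mg gf) (cspanZ (-1) (pos _ mNg Ngf)).
  congr cspan; apply/funext => x; rewrite mulN1r -rmorphB; congr (_%:C).
  rewrite !maxElt oppr_lt0.
  by case: (ltgtP (g x) 0) => [||->]; rewrite ?sub0r ?opprK ?subr0.
have := cspanD (part _ mf.1 _) (cspanZ (Complex 0 1) (part _ mf.2 _)).
move=> H; have {}H := H _ _.
have : cspan mu L (fun x => (complex.Re (f x))%:C + 'i * (complex.Im (f x))%:C).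
  apply: H => x; rewrite /sqn; last by rewrite lerDr sqr_ge0.
  by rewrite lerDl sqr_ge0.
by congr cspan; apply/funext => x; rewrite -complexE.
Qed.

End Density.

(** A criterion for an orthonormal set of characters to be a basis: every
    character satisfies Parseval's identity in the limit. *)
Lemma total_expP (R : realType) (n : nat) (mu : probability (borelRn R n) R)
    (L : set 'cV[R]_n) :
  (forall u : 'cV[R]_n,
     exists C : R, mu [set x : borelRn R n | C < `|dot u x| ] = 0%E) ->
  (forall l l', L l -> L l' -> l != l' -> fourier mu (l - l') = 0) ->
  (forall (xi : 'cV[R]_n) (e : R), 0 < e -> exists s : seq 'cV[R]_n,
     [/\ uniq s, forall l, l \in s -> L l &
         1 - e < \sum_(l <- s) sqn (fourier mu (xi - l))]) ->
  total_exp mu L.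
Proof.
move=> bnd orth pars f [mr mi ffin] e e0.
have ec l : cspan mu L (expo l).
  split; first by apply: bmc_cmeas; exact: bmc_expo.
  move=> d d0; have [s [us sL sP]] := pars l d d0.
  have os : orth_freq mu s by split => // a b /sL La /sL Lb; exact: orth.
  pose c l' := coef mu (expo l) l'.
  exists (fun x => \sum_(l' <- s) c l' * expo l' x); split.
    exists [fset l' in s]%fset, c; split; first by move=> l' /=; rewrite inE; exact: sL.
    apply/funext => x; apply: perm_big.
    apply: uniq_perm; rewrite ?fset_uniq // => l'; by rewrite !inE.
  rewrite nrm2_bmc; last first.
    apply: bmcB; [exact: bmc_expo | apply: bmc_sum => l'].
    by apply: bmcM; [exact: bmc_cst | exact: bmc_expo].
  rewrite (pythagoras c (bmc_expo l) os) lte_fin [X in _ + X]big1 ?addr0; last first.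
    by move=> l' _; rewrite subrr sqn0.
  rewrite (@eq_Rintegral _ _ _ mu _ (fun=> 1)) => [|x _]; last exact: sqn_expo.
  rewrite Rintegral_prob_cst.
  under eq_bigr => l' _ do rewrite coef_expo.
  by rewrite ltrBlDl -ltrBlDr.
have [||_ /(_ e e0) [g [[F [c [FL ->]]] gP]]] := @cspan_L2 R n mu L ec bnd f.
- by split.
- by move: ffin; under eq_integral do rewrite normc_sqn.
exists F, c; split => //.
by under eq_integral do rewrite normc_sqn.
Qed.

(** * Powers of the inverse of an expansive matrix *)

Section Contraction.
Variable R : realType.
Implicit Types M B : 'M[R]_2.

Lemma normc_real (x : R) : Normc.normc x%:C = `|x|.
Proof. by rewrite /= expr0n addr0 sqrtr_sqr. Qed.

Lemma expansive_unit M : expansive M -> M \in unitmx.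
Proof.
move=> eM; rewrite -row_free_unit -kermx_eq0; apply: contraT => k0.
have : eigenvalue (map_mx (real_complex R) M) 0.
  rewrite /eigenvalue /eigenspace raddf0 subr0 -map_kermx.
  by rewrite map_mx_eq0.
by move=> /eM; rewrite normr0 ltr10.
Qed.

Lemma char_poly_split (K : closedFieldType) (A : 'M[K]_2) :
  exists z1 z2, [/\ eigenvalue A z1, eigenvalue A z2 &
    (A - z1%:M) *m (A - z2%:M) = 0].
Proof.
have [r rE] := closed_field_poly_normal (char_poly A).
move: rE; rewrite (monicP (char_poly_monic A)) scale1r => rE.
have : size r = 2%N.
  by apply: succn_inj; rewrite -(size_prod_XsubC r id) -rE size_char_poly.
case: r rE => [|z1 [|z2 []]] //; rewrite !big_cons big_nil mulr1 => rE _.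
exists z1, z2; split.
- by rewrite eigenvalue_root_char rE rootM root_XsubC eqxx.
- by rewrite eigenvalue_root_char rE rootM !root_XsubC eqxx orbT.
have := Cayley_Hamilton A; rewrite rE rmorphM !rmorphB /=.
by rewrite !horner_mx_X !horner_mx_C.
Qed.

(** Powers of a matrix killed by [(X - w1) (X - w2)]. *)
Lemma powers_of_quadratic (K : comNzRingType) (W : 'M[K]_2) (w1 w2 : K) :
  (W - w1%:M) *m (W - w2%:M) = 0 ->
  exists a : nat -> K, [/\ a 0%N = 0, forall k, a k.+1 = w1 ^+ k + w2 * a k &
    forall k, W ^+ k = (w1 ^+ k)%:M + a k *: (W - w1%:M)].
Proof.
move=> W0; pose a := fix a k := if k is k'.+1 then w1 ^+ k' + w2 * a k' else 0.
exists a; split => //; elim=> [|k IH]; first by rewrite !expr0 scale0r addr0.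
have WW : (W - w1%:M) *m W = w2 *: (W - w1%:M).
  move: W0; rewrite mulmxBr => /eqP; rewrite subr_eq0 => /eqP ->.
  by rewrite mul_mx_scalar.
rewrite exprSr IH /= mulrDl -scalerAl; set u := w1 ^+ k.
have -> : (W - w1%:M) * W = w2 *: (W - w1%:M) by [].
have -> : u%:M * W = u *: W by exact: mul_scalar_mx.
rewrite -/a scalerA exprSr -/u; apply/matrixP => i j.
by rewrite !mxE; case: (i == j); rewrite ?mulr1n ?mulr0n; ring.
Qed.

(** The inverse of an expansive matrix has geometrically decaying powers, since
    both its eigenvalues lie in the open unit disc. *)
Lemma expansive_inv_pow M : expansive M ->
  exists C rho : R, [/\ 0 <= C, 0 < rho, rho < 1 &
    forall k i j, `|(invmx M ^+ k) i j| <= C * rho ^+ k].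
Proof.
move=> eM; have uM := expansive_unit eM.
set A := map_mx (real_complex R) M.
set W := map_mx (real_complex R) (invmx M).
have AW : A *m W = 1%:M by rewrite -map_mxM mulmxV // map_mx1.
have [z1 [z2 [e1 e2 zz]]] := char_poly_split A.
have := eM _ e1; have := eM _ e2; move=> g2 g1.
have n0 z : 1 < `|z| -> z != 0 :> R[i].
  by move=> z1'; rewrite -normr_gt0 (lt_trans ltr01).
pose w1 := z1^-1; pose w2 := z2^-1.
have WW : (W - w1%:M) *m (W - w2%:M) = 0.
  have half z : z != 0 -> W - (z^-1)%:M = - z^-1 *: ((A - z%:M) *m W).
    move=> z0; rewrite mulmxBl AW mul_scalar_mx scalerBr scalerA mulNr mulVf //.
    by rewrite scaleN1r opprK addrC scaleNr scalemx1.
  rewrite (half z1 (n0 _ g1)) (half z2 (n0 _ g2)) -scalemxAl -scalemxAr.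
  have comm : W *m (A - z2%:M) = (A - z2%:M) *m W.
    rewrite mulmxBr mulmxBl AW mul_scalar_mx mul_mx_scalar; congr (_ - _).
    exact: mulmx1C.
  rewrite -!mulmxA (mulmxA W) comm !mulmxA zz.
  by rewrite -mulmxA mul0mx !scaler0.
have [a [a0 aS aE]] := powers_of_quadratic WW.
pose nc := @Normc.normc R.
have nc_lt1 z : 1 < `|z| -> nc z^-1 < 1.
  rewrite normc_def -[1]/((1 : R)%:C) ltcR => z1'.
  by rewrite /nc Normc.normcV invf_lt1 //; case: z z1' => x y //; exact: lt_trans.
have nc_ge0 z : 0 <= nc z by case: z => x y; exact: sqrtr_ge0.
pose th := Num.max (nc w1) (nc w2).
have th0 : 0 <= th by rewrite le_max nc_ge0.
have th1 : th < 1 by rewrite gt_max !nc_lt1.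
pose rho := (1 + th) / 2.
have rth : th < rho by rewrite /rho; lra.
have r1 : rho < 1 by rewrite /rho; lra.
have r0 : 0 < rho by rewrite /rho; lra.
have ncX z k : nc (z ^+ k) = nc z ^+ k.
  elim: k => [|k IH]; first by rewrite !expr0 /nc Normc.normc1.
  by rewrite !exprS /nc Normc.normcM -/nc IH.
have w1k k : nc (w1 ^+ k) <= rho ^+ k.
  rewrite ncX lerXn2r ?nnegrE // ?(ltW r0) //.
  by apply: le_trans (ltW rth); rewrite le_max lexx.
have drt : 0 < rho - th by rewrite subr_gt0.
have ak k : nc (a k) <= (rho - th)^-1 * rho ^+ k.
  elim: k => [|k IH].
    by rewrite a0 /nc Normc.normc0 mulr_ge0 // ?invr_ge0 ?exprn_ge0 // ltW.
  rewrite aS; apply: le_trans (le_normcD _ _) _; rewrite Normc.normcM -/nc.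
  have -> : (rho - th)^-1 * rho ^+ k.+1 =
      rho ^+ k + th * ((rho - th)^-1 * rho ^+ k).
    by rewrite exprS; field; rewrite gt_eqF.
  apply: lerD; first exact: w1k.
  by apply: ler_pM => //; rewrite le_max lexx orbT.
pose c := \sum_i \sum_j nc ((W - w1%:M) i j).
have cP i j : nc ((W - w1%:M) i j) <= c.
  rewrite /c (bigD1 i) //= (bigD1 j) //= -addrA lerDl.
  by rewrite addr_ge0 // !sumr_ge0 // => i' _; rewrite sumr_ge0.
have c0 : 0 <= c by rewrite sumr_ge0 // => i _; rewrite sumr_ge0.
exists (1 + (rho - th)^-1 * c), rho; split=> //.
  by rewrite addr_ge0 // mulr_ge0 // invr_ge0 ltW.
move=> k i j; rewrite -normc_real -/nc.
have -> : ((invmx M ^+ k) i j)%:C = (W ^+ k) i j.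
  by rewrite /W -rmorphXn /= mxE.
rewrite aE 2!mxE mulrDl mul1r; apply: le_trans (le_normcD _ _) _.
apply: lerD.
  case: (i == j); first by rewrite mulr1n; exact: w1k.
  by rewrite mulr0n Normc.normc0 exprn_ge0 // ltW.
rewrite mxE Normc.normcM -/nc mulrAC; apply: ler_pM => //.
Qed.

End Contraction.

(** * Integration against a self-affine measure *)

Section SelfAffine.
Variables (R : realType) (n : nat) (mu : probability (borelRn R n) R).
Variables (M : 'M[R]_n) (ds : seq 'cV[R]_n).
Local Notation X := (borelRn R n).
Hypothesis ds0 : (0 < size ds)%N.
Hypothesis mu_sa : forall A : set X, measurable A ->
  mu A = (((size ds)%:R^-1)%:E * \sum_(d <- ds) mu (affine_map M d @^-1` A))%E.

Local Notation phi := (affine_map M).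

Lemma ge0_integral_self_affine (g : X -> \bar R) :
  measurable_fun setT g -> (forall x, 0 <= g x)%E ->
  (\int[mu]_x g x = ((size ds)%:R^-1)%:E * \sum_(d <- ds) \int[mu]_x g (phi d x))%E.
Proof.
move=> mg g0.
have mphi d := @measurable_affine R n M d.
pose ph d : X -> X := phi d.
pose mk k : {measure set X -> \bar R} := pushforward mu (ph (nth 0 ds k)).
pose m_ := mk (fun k => mphi (nth 0 ds k)).
have c0 : 0 <= (size ds)%:R^-1 :> R by rewrite invr_ge0.
pose c : {nonneg R} := NngNum c0.
transitivity (\int[mscale c (msum m_ (size ds))]_x g x)%E.
  apply: eq_measure_integral => A mA _.
  apply: etrans (mu_sa mA) _; rewrite (big_nth 0) big_mkord /mscale /= /msum.
  by [].
rewrite ge0_integral_mscale // ge0_integral_measure_sum //.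
rewrite (big_nth 0) big_mkord; congr (_ * _)%E; apply: eq_bigr => k _.
by rewrite /m_ ge0_integral_pushforward.
Qed.

Lemma Rintegral_self_affine (g : X -> R) : bmr g ->
  \int[mu]_x g x = (size ds)%:R^-1 * \sum_(d <- ds) \int[mu]_x g (phi d x).
Proof.
move=> [mg [C gC]].
have N0 : (size ds)%:R != 0 :> R by rewrite pnatr_eq0 -lt0n.
have bphi (h : X -> R) d : bmr h -> bmr (fun x => h (phi d x)).
  move=> [mh [D hD]]; split; last by exists D => x; exact: hD.
  exact: (measurableT_comp mh (@measurable_affine R n M d)).
have bg : bmr g by split=> //; exists C.
have bgC : bmr (fun x => g x + C) by apply: bmrD => //; exact: bmr_cst.
have gC0 x : 0 <= g x + C.
  by have := gC x; rewrite ler_norml => /andP[+ _]; lra.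
have E : \int[mu]_x (g x + C) =
    (size ds)%:R^-1 * \sum_(d <- ds) \int[mu]_x (g (phi d x) + C).
  have finI d : ((\int[mu]_x (g (phi d x) + C)%:E) \is a fin_num)%E.
    by apply: integrable_fin_num => //; apply: bmr_integrable; exact: (bphi _ _ bgC).
  rewrite {1}/Rintegral ge0_integral_self_affine.
  - under eq_bigr => d _ do rewrite -(fineK (finI d)).
    by rewrite sumEFin -EFinM.
  - by apply/measurable_EFinP; case: bgC.
  - by move=> x; rewrite lee_fin.
move: E; rewrite RintegralD //; try exact: bmr_integrable; try exact: bmr_integrable (bmr_cst n C).
rewrite Rintegral_prob_cst.
under eq_bigr => d _.
  rewrite RintegralD //; first 1 last.
  - by apply: bmr_integrable; exact: bphi.
  - exact: bmr_integrable (bmr_cst n C).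
  rewrite Rintegral_prob_cst; over.
rewrite big_split /=.
have -> : \sum_(d <- ds) C = (size ds)%:R * C.
  by rewrite big_const_seq count_predT iter_addr_0 mulr_natl.
by rewrite mulrDr mulrA mulVf // mul1r => /addIr.
Qed.

Lemma bmc_affine (f : X -> R[i]) d : bmc f -> bmc (fun x => f (phi d x)).
Proof. by apply: bmc_comp; exact: measurable_affine. Qed.

Lemma Cintegral_self_affine (f : X -> R[i]) : bmc f ->
  Cintegral mu f =
  (size ds)%:R^-1 * \sum_(d <- ds) Cintegral mu (fun x => f (phi d x)).
Proof.
move=> [fr fi]; rewrite {1}/Cintegral (Rintegral_self_affine fr).
rewrite (Rintegral_self_affine fi).
have -> : (size ds)%:R^-1 = ((size ds)%:R^-1 : R)%:C by rewrite fmorphV rmorph_nat.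
have -> : \sum_(d <- ds) Cintegral mu (fun x => f (phi d x)) =
    (\sum_(d <- ds) \int[mu]_x complex.Re (f (phi d x))) +i*
    (\sum_(d <- ds) \int[mu]_x complex.Im (f (phi d x))).
  by elim: (ds) => [|d s IH]; rewrite ?big_nil // !big_cons IH /Cintegral; simpc.
by simpc.
Qed.

(** The transform of the uniform probability on the digits. *)
Definition dmask (xi : 'cV[R]_n) : R[i] :=
  (size ds)%:R^-1 * \sum_(d <- ds) expo xi d.

(** Self-affinity expresses [mu] as the image by the inverse matrix of the
    convolution of [mu] with the uniform probability on the digits. *)
Lemma fourier_mask (xi : 'cV[R]_n) :
  fourier mu xi = dmask ((invmx M)^T *m xi) * fourier mu ((invmx M)^T *m xi).
Proof.
rewrite {1}/fourier Cintegral_self_affine; last exact: bmc_expo.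
rewrite /dmask -mulrA mulr_suml; congr (_ * _); apply: eq_bigr => d _.
rewrite /fourier -Cintegral_scale; last exact: bmc_expo.
congr Cintegral; apply/funext => x.
by rewrite /affine_map expo_mulmx expoDr mulrC.
Qed.

Lemma dmask0 : dmask 0 = 1.
Proof.
rewrite /dmask (eq_bigr (fun=> 1)) => [|d _]; last by rewrite expo0.
by rewrite big_const_seq count_predT iter_addr_0 mulVf // pnatr_eq0 -lt0n.
Qed.

End SelfAffine.

(** * Boundedness of the support *)

Section Bounded.
Variables (R : realType) (mu : probability (borelRn R 2) R).
Variables (M : 'M[R]_2) (ds : seq 'cV[R]_2).
Local Notation X := (borelRn R 2).
Hypothesis ds0 : (0 < size ds)%N.
Hypothesis mu_sa : forall A : set X, measurable A ->
  mu A = (((size ds)%:R^-1)%:E * \sum_(d <- ds) mu (affine_map M d @^-1` A))%E.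
Hypothesis eM : expansive M.
Local Notation B := (invmx M).

(** The sum norm, which pairs with [dot] by a plain inequality. *)
Definition n1 (x : 'cV[R]_2) : R := \sum_i `|x i 0|.

Lemma n1_ge0 x : 0 <= n1 x.
Proof. by rewrite /n1 sumr_ge0. Qed.

Lemma dot_le_n1 (u x : 'cV[R]_2) : `|dot u x| <= n1 u * n1 x.
Proof.
rewrite /dot /n1 mulr_suml; apply: le_trans (ler_norm_sum _ _ _) _.
apply: ler_sum => i _; rewrite normrM ler_wpM2l // (bigD1 i) //= lerDl.
by rewrite sumr_ge0.
Qed.

Lemma n1_mulmx (A : 'M[R]_2) (e : R) (x : 'cV[R]_2) :
  (forall i j, `|A i j| <= e) -> n1 (A *m x) <= 2 * e * n1 x.
Proof.
move=> Ae; rewrite /n1 -mulrA mulr_natl mulr2n.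
rewrite [leLHS](_ : _ = `|(A *m x) 0 0| + `|(A *m x) 1 0|); last first.
  by rewrite !big_ord_recl big_ord0 addr0; congr (_ + `|(A *m x) _ 0|); exact: val_inj.
by apply: lerD; rewrite mxE mulr_sumr; apply: le_trans (ler_norm_sum _ _ _) _;
  apply: ler_sum => i _; rewrite normrM ler_wpM2r.
Qed.

Lemma trmx_inv_pow_le : exists C rho : R, [/\ 0 <= C, 0 < rho, rho < 1 &
  forall k x, n1 ((B ^+ k)^T *m x) <= C * rho ^+ k * n1 x].
Proof.
have [K [rho [K0 r0 r1 KP]]] := expansive_inv_pow eM.
exists (2 * K), rho; split => //; first by rewrite mulr_ge0.
by move=> k x; rewrite -(mulrA 2); apply: n1_mulmx => i j; rewrite mxE.
Qed.

Lemma continuous_n1 : continuous n1.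
Proof.
move=> x; have FF : Filter (nbhs x) := nbhs_filter x.
apply: (@cvg_big _ _ +%R 0 xpredT) => [|i _]; first exact: add_continuous.
by apply: cvg_norm; exact: coord_continuous.
Qed.

Lemma measurable_tail (f : X -> R) (t : R) :
  measurable_fun setT f -> measurable [set x : X | t < f x].
Proof.
move=> mf; have -> : [set x : X | t < f x] = setT `&` f @^-1` `]t, +oo[%classic.
  by apply/seteqP; split => x /=; rewrite in_itv /= andbT // => -[].
exact: mf.
Qed.

Lemma measurable_normdot (u : 'cV[R]_2) (t : R) :
  measurable [set x : X | t < `|dot u x| ].
Proof.
by apply: measurable_tail; apply: measurableT_comp => //; exact: measurable_dot.
Qed.

Lemma n1_tail (e : R) : 0 < e -> exists m : nat,
  (mu [set x : X | (m%:R < n1 x)%R] < e%:E)%E.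
Proof.
move=> e0; pose A (m : nat) := [set x : X | m%:R < n1 x].
have mA m : measurable (A m).
  by apply: measurable_tail; apply: continuous_borel; exact: continuous_n1.
have A0 : \bigcap_m A m = set0.
  apply/seteqP; split => // x Ax.
  have [m /ltW xm] : exists m : nat, n1 x < m%:R.
    by exists (Num.bound (n1 x)); exact: archi_boundP (n1_ge0 x).
  by have := Ax m I; rewrite /A /= ltNge xm.
have := @nonincreasing_cvg_mu _ X R mu A.
rewrite A0 measure0 => /(_ _ mA measurable0) cv.
have {cv} : mu \o A @ \oo --> 0%E.
  apply: cv; first exact: le_lt_trans (probability_le1 mu (mA 0%N)) (ltry 1).
  move=> a b ab; apply/subsetPset => x; rewrite /A /=; apply: le_lt_trans.
  by rewrite ler_nat.
move=> /fine_cvgP[finI /cvgr0Pnorm_lt /(_ e e0) small].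
have [m [mfin msmall]] : exists m, (mu (A m) \is a fin_num)%E /\
    `|fine (mu (A m))| < e.
  have [k _ H] : \forall k \near \oo, (mu (A k) \is a fin_num)%E /\
    `|fine (mu (A k))| < e by near=> k; split; near: k.
  by exists k; exact: H (leqnn k).
exists m; rewrite -[X in (X < _)%E](fineK mfin) lte_fin.
exact: le_lt_trans (ler_norm _) msmall.
Unshelve. all: by end_near. Qed.

(** One unfolding of self-affinity: a tail of [dot v] is an average of tails
    of [dot (B^T *m v)], each shifted by the contribution of a digit. *)
Lemma mu_step (v : 'cV[R]_2) (t del : R) :
  (forall d, d \in ds -> `|dot (B^T *m v) d| <= del) ->
  (mu [set x : X | (t < `|dot v x|)%R ] <=
   mu [set x : X | (t - del < `|dot (B^T *m v) x|)%R ])%E.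
Proof.
move=> dP; set A' := [set x : X | t - del < _].
have mA' : measurable A' by exact: measurable_normdot.
have fA' : (mu A' \is a fin_num)%E by exact: fin_num_measure.
have N0 : (size ds)%:R != 0 :> R by rewrite pnatr_eq0 -lt0n.
apply: le_trans (_ : ((size ds)%:R^-1)%:E * \sum_(d <- ds) mu A' <= _)%E.
  apply: le_trans (le_refl _) _.
  rewrite [leLHS]mu_sa; last exact: measurable_normdot.
  apply: lee_wpmul2l; first by rewrite lee_fin invr_ge0.
  rewrite big_seq [leRHS]big_seq; apply: lee_sum => d dd.
  apply: le_measure; rewrite ?inE //.
    rewrite -[X in measurable X]setTI; apply: measurable_affine => //.
    exact: measurable_normdot.
  move=> x /=; rewrite /affine_map dot_mulmx dotDr => h.
  rewrite /A' /= ltrBlDr; apply: lt_le_trans h _; apply: le_trans (ler_normD _ _) _.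
  by rewrite lerD2l dP.
rewrite -(fineK fA') sumEFin -EFinM lee_fin.
by rewrite big_const_seq count_predT iter_addr_0 -(mulr_natl (fine _)) mulrA mulVf ?mul1r.
Qed.

(** Unfolding self-affinity [k] times replaces [u] by [(B ^+ k)^T *m u], which
    tends to [0], at the price of a geometric sum: so the tails of [dot u]
    vanish beyond a fixed bound. *)
Lemma self_affine_bounded (u : 'cV[R]_2) :
  exists C : R, mu [set x : X | C < `|dot u x| ] = 0%E.
Proof.
have [K [rho [K0 r0 r1 KP]]] := trmx_inv_pow_le.
pose D := \sum_(d <- ds) n1 d.
have dD d : d \in ds -> n1 d <= D.
  move=> dd; rewrite /D (big_rem d) //= lerDl sumr_ge0 // => *; exact: n1_ge0.
have D0 : 0 <= D by rewrite sumr_ge0 // => *; exact: n1_ge0.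
pose w k := (B ^+ k)^T *m u.
have wS k : B^T *m w k = w k.+1.
  by rewrite /w mulmxA -trmx_mul exprSr.
pose del := K * n1 u * D.
have del0 : 0 <= del by rewrite !mulr_ge0 ?n1_ge0.
pose S k := \sum_(j < k) del * rho ^+ j.
have Sle k : S k <= del / (1 - rho).
  rewrite /S -mulr_sumr; apply: ler_wpM2l => //.
  have r1' : 0 < 1 - rho by rewrite subr_gt0.
  rewrite -[leRHS]mul1r ler_pdivlMr // mulrC.
  have -> : (1 - rho) * \sum_(i < k) rho ^+ i = 1 - rho ^+ k.
    by rewrite -[1 in RHS](expr1n R k) subrXX; congr (_ * _); apply: eq_bigr => i _;
       rewrite expr1n mul1r.
  by rewrite gerBl exprn_ge0 // ltW.
have step k t : (mu [set x : X | (t < `|dot u x|)%R ] <=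
    mu [set x : X | (t - S k < `|dot (w k) x|)%R ])%E.
  elim: k => [|k IH].
    by rewrite /S big_ord0 subr0 /w expr0 trmx1 mul1mx.
  apply: le_trans IH _; rewrite -wS /S big_ord_recr /= opprD addrA.
  apply: mu_step => d dd; rewrite wS; apply: le_trans (dot_le_n1 _ _) _.
  rewrite /del mulrAC; apply: ler_pM; rewrite ?n1_ge0 ?dD //.
  apply: le_trans (KP _ _) _; rewrite mulrAC ler_wpM2l ?mulr_ge0 ?n1_ge0 //.
  by rewrite exprS ler_piMl ?exprn_ge0 // ltW.
exists (1 + del / (1 - rho)); apply/eqP; rewrite eq_le measure_ge0 andbT.
apply/lee_addgt0Pr => e e0; rewrite add0e.
have [m mP] := n1_tail e0.
have [k kP] : exists k, K * n1 u * m%:R * rho ^+ k <= 1.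
  have : (fun k => K * n1 u * m%:R * rho ^+ k) @ \oo --> (0 : R).
    rewrite -(mulr0 (K * n1 u * m%:R)); apply: cvgM; first exact: cvg_cst.
    by apply: cvg_expr; rewrite gtr0_norm.
  move=> /cvgr0Pnorm_lt /(_ 1 ltr01)[k _ H]; exists k.
  by apply: ltW; apply: le_lt_trans (ler_norm _) (H k (leqnn k)).
apply: le_trans (step k _) _; apply: ltW; apply: le_lt_trans mP.
apply: le_measure; rewrite ?inE; first exact: measurable_normdot.
  by apply: measurable_tail; apply: continuous_borel; exact: continuous_n1.
move=> x /= h.
have : 1 < `|dot (w k) x|.
  by apply: le_lt_trans h; have := Sle k; lra.
move=> {}h; rewrite ltNge; apply/negP => xm.
have : `|dot (w k) x| <= K * n1 u * m%:R * rho ^+ k.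
  apply: le_trans (dot_le_n1 _ _) _.
  have -> : K * n1 u * m%:R * rho ^+ k = (K * rho ^+ k * n1 u) * m%:R by ring.
  by apply: ler_pM; rewrite ?n1_ge0 //; exact: KP.
by move=> /le_trans/(_ kP); rewrite leNgt h.
Qed.

End Bounded.

(** * The Fourier transform as a product of masks *)

Section FourierTransform.
Variables (R : realType) (mu : probability (borelRn R 2) R).
Variables (M : 'M[R]_2) (ds : seq 'cV[R]_2).
Local Notation X := (borelRn R 2).
Hypothesis ds0 : (0 < size ds)%N.
Hypothesis mu_sa : forall A : set X, measurable A ->
  mu A = (((size ds)%:R^-1)%:E * \sum_(d <- ds) mu (affine_map M d @^-1` A))%E.
Hypothesis eM : expansive M.
Local Notation T := ((invmx M)^T).
Local Notation A := (M^T).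

Lemma trmx_exp (B : 'M[R]_2) k : (B ^+ k)^T = B^T ^+ k.
Proof.
elim: k => [|k IH]; first by rewrite !expr0 trmx1.
by rewrite exprSr trmx_mul IH exprS.
Qed.

Lemma mulAT : A *m T = 1%:M.
Proof. by rewrite -trmx_mul mulVmx ?trmx1 // expansive_unit. Qed.

Lemma mulTA : T *m A = 1%:M.
Proof. by rewrite -trmx_mul mulmxV ?trmx1 // expansive_unit. Qed.

Lemma mulTA_exp k : T ^+ k *m A ^+ k = 1%:M.
Proof.
elim: k => [|k IH]; first by rewrite !expr0 mulmx1.
rewrite exprSr exprS -[LHS]mulmxA (mulmxA T) mulTA mul1mx; exact: IH.
Qed.

Lemma mulAT_exp k : A ^+ k *m T ^+ k = 1%:M.
Proof. by apply: mulmx1C; exact: mulTA_exp. Qed.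

Lemma T_pow_small (x : 'cV[R]_2) (e : R) : 0 < e ->
  exists k0, forall k, (k0 <= k)%N -> n1 (T ^+ k *m x) < e.
Proof.
move=> e0; have [K [rho [K0 r0 r1 KP]]] := trmx_inv_pow_le eM.
have : (fun k => K * n1 x * rho ^+ k) @ \oo --> (0 : R).
  rewrite -(mulr0 (K * n1 x)); apply: cvgM; first exact: cvg_cst.
  by apply: cvg_expr; rewrite gtr0_norm.
move=> /cvgr0Pnorm_lt /(_ e e0)[k0 _ H]; exists k0 => k k0k.
rewrite -trmx_exp; apply: le_lt_trans (KP k x) _.
by rewrite mulrAC; apply: le_lt_trans (ler_norm _) (H k k0k).
Qed.

Lemma n1_bounded : exists2 C : R, 0 <= C & mu [set x : X | C < n1 x] = 0%E.
Proof.
have [C0 H0] := self_affine_bounded ds0 mu_sa eM (delta_mx 0 0).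
have [C1 H1] := self_affine_bounded ds0 mu_sa eM (delta_mx 1 0).
exists (`|C0| + `|C1|); first by rewrite addr_ge0.
have mn t : measurable [set x : X | t < n1 x].
  by apply: measurable_tail; apply: continuous_borel; exact: continuous_n1.
apply/eqP; rewrite eq_le measure_ge0 andbT.
apply: (@le_trans _ _ (mu ([set x : X | C0 < `|dot (delta_mx 0 0) x| ] `|`
                           [set x : X | C1 < `|dot (delta_mx 1 0) x| ]))).
  apply: le_measure; rewrite ?inE //.
    by apply: measurableU; exact: measurable_normdot.
  move=> x /=; rewrite !dot_delta /n1.
  rewrite (_ : \sum_i `|x i 0| = `|x 0 0| + `|x 1 0|); last first.
    by rewrite !big_ord_recl big_ord0 addr0; congr (_ + `|x _ 0|); exact: val_inj.
  move=> h; have [h0|h0] := ltP C0 `|x 0 0|; first by left.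
  by right; have := ler_norm C0; have := ler_norm C1; lra.
apply: le_trans (measureU2 mu (measurable_normdot _ _) (measurable_normdot _ _)) _.
by rewrite /= H0 H1 adde0.
Qed.

Lemma sqn_expoB_le (x y : 'cV[R]_2) (t : X) :
  sqn (expo x t - expo y t) <= 2 * (2 * pi * (n1 (x - y) * n1 t)) ^+ 2.
Proof.
have [h1 h2] := cis_lip (2 * pi * dot x t) (2 * pi * dot y t).
have tt : `|2 * pi * dot x t - 2 * pi * dot y t| <= 2 * pi * (n1 (x - y) * n1 t).
  rewrite -mulrBr -dotBl normrM ger0_norm; last by rewrite mulr_ge0 ?pi_ge0.
  by apply: ler_wpM2l; [rewrite mulr_ge0 ?pi_ge0 | exact: dot_le_n1].
have b0 := le_trans (normr_ge0 _) tt.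
rewrite /sqn /expo /cis /= [leRHS]mulr_natl [leRHS]mulr2n; apply: lerD.
  rewrite -[leLHS]real_normK ?num_real // lerXn2r ?nnegrE //.
  exact: le_trans h1 tt.
rewrite -[leLHS]real_normK ?num_real // lerXn2r ?nnegrE //.
exact: le_trans h2 tt.
Qed.

(** The Lipschitz constant comes from the bounded support of [mu]. *)
Lemma fourier_lipschitz : exists2 K : R, 0 <= K &
  forall x y, Normc.normc (fourier mu x - fourier mu y) <= K * n1 (x - y).
Proof.
have [C C0 CN] := n1_bounded; set N := [set x : X | C < n1 x] in CN.
have mN : measurable N.
  by apply: measurable_tail; apply: continuous_borel; exact: continuous_n1.
exists (Num.sqrt 2 * (2 * pi * C)); first by rewrite !mulr_ge0 ?pi_ge0 ?sqrtr_ge0.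
move=> x y; set K := _ * n1 _.
have K0 : 0 <= K by rewrite !mulr_ge0 ?pi_ge0 ?sqrtr_ge0 ?n1_ge0.
have KK : K ^+ 2 = 2 * (2 * pi * (n1 (x - y) * C)) ^+ 2.
  rewrite /K !exprMn sqr_sqrtr //; ring.
have ne0 (z : R[i]) : 0 <= Normc.normc z by case: z => a b; exact: sqrtr_ge0.
rewrite -ler_sqr ?nnegrE // normc_sqn.
have bxy : bmc (fun t : X => expo x t - expo y t) by apply: bmcB; exact: bmc_expo.
have -> : fourier mu x - fourier mu y = Cintegral mu (fun t => expo x t - expo y t).
  by rewrite /fourier -Cintegral_opp ?Cintegral_add //;
    [exact: bmc_expo | apply: bmcN; exact: bmc_expo | exact: bmc_expo].
apply: le_trans (sqn_Cintegral_le mu bxy) _.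
set c := K ^+ 2.
have c0 : 0 <= c by rewrite sqr_ge0.
have bI : bmr (fun t : X => 4 * \1_N t : R).
  by apply: bmrM; [exact: bmr_cst | exact: bmr_indic].
apply: (@le_trans _ _ (\int[mu]_t (c + 4 * \1_N t))).
  apply: le_Rintegral => //.
  - by apply: bmr_integrable; exact: bmr_sqn.
  - by apply: bmr_integrable; apply: bmrD => //; exact: bmr_cst.
  move=> t _; rewrite indicE; have [tN|tC] := ltP C (n1 t).
    rewrite mem_set // mulr1; apply: le_trans (sqnD_le _ _) _.
    by rewrite sqnN !sqn_expo; lra.
  rewrite memNset ?mulr0 ?addr0; last by rewrite /N /= ltNge tC.
  apply: le_trans (sqn_expoB_le x y t) _; rewrite /c KK ler_pM2l //.
  rewrite lerXn2r ?nnegrE ?mulr_ge0 ?pi_ge0 ?n1_ge0 //.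
  by rewrite !ler_wpM2l ?mulr_ge0 ?pi_ge0 ?n1_ge0.
rewrite RintegralD //; [|exact: bmr_integrable (bmr_cst 2 c)|exact: bmr_integrable].
rewrite Rintegral_prob_cst RintegralZl //; last first.
  by apply: bmr_integrable; exact: bmr_indic.
have -> : \int[mu]_t \1_N t = 0.
  by rewrite /Rintegral integral_indic // setIT; exact: (congr1 fine CN).
by rewrite mulr0 addr0.
Qed.

(** The transform of the convolution of the first [k] factors of [mu]. *)
Fixpoint mask_prod k (xi : 'cV[R]_2) : R[i] :=
  if k is k'.+1 then dmask ds (T *m xi) * mask_prod k' (T *m xi) else 1.

Lemma fourier_mask_prod k xi :
  fourier mu xi = mask_prod k xi * fourier mu (T ^+ k *m xi).
Proof.
elim: k xi => [|k IH] xi; first by rewrite expr0 mul1mx mul1r.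
rewrite (fourier_mask ds0 mu_sa) IH mulrA exprSr -mulmxA //.
Qed.

Lemma mask_prodD k l xi :
  mask_prod (k + l) xi = mask_prod k xi * mask_prod l (T ^+ k *m xi).
Proof.
elim: k xi => [|k IH] xi; first by rewrite expr0 mul1mx mul1r.
by rewrite addSn /= IH mulrA exprSr mulmxA.
Qed.

Lemma mask_prod0 k : mask_prod k 0 = 1.
Proof. by elim: k => //= k IH; rewrite mulmx0 IH dmask0 // mulr1. Qed.

Lemma fourier_T_near1 xi (e : R) : 0 < e -> exists k0, forall k, (k0 <= k)%N ->
  1 - e < Normc.normc (fourier mu (T ^+ k *m xi)).
Proof.
move=> e0; have [K K0 KP] := fourier_lipschitz.
have K1 : 0 < K + 1 by rewrite ltr_wpDl.
have [k0 k0P] := T_pow_small xi (divr_gt0 e0 K1); exists k0 => k /k0P small.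
have := KP 0 (T ^+ k *m xi).
rewrite fourier0 sub0r => h; have {}h : Normc.normc (1 - fourier mu (T ^+ k *m xi)) < e.
  apply: le_lt_trans h _.
  have -> : n1 (- (T ^+ k *m xi)) = n1 (T ^+ k *m xi).
    by apply: eq_bigr => i _; rewrite mxE normrN.
  apply: le_lt_trans (ler_wpM2r (n1_ge0 _) (_ : K <= K + 1)) _; first by rewrite lerDl.
  by rewrite mulrC -ltr_pdivlMr.
have := le_normcD (1 - fourier mu (T ^+ k *m xi)) (fourier mu (T ^+ k *m xi)).
by rewrite subrK Normc.normc1; lra.
Qed.

(** The tail of the product tends to [1], so only one of the finitely many
    first factors can cause a zero. *)
Lemma fourier_eq0 xi : fourier mu xi = 0 ->
  exists j, dmask ds (T ^+ j.+1 *m xi) = 0.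
Proof.
move=> f0; have [k0 /(_ k0 (leqnn _))] := fourier_T_near1 xi (ltr01 : 0 < (1 : R)).
rewrite subrr => fk; have := fourier_mask_prod k0 xi; rewrite f0.
move/esym/eqP; rewrite mulf_eq0 => /orP[|/eqP f0']; last first.
  by move: fk; rewrite f0' Normc.normc0 ltxx.
move=> {f0 fk}; elim: k0 xi => [|k IH] xi /=; first by rewrite oner_eq0.
rewrite mulf_eq0 => /orP[/eqP m0|/IH[j jP]]; first by exists 0%N; rewrite expr1.
by exists j.+1; rewrite exprSr -mulmxA.
Qed.

End FourierTransform.

(** * Parity and the zeros of the mask *)

Lemma even_mul (m k : int) : (2 %| m * k)%Z = (2 %| m)%Z || (2 %| k)%Z.
Proof. by rewrite !dvdzE abszM Euclid_dvdM. Qed.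

Lemma even_sub (m k : int) : (2 %| m - k)%Z = ((2 %| m)%Z == (2 %| k)%Z).
Proof. lia. Qed.

Section DigitMask.
Variables (R : realType) (a1 a2 b1 b2 : int).
Let det : int := a1 * b2 - a2 * b1.
Hypothesis det_odd : ~~ (2 %| det)%Z.
Implicit Types (xi v : 'cV[R]_2) (z : 'cV[int]_2).

Definition intvec v : Prop := forall i, v i 0 \is a Num.int.

Lemma intvecD v w : intvec v -> intvec w -> intvec (v + w).
Proof. by move=> iv iw i; rewrite mxE rpredD. Qed.

Lemma intvecN v : intvec v -> intvec (- v).
Proof. by move=> iv i; rewrite mxE rpredN. Qed.

Lemma intvecB v w : intvec v -> intvec w -> intvec (v - w).
Proof. by move=> iv iw; apply: intvecD => //; exact: intvecN. Qed.

Lemma intvec0 : intvec 0.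
Proof. by move=> i; rewrite mxE rpred0. Qed.

Lemma intvec_intr z : intvec (map_mx intr z).
Proof. by move=> i; rewrite mxE intr_int. Qed.

Lemma intvecP v : intvec v -> exists z, v = map_mx intr z.
Proof.
move=> iv; have /choice[f fP] : forall i, exists k : int, v i 0 = k%:~R.
  by move=> i; have /intrP := iv i.
exists (\col_i f i); apply/matrixP => i j; by rewrite (ord1 j) !mxE fP.
Qed.

Lemma intvec_mulmx (Z : 'M[int]_2) v : intvec v -> intvec (map_mx intr Z *m v).
Proof. by move=> /intvecP[z ->]; rewrite -map_mxM; exact: intvec_intr. Qed.

Lemma dot2E u v : dot u v = u 0 0 * v 0 0 + u 1 0 * v 1 0.
Proof.
rewrite /dot !big_ord_recl big_ord0 addr0.
by congr (_ + u _ 0 * v _ 0); exact: val_inj.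
Qed.

Lemma dot_col2 (x y : int) v :
  dot (map_mx intr (col2 x y)) v = x%:~R * v 0 0 + y%:~R * v 1 0.
Proof. by rewrite dot2E !mxE. Qed.

Definition da : 'cV[R]_2 := map_mx intr (col2 a1 a2).
Definition db : 'cV[R]_2 := map_mx intr (col2 b1 b2).
(** The digits as a list over the reals; [idgs] is the same list over the
    integers. They are distinct when [det] is odd, so that nothing is lost
    in passing from the finite set of digits to the list. *)
Definition dgs : seq 'cV[R]_2 := [:: 0; da; db; - da - db].

Definition idgs : seq 'cV[int]_2 :=
  [:: 0; col2 a1 a2; col2 b1 b2; col2 (- a1 - b1) (- a2 - b2)].

Lemma dgsE : dgs = [seq map_mx intr z | z <- idgs].
Proof.
rewrite /dgs /idgs /= map_mx0; congr [:: _; _; _; _].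
by apply/matrixP => i j; rewrite !mxE; case: ifP; rewrite rmorphB rmorphN.
Qed.

Lemma col2_inj (x y x' y' : int) : col2 x y = col2 x' y' -> x = x' /\ y = y'.
Proof. by move=> /matrixP e; have := e 0 0; have := e 1 0; rewrite !mxE. Qed.

Lemma idgs_uniq : uniq idgs.
Proof.
have n0 : det != 0 by apply: contraNneq det_odd => ->; rewrite dvdz0.
have z0 : 0 = col2 0 0 :> 'cV[int]_2.
  by apply/matrixP => i j; rewrite !mxE; case: ifP.
rewrite /idgs z0 /= !inE !negb_or !andbT.
by do !(apply/andP; split); apply: contra n0 => /eqP/col2_inj[e e'];
  apply/eqP; rewrite /det; nia.
Qed.

Lemma dgs_uniq : uniq dgs.
Proof.
rewrite dgsE map_inj_uniq ?idgs_uniq // => z w /matrixP e.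
by apply/matrixP => i j; have := e i j; rewrite !mxE => /intr_inj.
Qed.

Lemma dmaskE xi : dmask dgs xi =
  4^-1 * (1 + cis (2 * pi * dot da xi) + cis (2 * pi * dot db xi) +
          conjc (cis (2 * pi * dot da xi) * cis (2 * pi * dot db xi))).
Proof.
rewrite /dmask /dgs !big_cons big_nil addr0 expo0r !addrA; congr (_ * (_ + _ + _ + _)).
- by rewrite expoC.
- by rewrite expoC.
- by rewrite expoC /expo -cisD -cisN dotBl dotNl; congr cis; ring.
Qed.

Lemma dmask_add_int xi v : dot da v \is a Num.int -> dot db v \is a Num.int ->
  dmask dgs (xi + v) = dmask dgs xi.
Proof.
move=> /intrP[m mE] /intrP[k kE]; rewrite !dmaskE !dotDr mE kE !(mulrDr (2 * pi)) !cisD.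
by rewrite !cis_2pi_int !mulr1.
Qed.

(** The sign [(-1) ^ m] of an integer [m]. *)
Definition sgz2 (m : int) : R[i] := if (2 %| m)%Z then 1 else -1.

Lemma cis_half (m : int) : cis (2 * pi * (2^-1 * m%:~R)) = sgz2 m :> R[i].
Proof.
rewrite {1}(divz_eq m 2) /sgz2.
have -> : (2 %| m)%Z = ((m %% 2)%Z == 0) by apply/dvdz_mod0P/eqP.
have : (0 <= m %% 2)%Z by rewrite modz_ge0.
have : (m %% 2 < 2)%Z by rewrite ltz_pmod.
case: (m %% 2)%Z => // -[|[|//]] _ _ /=.
  rewrite addr0 intrM; have -> : 2^-1 * ((m %/ 2)%Z%:~R * 2%:~R) = (m %/ 2)%Z%:~R :> R.
    by rewrite mulrCA mulVf ?mulr1 // pnatr_eq0.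
  exact: cis_2pi_int.
rewrite intrD intrM (mulrDr 2^-1) (mulrDr (2 * pi)) cisD.
have -> : 2^-1 * ((m %/ 2)%Z%:~R * 2%:~R) = (m %/ 2)%Z%:~R :> R.
  by rewrite mulrCA mulVf ?mulr1 // pnatr_eq0.
rewrite cis_2pi_int mul1r.
have -> : 2 * pi * (2^-1 * 1%:~R) = pi :> R by rewrite mulr1 mulrAC mulfV ?mul1r // pnatr_eq0.
rewrite /cis cospi sinpi; apply/eqP; rewrite eq_complex /= oppr0 !eqxx //.
Qed.

Lemma sgz2D (m k : int) : sgz2 (m + k) = sgz2 m * sgz2 k.
Proof.
by rewrite -!cis_half -cisD; congr cis; rewrite intrD; ring.
Qed.

Lemma sgz2J (m : int) : conjc (sgz2 m) = sgz2 m.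
Proof.
by rewrite /sgz2; case: ifP => _; apply/eqP; rewrite eq_complex /= ?oppr0 !eqxx.
Qed.

(** [La] and [Lb] are the pairings of an integer vector with the two digits
    that span; the parity of their values decides the sign of the two
    characters at [z / 2]. *)
Definition La z : int := a1 * z 0 0 + a2 * z 1 0.
Definition Lb z : int := b1 * z 0 0 + b2 * z 1 0.

Lemma dot_da_half z : dot da (2^-1 *: map_mx intr z) = 2^-1 * (La z)%:~R.
Proof. by rewrite dotZr dot_col2 !mxE -!intrM -intrD. Qed.

Lemma dot_db_half z : dot db (2^-1 *: map_mx intr z) = 2^-1 * (Lb z)%:~R.
Proof. by rewrite dotZr dot_col2 !mxE -!intrM -intrD. Qed.

Lemma dmask_half xi z : dmask dgs (xi + 2^-1 *: map_mx intr z) =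
  4^-1 * (1 + sgz2 (La z) * cis (2 * pi * dot da xi)
    + sgz2 (Lb z) * cis (2 * pi * dot db xi)
    + sgz2 (La z) * sgz2 (Lb z) *
      conjc (cis (2 * pi * dot da xi) * cis (2 * pi * dot db xi))).
Proof.
rewrite dmaskE !dotDr dot_da_half dot_db_half !(mulrDr (2 * pi)) !cisD !cis_half.
rewrite !conjcM !sgz2J; congr (_ * _); ring.
Qed.

(** Representatives of the points of [{0, 1/2}^2], scaled by [2]. *)
Definition unit_square : seq 'cV[int]_2 :=
  [:: col2 0 0; col2 1 0; col2 0 1; col2 1 1].

Lemma unit_square_uniq : uniq unit_square.
Proof.
by rewrite /unit_square /= !inE !negb_or;
   do !(apply/andP; split) => //; apply/eqP => /col2_inj[].
Qed.

Lemma La_col2 x y : La (col2 x y) = a1 * x + a2 * y.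
Proof. by rewrite /La !mxE. Qed.

Lemma Lb_col2 x y : Lb (col2 x y) = b1 * x + b2 * y.
Proof. by rewrite /Lb !mxE. Qed.

Lemma La_det z : b2 * La z - a2 * Lb z = det * z 0 0.
Proof. by rewrite /La /Lb /det; ring. Qed.

Lemma Lb_det z : a1 * Lb z - b1 * La z = det * z 1 0.
Proof. by rewrite /La /Lb /det; ring. Qed.

Definition even_vec z : bool := (2 %| z 0%R 0%R)%Z && (2 %| z 1%R 0%R)%Z.

Lemma odd_det_cancel (k : int) : (2 %| det * k)%Z = (2 %| k)%Z.
Proof.
apply: Gauss_dvdzr; rewrite coprimezE; move: det_odd; rewrite dvdzE dvdn2 negbK.
by rewrite coprime2n.
Qed.

(** [det] being odd, the integer map with rows [a] and [b] is invertible
    modulo [2]. *)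
Lemma even_vec_L z : (2 %| La z)%Z -> (2 %| Lb z)%Z -> even_vec z.
Proof.
move=> ea eb; rewrite /even_vec -!(odd_det_cancel (z _ _)) -La_det -Lb_det.
by rewrite !rpredB // dvdz_mull.
Qed.

Lemma dmask_half0 z : ~~ even_vec z -> dmask dgs (2^-1 *: map_mx intr z) = 0.
Proof.
move=> nz; rewrite -[_ *: _]add0r dmask_half !dot0r mulr0 cis0 !mulr1 conjc1 mulr1.
have : ~~ ((2 %| La z)%Z && (2 %| Lb z)%Z).
  by apply: contra nz => /andP[]; exact: even_vec_L.
by rewrite /sgz2; case: ifP => _; case: ifP => _ //= _; ring.
Qed.

Lemma four_sums (x y w : R[i]) :
  sqn (1 + x + y + w) + sqn (1 - x + y - w) + sqn (1 + x - y - w)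
    + sqn (1 - x - y + w) = 4 * (1 + sqn x + sqn y + sqn w).
Proof. by case: x y w => [? ?] [? ?] [? ?]; rewrite /sqn /=; ring. Qed.

(** The four half-integer translates of the mask form an orthonormal system,
    the digits being pairwise distinct modulo [2]. *)
Lemma dmask_unit_square xi :
  \sum_(z <- unit_square) sqn (dmask dgs (xi + 2^-1 *: map_mx intr z)) = 1.
Proof.
rewrite /unit_square !big_cons big_nil !dmask_half !La_col2 !Lb_col2.
rewrite !(mulr0, mulr1, addr0, add0r) !sgz2D.
set x := cis _; set y := cis _; set w := conjc _.
have sw : sqn w = 1 by rewrite /w sqnJ sqnM !sqn_cis mulr1.
have := four_sums x y w; rewrite sw !sqn_cis => fs.
have s4 : sqn (4^-1 : R[i]) = 16^-1.
  have -> : 4^-1 = (4^-1 : R)%:C by rewrite fmorphV rmorph_nat.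
  by rewrite sqn_real; field.
have s0 : sgz2 0 = 1 by rewrite /sgz2 dvdz0.
rewrite s0 !mul1r !sqnM s4.
move: det_odd; rewrite /det even_sub !even_mul /sgz2.
by case: (2 %| a1)%Z; case: (2 %| a2)%Z; case: (2 %| b1)%Z; case: (2 %| b2)%Z => //= _;
  rewrite ?(mulN1r, mul1r, mulrN1, mulr1, opprK); lra.
Qed.

(** A sum of four unimodular numbers with product [1] vanishes only if they
    split into two opposite pairs of signs: with [p] the product of [x] and
    [y], the equation and its conjugate give [(1 + p) ^+ 2 * (1 - p) = 0]. *)
Lemma four_units_eq0 (x y : R[i]) : x * conjc x = 1 -> y * conjc y = 1 ->
  1 + x + y + conjc (x * y) = 0 ->
  [/\ x ^+ 2 = 1, y ^+ 2 = 1 & ~ (x = 1 /\ y = 1)].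
Proof.
move=> xx yy s0.
have n4 : (1 + 1 + 1 + 1 : R[i]) != 0.
  by rewrite (_ : _ + _ = 4) ?pnatr_eq0 //; ring.
have no11 : ~ (x = 1 /\ y = 1).
  by case=> x1 y1; move: s0; rewrite x1 y1 mulr1 conjc1; exact/eqP.
pose p := x * y; pose s := x + y.
have pp : p * conjc p = 1 by rewrite /p conjcM mulrACA xx yy mulr1.
have e1 : p + p * s + 1 = 0.
  by rewrite -pp -[RHS](mulr0 p) -s0 /s -/p; ring.
have e2 : p + s + p ^+ 2 = 0.
  have s0' : 1 + conjc x + conjc y + p = 0.
    by rewrite -[RHS]conjc0 -s0 !conjcD conjc1 -/p conjcK.
  rewrite -[RHS](mulr0 p) -s0' /p /s.
  have -> : x * y * (1 + conjc x + conjc y + x * y) =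
    x * y + (x * conjc x) * y + (y * conjc y) * x + (x * y) ^+ 2 by ring.
  by rewrite xx yy; ring.
have : (1 + p) ^+ 2 * (1 - p) = 0.
  have -> : (1 + p) ^+ 2 * (1 - p) = (p + p * s + 1) - p * (p + s + p ^+ 2).
    by ring.
  by rewrite e1 e2; ring.
move/eqP; rewrite mulf_eq0 sqrf_eq0 => /orP[/eqP p1|/eqP p1].
  have {}p1 : p = -1 by move/eqP: p1; rewrite addrC addr_eq0 => /eqP.
  have s1 : s = 0 by move: e2; rewrite p1 sqrrN expr1n addrAC addNr add0r.
  have yx : y = - x by move/eqP: s1; rewrite /s addrC addr_eq0 => /eqP.
  have x2 : x ^+ 2 = 1 by move: p1; rewrite /p yx mulrN -expr2 => /oppr_inj.
  by split => //; rewrite yx sqrrN.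
have {}p1 : p = 1 by move/eqP: p1; rewrite subr_eq0 eq_sym => /eqP.
have yE : y = conjc x.
  by rewrite -[y]mul1r -xx mulrAC -/p p1 mul1r.
have s2 : x + conjc x = - (1 + 1).
  by rewrite -[RHS]addr0 -[in RHS]e1 p1 /s yE; ring.
have : (x + 1) ^+ 2 = 0.
  have -> : (x + 1) ^+ 2 = x * (x + conjc x + (1 + 1)) - (x * conjc x - 1) by ring.
  by rewrite s2 xx; ring.
move/eqP; rewrite sqrf_eq0 addr_eq0 => /eqP x1.
by split => //; rewrite ?yE x1 ?conjcN ?conjc1 ?sqrrN ?expr1n.
Qed.

Lemma cis_sqr1 (t : R) : cis (2 * pi * t) ^+ 2 = 1 -> exists m : int, 2 * t = m%:~R.
Proof.
rewrite expr2 -cisD -mulrDr => /cis_eq1[m mE]; exists m.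
by rewrite -mE mulr_natl mulr2n.
Qed.

(** All four terms are signs by [four_units_eq0], so twice the pairings of
    [xi] with the digits are integers; they cannot both be even, since the
    sum would then be [4]. *)
Lemma dmask_eq0 xi : dmask dgs xi = 0 -> exists m k : int,
  [/\ 2 * dot da xi = m%:~R, 2 * dot db xi = k%:~R & ~~ ((2 %| m)%Z && (2 %| k)%Z)].
Proof.
rewrite dmaskE => /eqP; rewrite mulf_eq0 invr_eq0 pnatr_eq0 /= => /eqP.
move/(four_units_eq0 (cisJ _) (cisJ _)) => [/cis_sqr1[m mE] /cis_sqr1[k kE] no].
exists m, k; split => //; apply/negP => /andP[em ek]; apply: no.
have half (t : R) (j : int) : 2 * t = j%:~R -> (2 %| j)%Z -> cis (2 * pi * t) = 1.
  move=> tj ej; have -> : t = 2^-1 * j%:~R by rewrite -tj mulKf // pnatr_eq0.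
  by rewrite cis_half /sgz2 ej.
by split; [exact: half mE em | exact: half kE ek].
Qed.

Lemma adj_dot0 xi : b2%:~R * dot da xi - a2%:~R * dot db xi = det%:~R * xi 0 0.
Proof. by rewrite !dot_col2 /det !(intrD, intrM, rmorphN) /=; ring. Qed.

Lemma adj_dot1 xi : a1%:~R * dot db xi - b1%:~R * dot da xi = det%:~R * xi 1 0.
Proof. by rewrite !dot_col2 /det !(intrD, intrM, rmorphN) /=; ring. Qed.

Lemma intvec_coord v : v 0 0 \is a Num.int -> v 1 0 \is a Num.int -> intvec v.
Proof.
move=> v0 v1 i; have := ord2P i.
by rewrite !inE => /orP[] /eqP ->.
Qed.

(** The zeros of the mask have denominators dividing twice the odd number
    [det]. *)
Lemma dmask0_lattice xi : dmask dgs xi = 0 -> intvec ((2 * det)%:~R *: xi).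
Proof.
move=> /dmask_eq0[m [k [mE kE _]]]; apply: intvec_coord; rewrite mxE intrM -mulrA.
  rewrite -adj_dot0 mulrBr !(mulrCA 2%:~R) mE kE.
  by rewrite rpredB // rpredM // intr_int.
rewrite -adj_dot1 mulrBr !(mulrCA 2%:~R) mE kE.
by rewrite rpredB // rpredM // intr_int.
Qed.

(** An odd denominator is incompatible with the half-integers that a zero of
    the mask produces. *)
Lemma dmask_neq0_odd xi : intvec (det%:~R *: xi) -> dmask dgs xi != 0.
Proof.
move=> /intvecP[z zE]; apply/eqP => /dmask_eq0[m [k [mE kE]]].
have zi i : det%:~R * xi i 0 = (z i 0)%:~R.
  by have /matrixP/(_ i 0) := zE; rewrite !mxE.
rewrite -(odd_det_cancel m) -(odd_det_cancel k).
have LaE : (La z)%:~R = a1%:~R * (z 0 0)%:~R + a2%:~R * (z 1 0)%:~R :> R.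
  by rewrite /La intrD !intrM.
have LbE : (Lb z)%:~R = b1%:~R * (z 0 0)%:~R + b2%:~R * (z 1 0)%:~R :> R.
  by rewrite /Lb intrD !intrM.
have -> : det * m = 2 * La z.
  apply: (@intr_inj R); rewrite (intrM _ det m) -mE dot_col2 (intrM _ 2) LaE -!zi.
  by ring.
have -> : det * k = 2 * Lb z.
  apply: (@intr_inj R); rewrite (intrM _ det k) -kE dot_col2 (intrM _ 2) LbE -!zi.
  by ring.
by rewrite !dvdz_mulr.
Qed.

(** The defect in the triangle inequality for four unimodular numbers. *)
Lemma equality_case (x y w : R[i]) :
  sqn (1 - x) + sqn (1 - y) + sqn (1 - w) + sqn (x - y) + sqn (x - w) + sqn (y - w)
  = 4 * (1 + sqn x + sqn y + sqn w) - sqn (1 + x + y + w).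
Proof. by case: x y w => [? ?] [? ?] [? ?]; rewrite /sqn /=; ring. Qed.

(** Equality in the triangle inequality: the three other digits have the
    same phase as the digit [0]. *)
Lemma dmask_sqn1 xi : sqn (dmask dgs xi) = 1 ->
  dot da xi \is a Num.int /\ dot db xi \is a Num.int.
Proof.
rewrite dmaskE sqnM; set x := cis _; set y := cis _; set w := conjc _.
have sw : sqn w = 1 by rewrite /w sqnJ sqnM !sqn_cis mulr1.
have s4 : sqn (4^-1 : R[i]) = 16^-1.
  have -> : 4^-1 = (4^-1 : R)%:C by rewrite fmorphV rmorph_nat.
  by rewrite sqn_real; field.
rewrite s4 => m1.
have := equality_case x y w; rewrite sw !sqn_cis.
have := sqn_ge0 (1 - x); have := sqn_ge0 (1 - y); have := sqn_ge0 (1 - w).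
have := sqn_ge0 (x - y); have := sqn_ge0 (x - w); have := sqn_ge0 (y - w).
move=> h1 h2 h3 h4 h5 h6 E.
have z0 (c : R[i]) : sqn (1 - c) = 0 -> c = 1.
  by move=> /eqP; rewrite sqn_eq0 subr_eq0 eq_sym => /eqP.
have /z0/cis_eq1[m ->] : sqn (1 - x) = 0 by lra.
have /z0/cis_eq1[k ->] : sqn (1 - y) = 0 by lra.
by rewrite !intr_int.
Qed.

End DigitMask.

(** * Generic directions *)

Section Genericity.
Variable R : realType.

(** Finitely many nonzero vectors of the plane avoid a common orthogonal
    direction: the vectors [(1, t)] meet each of their orthogonal lines for at
    most one [t]. *)
Lemma generic_direction (W : seq 'cV[R]_2) : (forall w, w \in W -> w != 0) ->
  exists u, forall w, w \in W -> dot w u != 0.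
Proof.
move=> W0; pose p := \prod_(w <- W) ((w 0 0)%:P + (w 1 0) *: 'X : {poly R}).
have p0 : p != 0.
  rewrite prodf_seq_neq0; apply/allP => w /W0 wn0; apply: contra wn0 => /eqP e.
  apply/eqP/matrixP => i j; rewrite (ord1 j) mxE.
  have := congr1 (fun q : {poly R} => q`_0) e; have := congr1 (fun q : {poly R} => q`_1) e.
  rewrite !coefE /= !mulr0 !mulr1 !addr0 ?add0r => e1 e0.
  have := ord2P i.
  by rewrite !inE => /orP[] /eqP ->.
have [t tP] : exists t, p.[t] != 0.
  apply: contrapT => no.
  have := @max_poly_roots _ p [seq (k%:R : R) | k <- iota 0 (size p)] p0.
  have -> : all (root p) [seq (k%:R : R) | k <- iota 0 (size p)].
    apply/allP => x _; apply: contrapT => nr; apply: no; exists x.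
    by apply/negP => /eqP px; apply: nr; rewrite /root px.
  rewrite map_inj_uniq ?iota_uniq; last exact: (@mulrIn _ 1 (oner_neq0 R)).
  by rewrite size_map size_iota ltnn => /(_ isT isT).
exists (col2 1 t) => w wW; have := tP; rewrite /p horner_prod.
rewrite prodf_seq_neq0 => /allP/(_ w wW) /=; apply: contra => /eqP.
by rewrite dot2E !mxE /= mulr1 !hornerE => ->.
Qed.

End Genericity.

(** * An isolated second-level piece *)

Section IsolatedPiece.
Variables (R : realType) (mu : probability (borelRn R 2) R).
Variables (M : 'M[R]_2) (ds : seq 'cV[R]_2).
Local Notation X := (borelRn R 2).
Hypothesis ds0 : (0 < size ds)%N.
Hypothesis ds_uniq : uniq ds.
Hypothesis mu_sa : forall A : set X, measurable A ->
  mu A = (((size ds)%:R^-1)%:E * \sum_(d <- ds) mu (affine_map M d @^-1` A))%E.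
Hypothesis eM : expansive M.
Local Notation B := (invmx M).
Local Notation T := ((invmx M)^T).
Local Notation phi := (affine_map M).

Lemma seq_argmax (I : eqType) (f : I -> R) (s : seq I) : (0 < size s)%N ->
  exists2 d, d \in s & forall d', d' \in s -> f d' <= f d.
Proof.
elim: s => // x [|y s] IH _.
  by exists x; rewrite ?mem_head // => d' /[!inE] /eqP ->.
have [//|d ds' dP] := IH; have [fxd|fdx] := lerP (f x) (f d).
  exists d; first by rewrite inE ds' orbT.
  by move=> d'; rewrite inE => /predU1P[->//|/dP].
exists x; first exact: mem_head.
by move=> d'; rewrite inE => /predU1P[->//|/dP /le_trans]; apply; exact: ltW.
Qed.

Lemma seq_gap (I : eqType) (f : I -> R) (s : seq I) :
  (forall x, x \in s -> 0 < f x) ->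
  exists2 e : R, 0 < e & forall x, x \in s -> e <= f x.
Proof.
elim: s => [_|x s IH sP]; first by exists 1.
have [y ys|e e0 eP] := IH; first by apply: sP; rewrite inE ys orbT.
exists (Num.min e (f x)); first by rewrite lt_min e0 sP ?mem_head.
move=> y; rewrite inE => /predU1P[->|/eP ey]; first by rewrite ge_min lexx orbT.
by apply: le_trans ey; rewrite ge_min lexx.
Qed.

Lemma Cintegral_null (f : X -> R[i]) (N : set X) : bmc f -> measurable N ->
  mu N = 0%E -> (forall x, ~ N x -> f x = 0) -> Cintegral mu f = 0.
Proof.
move=> bf mN N0 fN; apply/eqP; rewrite -sqn_eq0 eq_le sqn_ge0 andbT.
apply: le_trans (sqn_Cintegral_le mu bf) _.
have [C fC] := (bmr_sqn bf).2.
apply: (@le_trans _ _ (\int[mu]_x (C * \1_N x))).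
  apply: le_Rintegral => //.
  - by apply: bmr_integrable; exact: bmr_sqn.
  - by apply: bmr_integrable; apply: bmrM; [exact: bmr_cst | exact: bmr_indic].
  move=> x _; rewrite indicE; case: (pselect (N x)) => [Nx|nNx].
    by rewrite mem_set // mulr1; exact: le_trans (ler_norm _) (fC x).
  by rewrite memNset // mulr0 fN // sqn0.
rewrite RintegralZl //; last by apply: bmr_integrable; exact: bmr_indic.
have -> : \int[mu]_t \1_N t = 0.
  by rewrite /Rintegral integral_indic // setIT; exact: (congr1 fine N0).
by rewrite mulr0.
Qed.

(** A level where the upper tail of [dot v] passes from positive to zero mass
    within a step of length [del]. *)
Lemma tail_drop (v : 'cV[R]_2) (del : R) : 0 < del -> exists t : R,
  mu [set x : X | t < dot v x] = 0%E /\ mu [set x : X | t - del < dot v x] != 0%E.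
Proof.
move=> del0; have [C CP] := self_affine_bounded ds0 mu_sa eM v.
pose E (t : R) := [set x : X | t < dot v x].
have Emono t t' : t <= t' -> (mu (E t') <= mu (E t))%E.
  move=> tt'; apply: le_measure; rewrite ?inE; try exact: measurable_halfspace.
  by move=> x; rewrite /E /=; exact: le_lt_trans.
have hi : mu (E C) = 0%E.
  apply/eqP; rewrite eq_le measure_ge0 andbT -CP; apply: le_measure; rewrite ?inE.
  - exact: measurable_halfspace.
  - exact: measurable_normdot.
  - by move=> x; rewrite /E /= => h; apply: lt_le_trans h (ler_norm _).
have lo t : t < - C -> mu (E t) != 0%E.
  move=> tC; apply/negP => /eqP Et0.
  have : (mu (setT : set X) <= mu (E t `|` [set x : X | (C < `|dot v x|)%R ]))%E.
    apply: le_measure; rewrite ?inE //.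
      by apply: measurableU; [exact: measurable_halfspace | exact: measurable_normdot].
    move=> x _; have [h|h] := ltP C `|dot v x|; [by right | left].
    by rewrite /E /=; apply: lt_le_trans tC _; move: h; rewrite ler_norml => /andP[].
  rewrite (@probability_setT _ _ _ mu) => h.
  have h2 : (mu (E t `|` [set x : X | (C < `|dot v x|)%R ]) <=
      mu (E t) + mu [set x : X | (C < `|dot v x|)%R ])%E.
    by apply: measureU2; [exact: measurable_halfspace | exact: measurable_normdot].
  by move: (le_trans h h2); rewrite Et0 CP adde0 lee_fin ler10.
pose P k := mu (E (C - k%:R * del)) != 0%E.
have exP : exists k, P k.
  have [k kP] : exists k : nat, (C + C) / del < k%:R.
    exists (Num.bound `|(C + C) / del|).
    exact: le_lt_trans (ler_norm _) (archi_boundP (normr_ge0 _)).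
  exists k; apply: lo; move: kP; rewrite ltr_pdivrMr //; lra.
have [k Pk kmin] := ex_minnP exP.
case: k Pk kmin => [|k] Pk kmin.
  by move: Pk; rewrite /P mul0r subr0 hi eqxx.
exists (C - k%:R * del); split.
  by apply/eqP; apply: contraT => /kmin; rewrite ltnn.
by move: Pk; rewrite /P /E -natr1 mulrDl mul1r opprD addrA.
Qed.

Lemma big_one (I : eqType) (s : seq I) (F : I -> R[i]) (c : I) : uniq s ->
  c \in s -> (forall d, d \in s -> d != c -> F d = 0) -> \sum_(d <- s) F d = F c.
Proof.
move=> us cs F0; rewrite (bigD1_seq c) //= big_seq_cond big1 ?addr0 // => d.
by move=> /andP[ds' dc]; exact: F0.
Qed.

(** A direction [u] is chosen so that a single pair of digits maximizes [dot u]
    over the second-level cylinders. A half-space orthogonal to [u] then meets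
    the support of [mu] in a part [U] of that one cylinder, so that the
    coefficients of its indicator are, up to a phase and a factor [N ^- 2],
    those of the rescaled piece [E]. *)
Lemma isolated_piece : exists U E : set X,
  [/\ measurable U, measurable E, mu E != 0%E &
    forall l, sqn (coef mu (fun x => (\1_U x : R)%:C) l) =
      (size ds)%:R^-1 ^+ 4 * sqn (coef mu (fun x => (\1_E x : R)%:C) (T ^+ 2 *m l))].
Proof.
have uM := expansive_unit eM.
(* [u] separates the images of distinct digits at both levels *)
pose dif := [seq p.1 - p.2 | p <- [seq (d, d') | d <- ds, d' <- ds] & p.1 != p.2].
have dif0 w : w \in dif -> w != 0.
  by move=> /mapP[[d d']]; rewrite mem_filter /= => /andP[dd _] ->; rewrite subr_eq0.
have Binj w : w != 0 -> B *m w != 0.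
  apply: contra => /eqP Bw; rewrite -(mulKVmx uM w) Bw mulmx0 //.
have [u uP] : exists u, forall w, w \in [seq B *m w | w <- dif] ++
    [seq B *m (B *m w) | w <- dif] -> dot w u != 0.
  apply: generic_direction => w; rewrite mem_cat => /orP[] /mapP[w' /dif0 w0 ->].
    exact: Binj.
  by do 2 apply: (Binj).
pose v1 := T *m u; pose v2 := T *m v1.
have dot1 w : dot v1 w = dot u (B *m w) by rewrite dot_mulmx.
have dot2 w : dot v2 w = dot u (B *m (B *m w)) by rewrite !dot_mulmx.
have sep v : (forall w, w \in dif -> dot v w != 0) ->
    exists2 c, c \in ds & forall d, d \in ds -> d != c -> dot v d < dot v c.
  move=> vP; have [c cs cmax] := seq_argmax (dot v) ds0; exists c => // d dd dc.
  rewrite lt_neqAle cmax // andbT -subr_eq0 -dotC dotC.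
  have : dot v (d - c) != 0.
    apply: vP; apply/mapP; exists (d, c) => //; rewrite mem_filter /= dc.
    by apply/allpairsP; exists (d, c).
  by rewrite [dot v (d - c)]dotC dotBl !(dotC v).
have [c1 c1s c1P] : exists2 c, c \in ds &
    forall d, d \in ds -> d != c -> dot v1 d < dot v1 c.
  apply: sep => w wd; rewrite dot1 dotC; apply: uP; rewrite mem_cat.
  by apply/orP; left; apply/mapP; exists w.
have [c2 c2s c2P] : exists2 c, c \in ds &
    forall d, d \in ds -> d != c -> dot v2 d < dot v2 c.
  apply: sep => w wd; rewrite dot2 dotC; apply: uP; rewrite mem_cat.
  by apply/orP; right; apply/mapP; exists w.
have [e1 e10 e1P] : exists2 e, 0 < e & forall d, d \in ds -> d != c1 ->
    dot v1 d <= dot v1 c1 - e.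
  have [|e e0 eP] := @seq_gap _ (fun d => dot v1 c1 - dot v1 d) [seq d <- ds | d != c1].
    by move=> d; rewrite mem_filter subr_gt0 => /andP[? ?]; exact: c1P.
  exists e => // d dd dc; rewrite lerBrDr -lerBrDl eP // mem_filter dc //.
have [e2 e20 e2P] : exists2 e, 0 < e & forall d, d \in ds -> d != c2 ->
    dot v2 d <= dot v2 c2 - e.
  have [|e e0 eP] := @seq_gap _ (fun d => dot v2 c2 - dot v2 d) [seq d <- ds | d != c2].
    by move=> d; rewrite mem_filter subr_gt0 => /andP[? ?]; exact: c2P.
  exists e => // d dd dc; rewrite lerBrDr -lerBrDl eP // mem_filter dc //.
have le1 d : d \in ds -> dot v1 d <= dot v1 c1.
  by move=> dd; case: (eqVneq d c1) => [->//|/(c1P _ dd)/ltW].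
have le2 d : d \in ds -> dot v2 d <= dot v2 c2.
  by move=> dd; case: (eqVneq d c2) => [->//|/(c2P _ dd)/ltW].
pose del := Num.min e1 e2.
have del0 : 0 < del by rewrite lt_min e10.
have del1 : del <= e1 by rewrite ge_min lexx.
have del2 : del <= e2 by rewrite ge_min lexx orbT.
have [t [t0 tdel]] := tail_drop v2 del0.
(* the offset of the extreme cylinder; any other one lies lower by at least [del] *)
pose m1 := dot v1 c1 + dot v2 c2.
pose U := [set x : X | t - del + m1 < dot u x].
pose E := [set x : X | t - del < dot v2 x].
have mU : measurable U by exact: measurable_halfspace.
have mE : measurable E by exact: measurable_halfspace.
have dotphi d d' x : dot u (phi d (phi d' x)) = dot v1 d + dot v2 d' + dot v2 x.
  by rewrite /affine_map dot_mulmx dotDr dot_mulmx dotDr; ring.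
have phiphi x : phi c1 (phi c2 x) = B *m (B *m x) + (B *m (B *m c2) + B *m c1).
  by rewrite /affine_map !mulmxDr addrA.
exists U, E; split => // l.
pose f x := (\1_U x : R)%:C * conjc (expo l x).
have bf : bmc f by apply: bmcM; [exact: bmc_indic | apply: bmcJ; exact: bmc_expo].
have off d d' : d \in ds -> d' \in ds -> (d != c1) || (d' != c2) ->
    Cintegral mu (fun x => f (phi d (phi d' x))) = 0.
  move=> dd dd' ne; apply: (Cintegral_null (N := [set x : X | t < dot v2 x])) => //.
    by have := bmc_affine M d' (bmc_affine M d bf).
    exact: measurable_halfspace.
  move=> x /= nx; rewrite /f indicE memNset ?mul0r // /U /= dotphi => h; apply: nx.
  have := le1 d dd; have := le2 d' dd'; rewrite /m1 in h.
  by case/orP: ne => [/(e1P d dd) | /(e2P d' dd')]; lra.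
have -> : coef mu (fun x => (\1_U x : R)%:C) l =
    (size ds)%:R^-1 * ((size ds)%:R^-1 * Cintegral mu (fun x => f (phi c1 (phi c2 x)))).
  rewrite /coef -/f (Cintegral_self_affine ds0 mu_sa bf); congr (_ * _).
  have bfd d : bmc (fun x => f (phi d x)) := bmc_affine M d bf.
  under eq_bigr => d _ do rewrite (Cintegral_self_affine ds0 mu_sa (bfd d)).
  rewrite (@big_one _ ds _ c1) //.
    congr (_ * _); rewrite (@big_one _ ds _ c2) // => d dd dc.
    by apply: off => //; rewrite dc orbT.
  move=> d dd dc; rewrite big1_seq ?mulr0 // => d' /= dd'.
  by apply: off => //; rewrite dc.
have -> : Cintegral mu (fun x => f (phi c1 (phi c2 x))) =
    conjc (expo l (phi c1 (phi c2 0))) * coef mu (fun x => (\1_E x : R)%:C) (T ^+ 2 *m l).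
  rewrite /coef -Cintegral_scale; last first.
    by apply: bmcM; [exact: bmc_indic | apply: bmcJ; exact: bmc_expo].
  congr Cintegral; apply/funext => x; rewrite /f.
  have -> : \1_U (phi c1 (phi c2 x)) = \1_E x :> R.
    rewrite !indicE; congr (_ %:R); congr nat_of_bool.
    apply/idP/idP; rewrite !inE /U /E /= dotphi /m1; lra.
  have -> : T ^+ 2 *m l = T *m (T *m l) by rewrite mulmxA.
  rewrite !phiphi !mulmx0 add0r expoDr conjcM !(expo_mulmx B).
  by ring.
rewrite !sqnM sqnJ sqn_expo mul1r !mulrA; congr (_ * _).
have -> : (size ds)%:R^-1 = ((size ds)%:R^-1 : R)%:C by rewrite fmorphV rmorph_nat.
by rewrite sqn_real -exprD.
Qed.

(** Parseval's identity for the isolated piece, read at the second level. *)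
Lemma isolated_parseval (L : set 'cV[R]_2) : orthonormal_basis_exp mu L ->
  exists f : X -> R[i], bmc f /\ 0 < \int[mu]_x sqn (f x) /\
    forall e : R, 0 < e -> exists s : seq 'cV[R]_2,
      [/\ uniq s, forall l, l \in s -> L l &
        (size ds)%:R ^+ 2 * (\int[mu]_x sqn (f x)) - e <
          \sum_(l <- s) sqn (coef mu f (T ^+ 2 *m l))].
Proof.
move=> [orth tot]; have [U [E [mU mE E0 UE]]] := isolated_piece.
pose iU (x : X) := (\1_U x : R)%:C; pose iE (x : X) := (\1_E x : R)%:C.
have bU : bmc iU by exact: bmc_indic.
have bE : bmc iE by exact: bmc_indic.
have sqI (D : set X) : measurable D ->
    \int[mu]_x sqn ((\1_D x : R)%:C) = fine (mu D).
  move=> mD; rewrite (@eq_Rintegral _ _ _ mu _ (\1_D)) => [|x _].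
    by rewrite /Rintegral integral_indic // setIT.
  by rewrite sqn_real indicE; case: (_ \in _); rewrite ?expr1n ?expr0n.
have fin (D : set X) : measurable D -> (mu D \is a fin_num)%E.
  by move=> mD; exact: fin_num_measure.
exists iE; split => //; rewrite sqI //.
have mpos : 0 < fine (mu E).
  by rewrite fine_gt0 // lt0e E0 measure_ge0 /= ltey_eq fin.
split=> // e e0.
have N0 : 0 < (size ds)%:R :> R by rewrite ltr0n.
have coef0 (D : set X) : measurable D ->
    sqn (coef mu (fun x => (\1_D x : R)%:C) 0) = fine (mu D) ^+ 2.
  move=> mD; rewrite -sqn_real -Cintegral_indic //; congr (sqn (Cintegral _ _)).
  by apply/funext => x; rewrite expo0 conjc1 mulr1.
have UEm : fine (mu U) = (size ds)%:R^-1 ^+ 2 * fine (mu E).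
  have := UE 0; rewrite mulmx0 !coef0 // => h; apply/eqP.
  rewrite -(@eqrXn2 _ 2) ?fine_ge0 ?measure_ge0 //; last first.
    by rewrite mulr_ge0 ?sqr_ge0 ?fine_ge0 ?measure_ge0.
  by rewrite h exprMn -exprM.
have d0 : 0 < (size ds)%:R^-1 ^+ 4 * e by rewrite mulr_gt0 // exprn_gt0 // invr_gt0.
have [|F [c [FL near]]] := tot iU _ _ d0.
  split; [by case: bU.1 | by case: bU.2 |].
  under eq_integral do rewrite normc_sqn.
  by have := nrm2_bmc mu bU; rewrite /nrm2 => ->; rewrite ltry.
exists F; split; [exact: fset_uniq | by move=> l lF; apply: FL |].
have os : orth_freq mu F.
  split; first exact: fset_uniq.
  move=> l l' lF l'F ll'; rewrite -L2dot_expo orth ?(negbTE ll') //; exact: FL.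
have := pythagoras c bU os; move: near.
have -> : (\int[mu]_x ((Normc.normc (iU x - \sum_(l <- F) c l * expo l x) ^+ 2)%:E))%E =
    (\int[mu]_x sqn (iU x - \sum_(l <- F) c l * expo l x))%:E.
  rewrite -nrm2_bmc; last first.
    apply: bmcB => //; apply: bmc_sum => l.
    by apply: bmcM; [exact: bmc_cst | exact: bmc_expo].
  by apply: eq_integral => x _; rewrite normc_sqn.
rewrite lte_fin => near E1; move: near; rewrite E1 sqI // UEm.
under eq_bigr => l _ do rewrite UE.
rewrite -mulr_sumr; set S := \sum_(l <- F) sqn _; set S' := \sum_(l <- F) sqn _.
have S'0 : 0 <= S' by apply: sumr_ge0 => l _; exact: sqn_ge0.
set m := fine (mu E); set N := (size ds)%:R in N0 *.
have -> : N^-1 ^+ 2 * m = N^-1 ^+ 4 * (N ^+ 2 * m) by field; rewrite gt_eqF.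
move=> h.
have {h} : N^-1 ^+ 4 * (N ^+ 2 * m - S) < N^-1 ^+ 4 * e.
  apply: le_lt_trans h; rewrite mulrBr lerDl //.
by rewrite ltr_pM2l ?exprn_gt0 ?invr_gt0 //; lra.
Qed.

End IsolatedPiece.

(** * Spectral measures have even matrices *)

Lemma half_intE (R : realType) (m : int) : ((2^-1 * m%:~R : R) \is a Num.int) = (2 %| m)%Z.
Proof.
apply/idP/idP => [/intrP[k kE]|/dvdzP[k ->]].
  by apply/dvdzP; exists k; apply: (@intr_inj R); rewrite intrM -kE; field.
have -> : 2^-1 * (k * 2)%:~R = k%:~R :> R by rewrite intrM; field.
exact: intr_int.
Qed.

Lemma half_parity (R : realType) (x y : R) : x \is a Num.int -> y \is a Num.int ->
  (2^-1 * x \is a Num.int) = (2^-1 * y \is a Num.int) ->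
  2^-1 * (x - y) \is a Num.int.
Proof.
by move=> /intrP[m ->] /intrP[k ->]; rewrite -intrB !half_intE => e; lia.
Qed.

Section Necessity.
Variables (R : realType) (mu : probability (borelRn R 2) R).
Variables (Mi : 'M[int]_2) (a1 a2 b1 b2 : int).
Local Notation X := (borelRn R 2).
Local Notation M := (map_mx intr Mi : 'M[R]_2).
Local Notation T := ((invmx M)^T).
Local Notation A := (M^T).
Local Notation ds := (dgs R a1 a2 b1 b2).
Local Notation det := (a1 * b2 - a2 * b1).
Hypothesis det_odd : ~~ (2 %| det)%Z.
Hypothesis mu_sa : forall E : set X, measurable E ->
  mu E = (((size ds)%:R^-1)%:E * \sum_(d <- ds) mu (affine_map M d @^-1` E))%E.
Hypothesis eM : expansive M.

Let ds0 : (0 < size ds)%N := isT.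

Lemma intvec_A (v : 'cV[R]_2) : intvec v -> intvec (A *m v).
Proof. by rewrite map_trmx; exact: intvec_mulmx. Qed.

Lemma intvec_A_exp k (v : 'cV[R]_2) : intvec v -> intvec (A ^+ k *m v).
Proof.
elim: k v => [|k IH] v iv; first by rewrite expr0 mul1mx.
by rewrite exprS -mulmxA; apply: intvec_A; exact: IH.
Qed.

Lemma A_exp_T_exp k (v : 'cV[R]_2) : A ^+ k *m (T ^+ k *m v) = v.
Proof. by rewrite mulmxA mulAT_exp // mul1mx. Qed.

(** Zeros of the Fourier transform lie in [1/2 *: A] applied to the lattice of
    points with denominator [det]. *)
Lemma fourier0_lattice (xi : 'cV[R]_2) : fourier mu xi = 0 ->
  intvec ((2 * det)%:~R *: (T *m xi)).
Proof.
move=> /(fourier_eq0 ds0 mu_sa eM)[j /dmask0_lattice].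
move=> /(intvec_A_exp j); rewrite -scalemxAr exprSr -mulmxA A_exp_T_exp.
exact.
Qed.

(** If a zero has an odd denominator after rescaling, the first factor of
    the product does not vanish there, and the zero comes from the next
    level. *)
Lemma fourier0_T (xi : 'cV[R]_2) : fourier mu xi = 0 -> intvec (det%:~R *: (T *m xi)) ->
  fourier mu (T *m xi) = 0.
Proof.
move=> + iv; rewrite (fourier_mask ds0 mu_sa) => /eqP.
by rewrite mulf_eq0 (negbTE (dmask_neq0_odd det_odd iv)) => /eqP.
Qed.

(** The parities of the coordinates of an integral vector, read from the
    integrality of the halves so that no integer vector has to be chosen. *)
Definition par (v : 'cV[R]_2) : bool * bool :=
  (2^-1 * v 0 0 \is a Num.int, 2^-1 * v 1 0 \is a Num.int).

Lemma par_eq v w : intvec v -> intvec w -> par v = par w ->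
  intvec (2^-1 *: (v - w)).
Proof.
move=> iv iw [e0 e1].
by apply: intvec_coord; rewrite !mxE half_parity.
Qed.

(** If [mu] is spectral, the sixteen classes of a spectrum for the parities
    of [2 det T (l - l0)] and of [2 det T^2 (l - l0')] are all inhabited:
    each class is orthogonal at the second level, so Bessel's inequality
    bounds its mass by that of the isolated piece, and Parseval's identity
    asks for sixteen times this mass. *)
Lemma spectral_even (L : set 'cV[R]_2) : orthonormal_basis_exp mu L -> even_mx Mi.
Proof.
move=> oL.
have [f [bf [f0 fP]]] := isolated_parseval ds0 (dgs_uniq R det_odd) mu_sa eM oL.
set I := \int[mu]_x sqn (f x) in f0 fP.
have [s [us sL sP]] := fP I f0.
have [l0 Ll0] : exists l0, L l0.
  case: s us sL sP => [|l s] us sL sP; last by exists l; apply: sL; exact: mem_head.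
  by move: sP; rewrite big_nil /=; lra.
have orth (l l' : 'cV[R]_2) : L l -> L l' -> l != l' -> fourier mu (l - l') = 0.
  by move=> Ll Ll' ne; case: oL => o _; rewrite -L2dot_expo o ?(negbTE ne).
pose n1 (l r : 'cV[R]_2) := (2 * det)%:~R *: (T *m (l - r)).
pose n2 (l r : 'cV[R]_2) := (2 * det)%:~R *: (T *m (T *m (l - r))).
have n1B l l' r : n1 l r - n1 l' r = n1 l l'.
  by rewrite /n1 -scalerBr -mulmxBr opprB addrA subrK.
have n2B l l' r : n2 l r - n2 l' r = n2 l l'.
  by rewrite /n2 -scalerBr -!mulmxBr opprB addrA subrK.
have in1 l r : L l -> L r -> intvec (n1 l r).
  move=> Ll Lr; case: (eqVneq l r) => [->|ne].
    by rewrite /n1 subrr mulmx0 scaler0; exact: intvec0.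
  by apply: fourier0_lattice; exact: orth.
have half_det (v : 'cV[R]_2) : 2^-1 *: ((2 * det)%:~R *: v) = det%:~R *: v :> 'cV[R]_2.
  by rewrite scalerA intrM mulrA mulVf ?mul1r // pnatr_eq0.
have same1 l l' r : L l -> L l' -> L r -> par (n1 l r) = par (n1 l' r) ->
    l != l' -> fourier mu (T *m (l - l')) = 0.
  move=> Ll Ll' Lr e ne; apply: fourier0_T; first exact: orth.
  by have := par_eq (in1 _ _ Ll Lr) (in1 _ _ Ll' Lr) e; rewrite n1B half_det.
pose c1 l := par (n1 l l0).
(* the representative of the class of [l0] has to be [l0] itself for [col] *)
pose rep c := if c == c1 l0 then l0 else
  if pselect (exists l, L l /\ c1 l = c) is left ex then projT1 (cid ex) else l0.
have repP l : L l -> L (rep (c1 l)) /\ c1 (rep (c1 l)) = c1 l.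
  move=> Ll; rewrite /rep; case: eqP => [->//|ne].
  case: pselect => [ex|no]; last by case: no; exists l.
  by case: (projT2 (cid ex)).
pose c2 l := par (n2 l (rep (c1 l))).
have in2 l l' : L l -> L l' -> c1 l = c1 l' -> intvec (n2 l l').
  move=> Ll Ll' e; case: (eqVneq l l') => [->|ne].
    by rewrite /n2 subrr !mulmx0 scaler0; exact: intvec0.
  by apply: fourier0_lattice; exact: (same1 _ _ l0).
have same2 l l' : L l -> L l' -> c1 l = c1 l' -> c2 l = c2 l' -> l != l' ->
    fourier mu (T *m (T *m (l - l'))) = 0.
  move=> Ll Ll' e1 e2 ne; apply: fourier0_T; first exact: (same1 _ _ l0).
  have [Lr rE] := repP l Ll.
  move: e2; rewrite /c2 -e1 => e2.
  have := par_eq (in2 _ _ Ll Lr (esym rE)) (in2 _ _ Ll' Lr _) e2.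
  by rewrite n2B half_det; apply; rewrite rE -e1.
have T2E (v : 'cV[R]_2) : T ^+ 2 *m v = T *m (T *m v) by rewrite mulmxA.
pose cl l := (c1 l, c2 l).
have hit c : exists2 l, L l & cl l = c.
  apply: contrapT => no.
  have [s' [us' s'L]] := fP I f0.
  have -> : \sum_(l <- s') sqn (coef mu f (T ^+ 2 *m l)) =
      \sum_(k : (bool * bool) * (bool * bool)) \sum_(l <- s' | cl l == k)
         sqn (coef mu f (T ^+ 2 *m l)).
    rewrite (exchange_big_dep xpredT) //=; apply: eq_bigr => l _.
    by rewrite (big_pred1 (cl l)) // => k; rewrite /= eq_sym.
  rewrite (bigD1 c) //= big1_seq ?add0r; last first.
    by move=> l /andP[/eqP lc /s'L Ll]; case: no; exists l.
  have bound k : \sum_(l <- s' | cl l == k) sqn (coef mu f (T ^+ 2 *m l)) <= I.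
    rewrite -big_filter -(big_map (mulmx (T ^+ 2)) xpredT (fun g => sqn (coef mu f g))).
    apply: bessel => //; split.
      rewrite map_inj_uniq ?filter_uniq // => l l' e.
      by rewrite -(A_exp_T_exp 2 l) e A_exp_T_exp.
    move=> _ _ /mapP[l + ->] /mapP[l' + ->].
    rewrite !mem_filter => /andP[/eqP lk /s'L Ll] /andP[/eqP l'k /s'L Ll'] ne.
    have e : cl l = cl l' by rewrite lk l'k.
    rewrite -mulmxBr T2E.
    by apply: (same2 _ _ Ll Ll' (congr1 fst e) (congr1 snd e)); apply: contra ne => /eqP ->.
  have : \sum_(i | i != c) \sum_(l <- s' | cl l == i) sqn (coef mu f (T ^+ 2 *m l))
      <= \sum_(i : (bool * bool) * (bool * bool) | i != c) I.
    by apply: ler_sum => k _; exact: bound.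
  rewrite sumr_const.
  have -> : #|[pred i | i != c]| = 15%N.
    by have := cardC1 c; rewrite !card_prod !card_bool.
  move=> le15 lt; have := lt_le_trans lt le15.
  by rewrite /= -mulr_natl; lra.
(* the classes trivial at the first level realize every parity at the second *)
have col c : exists2 v : 'cV[R]_2, intvec v /\ par v = c & par (A *m v) = (true, true).
  have [l Ll e] := hit (c1 l0, c).
  have e1 : c1 l = c1 l0 := congr1 fst e.
  have e2 : c2 l = c := congr1 snd e.
  have r0 : rep (c1 l) = l0 by rewrite e1 /rep eqxx.
  exists (n2 l l0).
    split; last by rewrite -e2 /c2 r0.
    exact: in2.
  have -> : A *m n2 l l0 = n1 l l0.
    by rewrite /n2 -scalemxAr (mulmxA A) mulAT // mul1mx.
  rewrite -/(c1 l) e1 /c1 /n1 subrr mulmx0 scaler0 /par !mxE mulr0.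
  by rewrite rpred0.
have ev (x y m k : int) : (2 %| x * m + y * k)%Z =
    (((2 %| x) || (2 %| m)) == ((2 %| y) || (2 %| k)))%Z.
  by rewrite -!even_mul; lia.
have AE (v : 'cV[R]_2) (z : 'cV[int]_2) i : v = map_mx intr z ->
    (A *m v) i 0 = (Mi 0 i * z 0 0 + Mi 1 i * z 1 0)%:~R.
  move=> ->; rewrite map_trmx -map_mxM mxE; congr (_%:~R).
  rewrite mxE !big_ord_recl big_ord0 addr0 !mxE.
  by congr (_ + Mi _ i * z _ 0); exact: val_inj.
have final (c : bool * bool) i : (~~ c.1 /\ c.2 -> (2 %| Mi 0%R i)%Z) /\ (c.1 /\ ~~ c.2 -> (2 %| Mi 1%R i)%Z).
  have [v [/intvecP[z vE] pc] pA] := col c.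
  have Ai : (2 %| (Mi 0 i * z 0 0 + Mi 1 i * z 1 0)%R)%Z.
    rewrite -(half_intE R) -(AE _ _ i vE).
    have [q0 q1] : (2^-1 * (A *m v) 0 0 \is a Num.int) /\
      (2^-1 * (A *m v) 1 0 \is a Num.int) by case: pA.
    have := ord2P i.
    by rewrite !inE => /orP[] /eqP ->.
  have c1E : c.1 = (2 %| z 0%R 0%R)%Z by rewrite -pc /par vE !mxE /= half_intE.
  have c2E : c.2 = (2 %| z 1%R 0%R)%Z by rewrite -pc /par vE !mxE /= half_intE.
  move: Ai; rewrite ev -c1E -c2E.
  case: c.1; case: c.2 => /=; rewrite ?orbT ?orbF => h; split=> -[] //= _ _.
  by move/eqP: h.
move=> i j; have := ord2P i.
rewrite !inE => /orP[] /eqP ->.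
  exact: (final (false, true) j).1.
exact: (final (true, false) j).2.
Qed.

End Necessity.

(** * Absence of periodic zeros *)

Section NoPeriodicZero.
Variables (R : realType) (mu : probability (borelRn R 2) R).
Variables (Mi Ni : 'M[int]_2) (a1 a2 b1 b2 : int).
Local Notation X := (borelRn R 2).
Local Notation M := (map_mx intr Mi : 'M[R]_2).
Local Notation T := ((invmx M)^T).
Local Notation A := (M^T).
Local Notation ds := (dgs R a1 a2 b1 b2).
Local Notation det := (a1 * b2 - a2 * b1).
Hypothesis det_odd : ~~ (2 %| det)%Z.
Hypothesis mu_sa : forall E : set X, measurable E ->
  mu E = (((size ds)%:R^-1)%:E * \sum_(d <- ds) mu (affine_map M d @^-1` E))%E.
Hypothesis eM : expansive M.
Hypothesis MN : Mi = 2 *: Ni.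
Implicit Types (v w xi : 'cV[R]_2).
Let ds0 : (0 < size ds)%N := isT.

Lemma T_A v : T *m (A *m v) = v.
Proof. by rewrite mulmxA mulTA // mul1mx. Qed.

Lemma T_exp_A_exp k v : T ^+ k *m (A ^+ k *m v) = v.
Proof. by rewrite mulmxA mulTA_exp // mul1mx. Qed.

(** The lattice dual to the smallest [M]-invariant lattice containing the
    digits; translating by [A ^+ k *m v] with [v] in it preserves the first
    [k] factors of the Fourier transform. *)
Definition gam v : Prop := forall j : nat,
  dot (da R a1 a2) (A ^+ j *m v) \is a Num.int /\
  dot (db R b1 b2) (A ^+ j *m v) \is a Num.int.

Lemma dot_int (x y : int) v : intvec v ->
  dot (map_mx intr (col2 x y)) v \is a Num.int.
Proof.
by move=> iv; rewrite dot_col2 rpredD // rpredM // intr_int.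
Qed.

Lemma gam_intvec v : intvec v -> gam v.
Proof.
by move=> iv j; split; apply: dot_int; exact: intvec_A_exp.
Qed.

Lemma gam0 : gam 0.
Proof. by apply: gam_intvec; exact: intvec0. Qed.

Lemma gamD v w : gam v -> gam w -> gam (v + w).
Proof.
move=> gv gw j; rewrite mulmxDr !dotDr.
by have [? ?] := gv j; have [? ?] := gw j; split; rewrite rpredD.
Qed.

Lemma gamN v : gam v -> gam (- v).
Proof.
move=> gv j; rewrite mulmxN.
have dN u w : dot u (- w) = - dot u w by rewrite dotC dotNl dotC.
by have [? ?] := gv j; rewrite !dN; split; rewrite rpredN.
Qed.

Lemma gam_A_exp k v : gam v -> gam (A ^+ k *m v).
Proof. by move=> gv j; rewrite mulmxA -[_ *m A ^+ k]exprD; exact: gv. Qed.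

Lemma dmask_gam xi v : gam v -> dmask ds (xi + v) = dmask ds xi.
Proof.
by move=> gv; have := gv 0%N; rewrite expr0 mul1mx => -[? ?]; exact: dmask_add_int.
Qed.

Lemma mask_prod_gam k xi v : gam v ->
  mask_prod M ds k (xi + A ^+ k *m v) = mask_prod M ds k xi.
Proof.
move=> gv; elim: k xi => //= k IH xi.
by rewrite mulmxDr exprS -mulmxA T_A IH dmask_gam //; exact: gam_A_exp.
Qed.

Lemma A_half (z : 'cV[int]_2) :
  A *m (2^-1 *: map_mx intr z) = map_mx intr (Ni^T *m z).
Proof.
rewrite map_mxM -scalemxAr scalemxAl; congr (_ *m _).
by apply/matrixP => i j; rewrite MN !mxE intrM mulrA mulVf ?mul1r // pnatr_eq0.
Qed.

Definition periodic_zero xi : Prop :=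
  forall v, gam v -> fourier mu (xi + v) = 0.

Lemma periodic_zero_det xi : periodic_zero xi -> intvec (det%:~R *: xi).
Proof.
move=> /(_ 0 gam0); rewrite addr0 => /(fourier0_lattice mu_sa eM).
move=> /intvecP[z zE].
have -> : det%:~R *: xi = A *m (2^-1 *: map_mx intr z).
  rewrite -zE scalerA -scalemxAr mulmxA mulAT // mul1mx intrM mulrA.
  by rewrite mulVf ?mul1r // pnatr_eq0.
by rewrite A_half; exact: intvec_intr.
Qed.

Lemma periodic_zero_preimage xi (z : 'cV[int]_2) : periodic_zero xi ->
  dmask ds (T *m xi + 2^-1 *: map_mx intr z) != 0 ->
  periodic_zero (T *m xi + 2^-1 *: map_mx intr z).
Proof.
move=> pz m0 v gv; have := pz (A *m (2^-1 *: map_mx intr z + v)).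
rewrite (fourier_mask ds0 mu_sa) (mulmxDr T) T_A addrA dmask_gam // => h.
have gA : gam (A *m (2^-1 *: map_mx intr z + v)).
  rewrite mulmxDr; apply: gamD.
    by rewrite A_half; apply: gam_intvec; exact: intvec_intr.
  by have := gam_A_exp 1 gv; rewrite expr1.
by move/eqP: (h gA); rewrite mulf_eq0 (negbTE m0) => /eqP.
Qed.

(** Periodic zeros have odd denominator, so exactly one of the four preimages
    of such a point is again one; the mask vanishes at the other three, hence
    has modulus [1] at this one. *)
Lemma periodic_zero_step xi : periodic_zero xi -> exists eta,
  [/\ periodic_zero eta, intvec (A *m eta - xi),
      dot (da R a1 a2) eta \is a Num.int & dot (db R b1 b2) eta \is a Num.int].
Proof.
move=> pz.
pose w (z : 'cV[int]_2) := T *m xi + 2^-1 *: map_mx intr z.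
have sum1 : \sum_(z <- unit_square) sqn (dmask ds (w z)) = 1.
  exact: dmask_unit_square.
have [z zs zn] : exists2 z, z \in unit_square & dmask ds (w z) != 0.
  apply: contrapT => no; move: sum1; rewrite big1_seq; first by move/eqP; rewrite eq_sym oner_eq0.
  move=> z /= zs; apply/eqP; rewrite sqn_eq0; apply: contrapT => /negP nz.
  by apply: no; exists z.
have pzw := periodic_zero_preimage pz zn.
have others z' : z' \in unit_square -> z' != z -> dmask ds (w z') = 0.
  move=> z's z'z; apply/eqP; apply: contraT => /(periodic_zero_preimage pz) pzw'.
  have := intvecB (periodic_zero_det pzw') (periodic_zero_det pzw).
  rewrite -scalerBr /w opprD addrACA subrr add0r -scalerBr -map_mxB.
  move=> iv; exfalso; move: z'z; rewrite -subr_eq0.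
  have ev2 i : (2 %| z' i 0%R - z i 0%R)%Z.
    have := iv i; rewrite !mxE mulrCA -intrM half_intE.
    by rewrite (odd_det_cancel det_odd).
  move: (ev2 0) (ev2 1) => {ev2 iv pzw' pzw zn}.
  by move: zs z's; rewrite !inE => /or4P[] /eqP -> /or4P[] /eqP ->;
     rewrite !mxE //= ?subrr ?eqxx.
have m1 : sqn (dmask ds (w z)) = 1.
  rewrite -sum1 (bigD1_seq z) ?unit_square_uniq //= big_seq_cond big1 ?addr0 // => z'.
  by move=> /andP[z's z'z]; rewrite others // sqn0.
have [d1 d2] := dmask_sqn1 m1.
exists (w z); split => //.
rewrite /w mulmxDr (mulmxA A) mulAT // mul1mx addrAC subrr add0r A_half.
exact: intvec_intr.
Qed.

(** The Cayley-Hamilton identity in dimension [2]. *)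
Lemma mx2_quadratic (K : comNzRingType) (C : 'M[K]_2) :
  C *m C = \tr C *: C - \det C *: 1%:M.
Proof.
have e : lift ord0 ord0 = 1 :> 'I_2 by exact: val_inj.
have e' : lift 1 ord0 = 0 :> 'I_2 by exact: val_inj.
have detE : \det C = C 0 0 * C 1 1 - C 0 1 * C 1 0.
  rewrite (expand_det_row _ 0) !big_ord_recl big_ord0 /cofactor !det_mx11 !mxE /=.
  rewrite ?e ?e' ?expr0 ?expr1 ?mul1r ?mulN1r ?addr0 ?addn0 ?add0n.
  by rewrite ?expr0 ?expr1 ?mul1r ?mulN1r ?mulrN.
rewrite detE; have trE : \tr C = C 0 0 + C 1 1.
  rewrite /mxtrace !big_ord_recl big_ord0 addr0.
  by rewrite ?e.
rewrite trE; apply/matrixP => i j.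
have := ord2P i.
have := ord2P j.
by rewrite !inE => /orP[] /eqP -> /orP[] /eqP ->;
  rewrite !mxE !big_ord_recl big_ord0 /= ?e ?mulr1n ?mulr0n; ring.
Qed.

(** Two levels suffice by the quadratic equation of [A]. *)
Lemma gam_two v :
  (dot (da R a1 a2) v \is a Num.int /\ dot (db R b1 b2) v \is a Num.int) ->
  (dot (da R a1 a2) (A *m v) \is a Num.int /\
   dot (db R b1 b2) (A *m v) \is a Num.int) -> gam v.
Proof.
move=> g0 g1 j; suff : (dot (da R a1 a2) (A ^+ j *m v) \is a Num.int /\
    dot (db R b1 b2) (A ^+ j *m v) \is a Num.int) /\
   (dot (da R a1 a2) (A ^+ j.+1 *m v) \is a Num.int /\
    dot (db R b1 b2) (A ^+ j.+1 *m v) \is a Num.int) by case.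
elim: j => [|j [IH0 IH1]]; first by rewrite expr0 mul1mx expr1.
split=> //.
have -> : A ^+ j.+2 *m v =
    (\tr Mi^T)%:~R *: (A ^+ j.+1 *m v) - (\det Mi^T)%:~R *: (A ^+ j *m v).
  rewrite !exprS -!mulmxA.
  have -> : A *m (A *m (A ^+ j *m v)) = (A *m A) *m (A ^+ j *m v) by rewrite mulmxA.
  rewrite mx2_quadratic mulmxBl -!scalemxAl mul1mx map_trmx; congr (_ *: _ - _ *: _).
    by rewrite /mxtrace rmorph_sum; apply: eq_bigr => i _; rewrite !mxE.
  by rewrite det_map_mx.
have dB u x y (s t : R) : dot u (s *: x - t *: y) = s * dot u x - t * dot u y.
  by rewrite dotC dotBl !dotZl !(dotC u).
by rewrite !dB; case: IH0 => ? ?; case: IH1 => ? ?;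
  split; rewrite rpredB // rpredM // intr_int.
Qed.

(** Each step adds one level at which the pairings with the digits are
    integral; after two steps the point lies in the lattice itself, and
    translating it to the origin contradicts the value [1] there. *)
Lemma no_periodic_zero xi : exists2 v, gam v & fourier mu (xi + v) != 0.
Proof.
apply: contrapT => no.
have pz : periodic_zero xi.
  move=> v gv; apply/eqP; apply: contrapT => /negP nz; by apply: no; exists v.
have [eta [pe _ ea eb]] := periodic_zero_step pz.
have [zeta [pzeta iz za zb]] := periodic_zero_step pe.
have gz : gam zeta.
  apply: gam_two => //; rewrite -(subrK eta (A *m zeta)) !(dotDr _ (A *m zeta - eta)).
  by split; apply: rpredD => //; exact: dot_int.
by have /eqP := pzeta _ (gamN gz); rewrite subrr fourier0 oner_eq0.
Qed.

End NoPeriodicZero.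

(** * Spectra for even matrices *)

Section Sufficiency.
Variables (R : realType) (mu : probability (borelRn R 2) R).
Variables (Mi Ni : 'M[int]_2) (a1 a2 b1 b2 : int).
Local Notation X := (borelRn R 2).
Local Notation M := (map_mx intr Mi : 'M[R]_2).
Local Notation T := ((invmx M)^T).
Local Notation A := (M^T).
Local Notation ds := (dgs R a1 a2 b1 b2).
Local Notation det := (a1 * b2 - a2 * b1).
Hypothesis det_odd : ~~ (2 %| det)%Z.
Hypothesis mu_sa : forall E : set X, measurable E ->
  mu E = (((size ds)%:R^-1)%:E * \sum_(d <- ds) mu (affine_map M d @^-1` E))%E.
Hypothesis eM : expansive M.
Hypothesis MN : Mi = 2 *: Ni.
Implicit Types (v w xi : 'cV[R]_2) (S : seq 'cV[R]_2).
Let ds0 : (0 < size ds)%N := isT.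
Local Notation gam := (gam Mi a1 a2 b1 b2).
Local Notation mprod := (mask_prod M ds).

Definition absf xi : R := Normc.normc (fourier mu xi).

Lemma absf_ge0 xi : 0 <= absf xi.
Proof. by rewrite /absf; case: (fourier _ _) => a b; exact: sqrtr_ge0. Qed.

Lemma absf_sqr xi : absf xi ^+ 2 = sqn (fourier mu xi).
Proof. exact: normc_sqn. Qed.

Lemma absf_le1 xi : absf xi <= 1.
Proof.
rewrite -(@ler_pXn2r _ 2) ?nnegrE ?absf_ge0 // absf_sqr expr1n.
exact: sqn_fourier_le1.
Qed.

Lemma absf0 : absf 0 = 1.
Proof. by rewrite /absf fourier0 Normc.normc1. Qed.

Lemma absf_lip : exists2 K : R, 0 < K &
  forall v w, absf v <= absf w + K * n1 (v - w).
Proof.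
have [K K0 KP] := fourier_lipschitz ds0 mu_sa eM.
exists (K + 1); first by rewrite ltr_wpDl.
move=> v w; have := le_normcD (fourier mu v - fourier mu w) (fourier mu w).
rewrite subrK -/(absf v) -/(absf w) => /le_trans; apply.
rewrite addrC lerD2l; apply: le_trans (KP v w) _.
by rewrite ler_wpM2r ?n1_ge0 // lerDl.
Qed.

Lemma n1N v : n1 (- v) = n1 v.
Proof. by apply: eq_bigr => i _; rewrite mxE normrN. Qed.

Definition reach v : R := sup [set absf (v + w) | w in gam].

Lemma reach_has_sup v : has_sup [set absf (v + w) | w in gam].
Proof.
split; first by exists (absf (v + 0)); exists 0 => //; exact: gam0.
by exists 1 => _ [w _ <-]; exact: absf_le1.
Qed.

Lemma reach_ge v w : gam w -> absf (v + w) <= reach v.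
Proof. by move=> gw; apply: sup_upper_bound; [exact: reach_has_sup | exists w]. Qed.

Lemma reach_gt0 v : 0 < reach v.
Proof.
have [w gw nz] := no_periodic_zero det_odd mu_sa eM MN v.
apply: lt_le_trans (reach_ge v gw); rewrite lt_neqAle absf_ge0 andbT eq_sym.
by apply: contra nz => /eqP/Normc.eq0_normc ->.
Qed.

Lemma reach_witness v (e : R) : e < reach v -> exists2 w, gam w & e < absf (v + w).
Proof.
move=> ev; have d0 : 0 < reach v - e by rewrite subr_gt0.
have [_ [w gw <-]] := sup_adherent d0 (reach_has_sup v).
by rewrite subKr => h; exists w.
Qed.

Lemma reach_gam v w : gam w -> reach (v + w) = reach v.
Proof.
move=> gw; rewrite /reach; congr sup; apply/seteqP; split => _ [x gx <-].
  by exists (w + x); [exact: gamD | rewrite addrA].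
exists (x - w); last by rewrite addrAC addrA subrK addrC.
by apply: gamD => //; exact: gamN.
Qed.

(** A supremum of Lipschitz functions with the same constant. *)
Lemma reach_lip (K : R) : 0 < K ->
  (forall v w, absf v <= absf w + K * n1 (v - w)) ->
  forall v w, reach v <= reach w + K * n1 (v - w).
Proof.
move=> K0 KP v w; apply: ge_sup => [|_ [x gx <-]]; first by case: (reach_has_sup v).
apply: le_trans (KP (v + x) (w + x)) _.
rewrite opprD addrACA subrr addr0 lerD2r; exact: reach_ge.
Qed.

(** Compactness of the unit square turns the absence of periodic zeros into a
    uniform lower bound. *)
Lemma uniform_reach : exists e : R, [/\ 0 < e, e <= 1 &
  forall v, exists2 w, gam w & e <= absf (v + w)].
Proof.
have [K K0 KP] := absf_lip; have RP := reach_lip K0 KP.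
pose h (q : R * R) := reach (col2 q.1 q.2).
have hc : continuous h.
  move=> q; apply/cvgrPdist_le => e e0.
  pose phi (r : R * R) := K * (`|r.1 - q.1| + `|r.2 - q.2|).
  have phi0 : phi r @[r --> q] --> (0 : R).
    have c1 : `|r.1 - q.1| @[r --> q] --> `|q.1 - q.1|.
      by apply: cvg_norm; apply: cvgB; [exact: cvg_fst | exact: cvg_cst].
    have c2 : `|r.2 - q.2| @[r --> q] --> `|q.2 - q.2|.
      by apply: cvg_norm; apply: cvgB; [exact: cvg_snd | exact: cvg_cst].
    have := cvgM (cvg_cst K) (cvgD c1 c2).
    by rewrite !subrr normr0 addr0 mulr0; apply.
  have n1q (r s : R * R) : n1 (col2 r.1 r.2 - col2 s.1 s.2) = `|r.1 - s.1| + `|r.2 - s.2|.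
    by rewrite /n1 !big_ord_recl big_ord0 !mxE /= addr0.
  move/cvgr0Pnorm_le : phi0 => /(_ e e0); apply: filterS => r rq.
  have bound (s t : R * R) : h s - h t <= K * (`|s.1 - t.1| + `|s.2 - t.2|).
    by rewrite lerBlDl -n1q; exact: RP.
  apply: le_trans (le_trans (ler_norm _) rq).
  rewrite ler_norml lerNl opprB; apply/andP; split; first exact: bound.
  by apply: le_trans (bound q r) _; rewrite !(distrC q.1) !(distrC q.2).
have [|c _ cmin] := @compact_EVT_min _ R h (`[0, 1]%classic `*` `[0, 1]%classic) _
    (compact_setX (@segment_compact R 0 1) (@segment_compact R 0 1)) (continuous_subspaceT hc).
  by exists (0, 0); split; rewrite /= in_itv /= lexx ler01.
have hp : 0 < h c by exact: reach_gt0.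
have hall v : h c <= reach v.
  pose fl : 'cV[R]_2 := \col_i (Num.floor (v i 0))%:~R.
  have gfl : gam fl by apply: gam_intvec => // i; rewrite mxE intr_int.
  rewrite -(subrK fl v) (reach_gam _ gfl).
  pose q := ((v - fl) 0 0, (v - fl) 1 0).
  have -> : v - fl = col2 q.1 q.2.
    apply/matrixP => i j; rewrite (ord1 j) mxE /=.
    have := ord2P i.
    by rewrite !inE => /orP[] /eqP -> /=; rewrite !mxE.
  apply: cmin; rewrite inE; split; rewrite /= !mxE in_itv /= subr_ge0 floor_le /=.
    by rewrite lerBlDl -intrD1 ltW // floorD1_gt.
  by rewrite lerBlDl -intrD1 ltW // floorD1_gt.
exists (h c / 2); split; first by rewrite divr_gt0.
  have : h c <= 1; last by lra.
  apply: le_trans (hall 0) _; apply: ge_sup; first by case: (reach_has_sup 0).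
  by move=> _ [w _ <-]; exact: absf_le1.
move=> v; have [|w gw lw] := @reach_witness v (h c / 2); last by exists w => //; exact: ltW.
apply: lt_le_trans (hall v); lra.
Qed.

(** Membership in the invariant lattice and Parseval's identity for the
    convolution of the first [k] factors of [mu]. *)
Definition spec k S : Prop := (forall w, w \in S -> gam w) /\
  forall xi, \sum_(w <- S) sqn (mprod k (xi + w)) = 1.

(** At the frequency [- w] the term of [w] is already [1], so all other
    terms vanish. *)
Lemma spec_orth k S w : spec k S -> w \in S ->
  forall w', w' \in rem w S -> mprod k (w' - w) = 0.
Proof.
move=> [_ sum1] wS w' w'S; have := sum1 (- w).
rewrite (big_rem w) //= addNr mask_prod0 // sqn1.
rewrite (big_rem w' w'S) /= => e; apply/eqP.
rewrite -sqn_eq0 eq_le sqn_ge0 andbT addrC.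
have : 0 <= \sum_(x <- rem w' (rem w S)) sqn (mprod k (- w + x)).
  by apply: sumr_ge0 => x _; exact: sqn_ge0.
by move: e; lra.
Qed.

Lemma spec_uniq k S : spec k S -> uniq S.
Proof.
move=> sS; apply: count_mem_uniq => w; case: (boolP (w \in S)) => [wS|]; last first.
  by move/count_memPn.
rewrite (permP (perm_to_rem wS)) /= eqxx; congr (_ + _)%N; apply/count_memPn.
apply/negP => /(spec_orth sS wS)/eqP.
by rewrite subrr mask_prod0 // oner_eq0.
Qed.

Lemma spec0 : spec 0 [:: 0].
Proof.
split; first by move=> w; rewrite inE => /eqP ->; exact: gam0.
by move=> xi; rewrite big_seq1 /= sqn1.
Qed.

(** The sum over the half-integer translates of the mask; evenness of the
    matrix turns these translates into integral vectors one level below. *)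
Lemma spec1 : spec 1 [seq map_mx intr (Ni^T *m z) | z <- unit_square].
Proof.
split; first by move=> _ /mapP[z _ ->]; apply: gam_intvec; exact: intvec_intr.
move=> xi; rewrite big_map -[RHS](dmask_unit_square det_odd (T *m xi)).
apply: eq_bigr => z _; rewrite /= mulr1 mulmxDr.
by rewrite -(A_half R MN) T_A.
Qed.

(** The first factor is invariant under the translations [A ^+ k *m w'], so
    the double sum factors; the choice of [S'] may depend on the first
    frequency. *)
Lemma spec_compose k l S (S' : 'cV[R]_2 -> seq 'cV[R]_2) : spec k S ->
  (forall w, w \in S -> spec l (S' w)) ->
  spec (k + l) [seq w + A ^+ k *m w' | w <- S, w' <- S' w].
Proof.
move=> [gS sum1] sS'; split.
  move=> _ /allpairsPdep[w [w' [wS w'S ->]]]; apply: gamD; first exact: gS.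
  by apply: gam_A_exp; exact: (sS' w wS).1.
move=> xi; rewrite big_allpairs_dep /= -[RHS](sum1 xi); apply: eq_big_seq => w wS.
have [gS' sum1'] := sS' w wS.
transitivity (sqn (mprod k (xi + w)) *
    \sum_(w' <- S' w) sqn (mprod l (T ^+ k *m (xi + w) + w'))); last first.
  by rewrite sum1' mulr1.
rewrite mulr_sumr; apply: eq_big_seq => w' w'S; rewrite (addrA xi) mask_prodD sqnM mask_prod_gam //; last exact: gS'.
by rewrite mulmxDr (T_exp_A_exp eM).
Qed.

Lemma spec_shift k S (kap : 'cV[R]_2 -> 'cV[R]_2) : spec k S ->
  (forall w, gam (kap w)) -> spec k [seq w + A ^+ k *m kap w | w <- S].
Proof.
move=> [gS sum1] gk; split.
  by move=> _ /mapP[w wS ->]; apply: gamD; [exact: gS | exact: gam_A_exp].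
move=> xi; rewrite big_map -[RHS](sum1 xi); apply: eq_bigr => w _.
by rewrite addrA mask_prod_gam.
Qed.

Lemma spec_exists k : exists2 S, spec k S & 0 \in S.
Proof.
elim: k => [|k [S sS S0]]; first by exists [:: 0]; [exact: spec0 | rewrite mem_head].
exists [seq w + A ^+ 1 *m w' | w <- [seq map_mx intr (Ni^T *m z) | z <- unit_square], w' <- S].
  by rewrite -addn1 addnC; apply: spec_compose spec1 _.
apply/allpairsP; exists (0, 0); rewrite mulmx0 addr0; split => //.
apply/mapP; exists (col2 0 0); first by rewrite mem_head.
have -> : col2 0 0 = 0 :> 'cV[int]_2 by apply/matrixP => i j; rewrite !mxE; case: ifP.
by rewrite mulmx0 map_mx0.
Qed.

Lemma seq_eventually (I : eqType) (P : I -> nat -> Prop) (s : seq I) :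
  (forall x, exists k0, forall k, (k0 <= k)%N -> P x k) ->
  exists k0, forall x k, x \in s -> (k0 <= k)%N -> P x k.
Proof.
move=> H; elim: s => [|x s [k0 IH]]; first by exists 0%N.
have [k1 Hx] := H x; exists (maxn k0 k1) => y k; rewrite inE geq_max.
by move=> /predU1P[->|ys] /andP[h0 h1]; [exact: Hx | exact: IH].
Qed.

Lemma n1_T_eventually (K e : R) (s : seq 'cV[R]_2) : 0 < K -> 0 < e ->
  exists k0, forall w k, w \in s -> (k0 <= k)%N -> K * n1 (T ^+ k *m w) < e.
Proof.
move=> K0 e0; apply: seq_eventually => w.
have [k0 kP] := T_pow_small eM w (divr_gt0 e0 K0); exists k0 => k /kP.
by rewrite ltr_pdivlMr // mulrC.
Qed.

Section Tower.
Variables (K e : R).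
Hypothesis K0 : 0 < K.
Hypothesis KP : forall v w, absf v <= absf w + K * n1 (v - w).
Hypothesis e0 : 0 < e.
Hypothesis e1 : e <= 1.
Hypothesis eP : forall v, exists2 w, gam w & e <= absf (v + w).

(** The rescaled frequencies stay where the transform is bounded below,
    which prevents mass from escaping in the limit. *)
Definition good k S : Prop := forall w, w \in S -> e / 2 <= absf (T ^+ k *m w).

(** Each element [w + A ^+ k *m w'] of the next level is moved within its class
    by an element of the invariant lattice, so that its rescaling stays where
    the Fourier transform is large; [w' = 0] is left alone to keep [S]. *)
Lemma tower_step k S : spec k S -> exists k' S',
  [/\ (k < k')%N, spec k' S', good k' S' & {subset S <= S'}].
Proof.
move=> sS; have e20 : 0 < e / 2 by rewrite divr_gt0.
have [k0 k0P] := n1_T_eventually S K0 e20.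
pose p := k0.+1.
have [W sW W0] := spec_exists p.
have /choice[kap kapP] : forall v, exists w, [/\ gam w, e <= absf (T ^+ p *m v + w) &
    v = 0 -> w = 0].
  move=> v; case: (eqVneq v 0) => [->|vn0].
    by exists 0; split => //; [exact: gam0 | rewrite mulmx0 addr0 absf0].
  have [w gw lw] := eP (T ^+ p *m v); exists w; split => // v0.
  by rewrite v0 eqxx in vn0.
exists (k + p)%N, [seq w + A ^+ k *m w' | w <- S, w' <- [seq w' + A ^+ p *m kap w' | w' <- W]].
split.
- by rewrite /p addnS ltnS leq_addr.
- apply: spec_compose => // _ _; apply: spec_shift => // w.
  by case: (kapP w).
- move=> _ /allpairsP[[w w''] /= [wS /mapP[w' w'W ->] ->]].
  have [gk lk _] := kapP w'.
  have E : T ^+ (k + p) *m (w + A ^+ k *m (w' + A ^+ p *m kap w')) =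
      T ^+ (k + p) *m w + (T ^+ p *m w' + kap w').
    rewrite mulmxDr; congr (_ + _).
    rewrite addnC exprD -mulmxA (T_exp_A_exp eM) (mulmxDr (T ^+ p)).
    by rewrite (T_exp_A_exp eM).
  rewrite E; set x := T ^+ (k + p) *m w; set y := T ^+ p *m w' + kap w' in lk *.
  have yx : y - (x + y) = - x by rewrite opprD addrC -addrA addNr addr0.
  have := KP y (x + y); rewrite yx n1N.
  have : K * n1 x < e / 2.
    by apply: (k0P w (k + p)%N wS); rewrite /p addnS leqW ?leq_addl.
  lra.
move=> w wS; apply/allpairsP; exists (w, 0); split => //=; last by rewrite mulmx0 addr0.
apply/mapP; exists 0 => //; have [_ _ ->] := kapP 0; rewrite ?mulmx0 ?addr0 //.
Qed.

Lemma tower : exists (k_ : nat -> nat) (S_ : nat -> seq 'cV[R]_2),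
  [/\ forall i, (i <= k_ i)%N, forall i, spec (k_ i) (S_ i), forall i, good (k_ i) (S_ i) &
      forall i, {subset S_ i <= S_ i.+1}].
Proof.
pose state := {x : nat * seq 'cV[R]_2 | spec x.1 x.2 /\ good x.1 x.2}.
have /choice[next nextP] : forall x : state, exists y : state,
    ((projT1 x).1 < (projT1 y).1)%N /\ {subset (projT1 x).2 <= (projT1 y).2}.
  move=> [[k S] /= [sS gS]]; have [k' [S' [kk' sS' gS' SS']]] := tower_step sS.
  by exists (exist _ (k', S') (conj sS' gS')).
have init : spec 0 [:: 0] /\ good 0 [:: 0].
  split; first exact: spec0.
  move=> w; rewrite inE => /eqP ->; rewrite mulmx0 absf0 ler_pdivrMr // mul1r.
  by apply: le_trans e1 _; rewrite ler1n.
pose st := fix st i : state := if i is j.+1 then next (st j) else exist _ (0%N, [:: 0]) init.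
exists (fun i => (projT1 (st i)).1), (fun i => (projT1 (st i)).2); split.
- elim=> // i IH; have [lt _] := nextP (st i); exact: leq_ltn_trans IH lt.
- by move=> i; case: (projT2 (st i)).
- by move=> i; case: (projT2 (st i)).
- by move=> i; case: (nextP (st i)).
Qed.

End Tower.

(** Parseval's identity survives the passage to the limit along the tower: the
    terms at level [k_ i] are dominated by those of the limit, up to the factor
    given by [good]. *)
Lemma tower_parseval (K e : R) (k_ : nat -> nat) (S_ : nat -> seq 'cV[R]_2) :
  0 < K -> (forall v w, absf v <= absf w + K * n1 (v - w)) -> 0 < e ->
  (forall i, (i <= k_ i)%N) -> (forall i, spec (k_ i) (S_ i)) ->
  (forall i, good e (k_ i) (S_ i)) -> (forall i, {subset S_ i <= S_ i.+1}) ->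
  forall xi (d : R), 0 < d -> exists i,
    1 - d < \sum_(w <- S_ i) sqn (fourier mu (xi + w)).
Proof.
move=> K0 KP e0 kge sS gS SS xi.
suff small d : 0 < d -> d <= 1 -> exists i,
    1 - d < \sum_(w <- S_ i) sqn (fourier mu (xi + w)).
  move=> d d0; have [//||i iP] := small (Num.min d 1); first by rewrite lt_min d0 ltr01.
    by rewrite ge_min lexx orbT.
  exists i; apply: le_lt_trans iP; rewrite lerD2l lerN2.
  by rewrite ge_min lexx.
move=> d0 d1; apply: contrapT => no.
pose Q i := \sum_(w <- S_ i) sqn (fourier mu (xi + w)).
have Qle i : Q i <= 1 - d.
  by rewrite leNgt; apply/negP => lt; apply: no; exists i.
have SSle i j : (i <= j)%N -> {subset S_ i <= S_ j}.
  move=> /subnK <-; elim: (j - i)%N => // m IH w wS; rewrite addSn; apply: SS; exact: IH.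
have us i : uniq (S_ i) by exact: spec_uniq (sS i).
have split i j (F : 'cV[R]_2 -> R) : (i <= j)%N ->
    \sum_(w <- S_ j) F w = \sum_(w <- S_ i) F w + \sum_(w <- S_ j | w \notin S_ i) F w.
  move=> ij; rewrite (bigID (mem (S_ i))) /=; congr (_ + _).
  rewrite -big_filter; apply: perm_big; apply: uniq_perm; rewrite ?filter_uniq //.
  move=> w; rewrite mem_filter; case: (boolP (w \in S_ i)) => //= wi.
  by rewrite (SSle i j).
have fE k w : sqn (fourier mu (xi + w)) =
    sqn (mprod k (xi + w)) * absf (T ^+ k *m (xi + w)) ^+ 2.
  by rewrite (fourier_mask_prod ds0 mu_sa k) sqnM absf_sqr.
(* eventually the rescaled frequencies stay where [absf] is at least [e / 4] *)
have [i0 i0P] : exists i0, forall i w, (i0 <= i)%N -> w \in S_ i ->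
    e / 4 <= absf (T ^+ k_ i *m (xi + w)).
  have e4 : 0 < e / 4 by rewrite divr_gt0.
  have [k0 k0P] := n1_T_eventually [:: xi] K0 e4; exists k0 => i w ii wS.
  have := gS i w wS; have := KP (T ^+ k_ i *m w) (T ^+ k_ i *m (xi + w)).
  have -> : T ^+ k_ i *m w - T ^+ k_ i *m (xi + w) = - (T ^+ k_ i *m xi).
    by rewrite mulmxDr opprD addrC -addrA addNr addr0.
  rewrite n1N; have := k0P xi (k_ i) (mem_head _ _) (leq_trans ii (kge i)); lra.
pose c := (e / 4) ^+ 2.
have c0 : 0 < c by rewrite exprn_gt0 // divr_gt0.
(* from [i1] on, the sums [Q] gain less than [c * (d / 4)] *)
have [i1 i01 i1P] : exists2 i1, (i0 <= i1)%N & forall j, (i1 <= j)%N ->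
    Q j - Q i1 <= c * (d / 4).
  have hQ : has_sup [set Q i | i in setT].
    by split; [exists (Q 0%N); exists 0%N | exists (1 - d) => _ [i _ <-]].
  have cd : 0 < c * (d / 4) by rewrite mulr_gt0 // divr_gt0.
  have [_ [i _ <-] iQ] := sup_adherent cd hQ.
  have Qmono j j' : (j <= j')%N -> Q j <= Q j'.
    move=> jj'; rewrite /Q (split _ _ _ jj') lerDl sumr_ge0 // => w _.
    exact: sqn_ge0.
  exists (maxn i0 i); first exact: leq_maxl.
  move=> j ij; have := Qmono _ _ (leq_maxr i0 i).
  have : Q j <= sup [set Q i | i in setT] by apply: sup_upper_bound => //; exists j.
  by move: iQ; lra.
(* from [j] on, the finitely many terms of level [i1] are nearly exact *)
have [k2 k2P] : exists k2, forall w k, w \in S_ i1 -> (k2 <= k)%N ->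
    1 - d / 8 < absf (T ^+ k *m (xi + w)).
  apply: seq_eventually => w.
  by apply: (fourier_T_near1 ds0 mu_sa eM); rewrite divr_gt0.
pose j := maxn i1 k2.
have i1j : (i1 <= j)%N by exact: leq_maxl.
have k2j : (k2 <= k_ j)%N := leq_trans (leq_maxr _ _) (kge j).
have := (sS j).2 xi; rewrite (split _ _ _ i1j) => sum1.
have far : \sum_(w <- S_ j | w \notin S_ i1) sqn (mprod (k_ j) (xi + w)) <= d / 4.
  rewrite -(ler_pM2l c0); apply: le_trans (i1P j i1j).
  rewrite /Q (split _ _ _ i1j) [X in _ <= X]addrC addKr mulr_sumr.
  rewrite big_seq_cond [leRHS]big_seq_cond; apply: ler_sum => w /andP[wS _].
  rewrite (fE (k_ j)) mulrC ler_wpM2l ?sqn_ge0 // /c.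
  by rewrite lerXn2r ?nnegrE ?absf_ge0 ?divr_ge0 ?(ltW e0) // i0P // (leq_trans i01).
have near : (1 - d / 8) ^+ 2 * \sum_(w <- S_ i1) sqn (mprod (k_ j) (xi + w)) <= Q i1.
  rewrite mulr_sumr /Q big_seq [leRHS]big_seq; apply: ler_sum => w wS.
  rewrite (fE (k_ j)) mulrC ler_wpM2l ?sqn_ge0 //.
  rewrite lerXn2r ?nnegrE ?absf_ge0 //; last exact: ltW (k2P w _ wS k2j).
  lra.
have := Qle i1; move: far near sum1.
set a := \sum_(w <- _ | _) _; set b := \sum_(w <- S_ i1) _ => far near sum1 q1.
nra.
Qed.

(** The image of a product of two segments of the line. *)
Lemma compact_square (C : R) :
  compact [set x : 'cV[R]_2 | `|x 0 0| <= C /\ `|x 1 0| <= C].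
Proof.
pose h (q : R * R) : 'cV[R]_2 := col2 q.1 q.2.
have -> : [set x : 'cV[R]_2 | `|x 0 0| <= C /\ `|x 1 0| <= C] =
    h @` (`[- C, C]%classic `*` `[- C, C]%classic).
  apply/seteqP; split => [x [x0 x1]|_ [[p q] [/= p0 q0] <-]].
    exists (x 0 0, x 1 0); first by split; rewrite /= in_itv /= -ler_norml.
    apply/matrixP => i j; rewrite (ord1 j) mxE /=.
    have := ord2P i.
    by rewrite !inE => /orP[] /eqP ->.
  by rewrite !mxE /= !ler_norml; move: p0 q0; rewrite !in_itv.
apply: continuous_compact; last by apply: compact_setX; exact: segment_compact.
apply: continuous_subspaceT; apply: continuous_coordP => i q.
rewrite /h; have := ord2P i.
rewrite !inE => /orP[] /eqP ->.
  have -> : (fun x : R * R => col2 x.1 x.2 0 0) = fst by apply/funext => x; rewrite mxE.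
  exact: cvg_fst.
have -> : (fun x : R * R => col2 x.1 x.2 1 0) = snd by apply/funext => x; rewrite mxE.
exact: cvg_snd.
Qed.

Lemma mu_compactly_supported : compactly_supported mu.
Proof.
have [C C0 CN] := n1_bounded ds0 mu_sa eM.
exists [set x : 'cV[R]_2 | `|x 0 0| <= C /\ `|x 1 0| <= C]; first exact: compact_square.
apply/eqP; rewrite eq_le measure_ge0 andbT -CN; apply: le_measure; rewrite ?inE.
- have -> : ~` [set x : 'cV[R]_2 | `|x 0 0| <= C /\ `|x 1 0| <= C] =
     [set x : X | C < `|dot (delta_mx 0 0) x| ] `|` [set x : X | C < `|dot (delta_mx 1 0) x| ].
    apply/seteqP; split => x /=; rewrite !dot_delta.
      by move=> /not_andP[]/negP; rewrite -ltNge; [left | right].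
    by move=> [] h [h0 h1]; [move: h0 | move: h1]; rewrite leNgt h.
  by apply: measurableU; exact: measurable_normdot.
- by apply: measurable_tail; apply: continuous_borel; exact: continuous_n1.
move=> x /= no; rewrite ltNge; apply/negP => h; apply: no; split; apply: le_trans h.
  by rewrite /n1 (bigD1 0) //= lerDl sumr_ge0.
by rewrite /n1 (bigD1 1) //= lerDl sumr_ge0.
Qed.

Lemma spectral_of_even : spectral_measure mu.
Proof.
split; first exact: mu_compactly_supported.
have [K K0 KP] := absf_lip; have [e [e0 e1 eP]] := uniform_reach.
have [k_ [S_ [kge sS gS SS]]] := tower K0 KP e0 e1 eP.
have SSle i j : (i <= j)%N -> {subset S_ i <= S_ j}.
  move=> /subnK <-; elim: (j - i)%N => // m IH w wS; rewrite addSn; apply: SS; exact: IH.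
pose L : set 'cV[R]_2 := \bigcup_i [set` S_ i].
have orthL l l' : L l -> L l' -> l != l' -> fourier mu (l - l') = 0.
  move=> [i _ li] [j _ l'j] ne; pose m := maxn i j.
  have lm : l \in S_ m by apply: SSle li; exact: leq_maxl.
  have l'm : l' \in S_ m by apply: SSle l'j; exact: leq_maxr.
  have lr : l \in rem l' (S_ m).
    by rewrite (mem_rem_uniq _ (spec_uniq (sS m))) !inE ne lm.
  by rewrite (fourier_mask_prod ds0 mu_sa (k_ m)) (spec_orth (sS m) l'm lr) mul0r.
exists L.
  by apply: bigcup_countable => // i _; exact: finite_set_countable.
split.
  move=> l l' Ll Ll'; rewrite L2dot_expo; case: (eqVneq l l') => [->|ne].
    by rewrite subrr fourier0.
  exact: orthL.
apply: total_expP => //; first exact: self_affine_bounded ds0 mu_sa eM.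
move=> xi d d0; have [i iP] := tower_parseval K0 KP e0 kge sS gS SS (- xi) d0.
exists (S_ i); split; [exact: spec_uniq (sS i) | by move=> l lS; exists i |].
apply: lt_le_trans iP _; rewrite le_eqVlt; apply/orP; left; apply/eqP.
by apply: eq_bigr => w _; rewrite -(opprB w xi) fourierN sqnJ addrC.
Qed.

End Sufficiency.

(** * Admissible pairs *)

Section Admissibility.
Variable R : realType.
Variables (Mi : 'M[int]_2) (a1 a2 b1 b2 : int).
Local Notation M := (map_mx intr Mi : 'M[R]_2).
Local Notation T := ((invmx M)^T).
Local Notation A := (M^T).
Local Notation ds := (dgs R a1 a2 b1 b2).
Local Notation D := (digits a1 a2 b1 b2).
Local Notation det := (a1 * b2 - a2 * b1).
Hypothesis det_odd : ~~ (2 %| det)%Z.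
Hypothesis eM : expansive M.

Lemma perm_digits : perm_eq D (idgs a1 a2 b1 b2).
Proof.
apply: uniq_perm; rewrite ?fset_uniq ?idgs_uniq // => z.
by rewrite !inE -!orbA.
Qed.

Lemma card_digits : #|` D| = 4%N.
Proof. by rewrite -[RHS]/(size (idgs a1 a2 b1 b2)) -(perm_size perm_digits). Qed.

Lemma perm_digits_real : perm_eq [fset map_mx intr d | d in D]%fset ds.
Proof.
apply: uniq_perm; rewrite ?fset_uniq ?dgs_uniq // => v; rewrite dgsE.
apply/imfsetP/mapP => [[z /= zD ->]|[z zD ->]]; exists z => //=.
  by rewrite -(perm_mem perm_digits).
by rewrite (perm_mem perm_digits).
Qed.

(** Inner products of the columns of the matrix of the pair; they are values
    of the mask at rescaled differences of frequencies. *)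
Definition gram (S : {fset 'cV[int]_2}) (j j' : 'I_#|` S|) : R[i] :=
  \sum_i hadamard_mx R Mi D S i j * conjc (hadamard_mx R Mi D S i j').

Lemma gramE S (j j' : 'I_#|` S|) : gram j j' =
  dmask ds (T *m (map_mx intr (nth 0 S j) - map_mx intr (nth 0 S j'))).
Proof.
rewrite /gram /dmask -[size ds]/4%N.
have -> : \sum_(d <- ds) expo (T *m (map_mx intr (nth 0 S j) - map_mx intr (nth 0 S j'))) d =
    \sum_(z <- D) expo (T *m (map_mx intr (nth 0 S j) - map_mx intr (nth 0 S j')))
       (map_mx intr z).
  by rewrite dgsE big_map (perm_big _ perm_digits).
rewrite (big_nth 0) big_mkord mulr_sumr; apply: eq_bigr => i _.
rewrite !mxE conjcM conjc_real mulrACA; congr (_ * _).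
  rewrite -rmorphM -invfM -expr2 sqr_sqrtr // card_digits.
  by rewrite fmorphV rmorph_nat.
by rewrite -expo_mulmx expoB !(expoC (invmx M *m _)).
Qed.

Lemma square_unitary (m k : nat) (e : k = m) (H : 'M[R[i]]_(m, k)) :
  H \is unitarymx <->
  forall j j', \sum_i H i j * conjc (H i j') = (j == j')%:R.
Proof.
subst k; split => [/unitarymxP HH j j'|cols].
  have := mulmx1C HH => /matrixP/(_ j' j); rewrite !mxE eq_sym => <-.
  by apply: eq_bigr => i _; rewrite !mxE mulrC.
apply/unitarymxP; apply: mulmx1C; apply/matrixP => j' j.
rewrite !mxE eq_sym -cols; apply: eq_bigr => i _; by rewrite !mxE mulrC.
Qed.

Lemma even_halve : even_mx Mi -> exists Ni, Mi = 2 *: Ni.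
Proof.
move=> ev; exists (\matrix_(i, j) (Mi i j %/ 2)%Z); apply/matrixP => i j.
by rewrite !mxE mulrC divzK.
Qed.

Lemma T_A_mul (v : 'cV[R]_2) : T *m (A *m v) = v.
Proof. by rewrite mulmxA mulTA // mul1mx. Qed.

(** The candidates [A z / 2], with [z] in the unit square, are integral when
    [Mi] is even, and the mask vanishes at their rescaled differences. *)
Lemma admissible_of_even : even_mx Mi -> admissible R Mi D.
Proof.
move=> /even_halve[Ni MN].
pose f (z : 'cV[int]_2) := Ni^T *m z.
have fT z : T *m map_mx intr (f z) = 2^-1 *: map_mx intr z.
  by rewrite -(A_half R MN) T_A_mul.
have finj : injective f.
  move=> z z' e; have := fT z; rewrite e fT => /(congr1 (fun v : 'cV[R]_2 => 2 *: v)).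
  rewrite !scalerA mulfV ?pnatr_eq0 // !scale1r => /matrixP h.
  by apply/matrixP => i j; have := h i j; rewrite !mxE => /intr_inj.
pose S := [fset z | z in [seq f z | z <- unit_square]]%fset.
have pS : perm_eq S [seq f z | z <- unit_square].
  apply: uniq_perm; rewrite ?fset_uniq ?(map_inj_uniq finj) ?unit_square_uniq // => z.
  by rewrite /S in_fset.
have cS : #|` S| = #|` D| by rewrite card_digits (perm_size pS).
exists S => //; apply/(square_unitary cS) => j j'; rewrite -/(gram j j') gramE.
case: (eqVneq j j') => [->|ne]; first by rewrite subrr mulmx0 dmask0.
have mem (k : 'I_#|` S|) : exists2 z, z \in unit_square & nth 0 S k = f z.
  have : nth 0 S k \in S by apply: mem_nth.
  by rewrite (perm_mem pS) => /mapP[z zs ->]; exists z.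
have [z zs zE] := mem j; have [z' z's z'E] := mem j'.
have zz' : z != z'.
  apply: contra ne => /eqP e; apply/eqP/val_inj/eqP.
  have := nth_uniq 0 (ltn_ord j) (ltn_ord j') (fset_uniq S).
  by rewrite zE z'E e eqxx => <-.
rewrite zE z'E mulmxBr !fT -scalerBr -map_mxB.
apply: (dmask_half0 R det_odd); rewrite /even_vec !mxE; move: zz'.
move: zs z's; rewrite /unit_square !inE => /or4P[] /eqP -> /or4P[] /eqP ->;
  by rewrite ?eqxx // => _; rewrite !mxE /=.
Qed.

(** The differences of the frequencies from one of them realize all parities
    of the two pairings with [2 T w]. Those where exactly one pairing is
    even give linear congruences modulo [2] on the rows of the matrix, of
    odd determinant [det]. *)
Lemma even_of_admissible : admissible R Mi D -> even_mx Mi.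
Proof.
case=> S cS /(square_unitary cS) cols.
have S0 : (0 < #|` S|)%N by rewrite cS card_digits.
pose j0 := Ordinal S0; pose sv j : 'cV[R]_2 := map_mx intr (nth 0 S j).
have sint j : intvec (sv j) by exact: intvec_intr.
have /choice[e eP] : forall j : 'I_#|` S|, exists mk : int * int,
    2 * dot (da R a1 a2) (T *m (sv j - sv j0)) = mk.1%:~R /\
    2 * dot (db R b1 b2) (T *m (sv j - sv j0)) = mk.2%:~R.
  move=> j; case: (eqVneq j j0) => [->|ne].
    by exists (0, 0); rewrite subrr mulmx0 !dot0r mulr0.
  have := cols j j0; rewrite (negbTE ne) -/(gram j j0) gramE.
  by move=> /dmask_eq0[m [k [mE kE _]]]; exists (m, k).
pose pr (mk : int * int) : bool * bool := ((2 %| mk.1)%Z, (2 %| mk.2)%Z).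
have prinj : injective (fun j => pr (e j)).
  move=> j j' ejj'; apply/eqP; apply: contraT => ne; exfalso.
  have := cols j j'; rewrite (negbTE ne) -/(gram j j') gramE -/(sv j) -/(sv j').
  move=> /dmask_eq0[m [k [mE kE]]].
  have dd u v w w' : dot u (T *m (v - w)) = dot u (T *m (v - w')) - dot u (T *m (w - w')) :> R.
    by rewrite dotC [RHS](_ : _ = dot (T *m (v - w')) u - dot (T *m (w - w')) u)
      ?(dotC u) // -dotBl -mulmxBr opprB addrA subrK.
  have [m1 k1] := eP j; have [m2 k2] := eP j'.
  have mE' : m = (e j).1 - (e j').1.
    by apply: (@intr_inj R); rewrite intrB -mE -m1 -m2 -mulrBr -dd.
  have kE' : k = (e j).2 - (e j').2.
    by apply: (@intr_inj R); rewrite intrB -kE -k1 -k2 -mulrBr -dd.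
  by move: ejj' => [h1 h2]; rewrite mE' kE' !even_sub h1 h2 !eqxx.
have prsurj c : exists j, pr (e j) = c.
  have cc : #|{: bool * bool}| = #|'I_#|` S| |.
    by rewrite card_prod card_bool card_ord cS card_digits.
  have /(_ c)/codomP[j jE] := inj_card_onto prinj (eq_leq cc).
  by exists j.
have evA j i : (2 %| Mi 0%R i * (b2 * (e j).1 - a2 * (e j).2) -
                     Mi 1%R i * (b1 * (e j).1 - a1 * (e j).2))%Z.
  have [m1 k1] := eP j; set xi := T *m _ in m1 k1.
  have [z zE] : exists z : 'cV[int]_2, sv j - sv j0 = map_mx intr z.
    by apply: intvecP; apply: intvecB.
  have AT : A *m xi = map_mx intr z by rewrite -zE mulmxA mulAT // mul1mx.
  clearbody xi.
  have zi : (z i 0)%:~R = (Mi 0 i)%:~R * xi 0 0 + (Mi 1 i)%:~R * xi 1 0 :> R.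
    have /matrixP/(_ i 0) := AT; rewrite mxE [RHS]mxE => <-.
    rewrite !big_ord_recl big_ord0 addr0 !mxE.
    by congr (_ + (Mi _ i)%:~R * xi _ 0); exact: val_inj.
  apply/dvdzP; exists (det * z i 0); apply: (@intr_inj R).
  have h0 := adj_dot0 a1 a2 b1 b2 xi; have h1 := adj_dot1 a1 a2 b1 b2 xi.
  rewrite !(intrB, intrM) -m1 -k1.
  transitivity (2 * ((Mi 0 i)%:~R * (det%:~R * xi 0 0) + (Mi 1 i)%:~R * (det%:~R * xi 1 0))).
    by rewrite -h0 -h1; ring.
  by rewrite !(intrB, intrM) zi; ring.
have [j1 [] o1 o1'] := prsurj (false, true).
have [j2 [] o2 o2'] := prsurj (true, false).
move=> l i; have := ord2P l.
move: (evA j1 i) (evA j2 i) det_odd.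
rewrite !inE !(even_sub, even_mul, o1, o1', o2, o2').
move=> h1 h2 h3 /orP[] /eqP ->; move: h1 h2 h3;
  by case: (2 %| a1)%Z; case: (2 %| a2)%Z; case: (2 %| b1)%Z; case: (2 %| b2)%Z;
     case: (2 %| Mi _ _)%Z; case: (2 %| Mi _ _)%Z.
Qed.

End Admissibility.

(** * The normalized pair *)

Section Statements.
Variable R : realType.

(** An eigenvector of the conjugate becomes one of [M] with the same
    eigenvalue. *)
Lemma expansive_conj n (P M : 'M[R]_n) :
  P \in unitmx -> expansive M -> expansive (P *m M *m invmx P).
Proof.
move=> Pu eM z /eigenvalueP[v vz v0]; apply: eM; apply/eigenvalueP.
have Pu' : map_mx (real_complex R) P \in unitmx by rewrite map_unitmx.
exists (v *m map_mx (real_complex R) P).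
  by rewrite scalemxAl -vz -!mulmxA -!map_mxM -!mulmxA mulVmx // mulmx1.
by apply: contra_neq v0 => /(canRL (mulmxK Pu')) ->; rewrite mul0mx.
Qed.

Lemma tilde_expansive (M : 'M[int]_2) (p q t1 t2 : int) :
  p * t1 + q * t2 = 1 -> expansive (map_mx intr M : 'M[R]_2) ->
  expansive (map_mx intr (tilde_mx (Qmx p q t1 t2) M) : 'M[R]_2).
Proof.
move=> /det_Qmx dQ eM; rewrite /tilde_mx !map_mxM.
set Q := Qmx p q t1 t2 in dQ *; set QR : 'M[R]_2 := map_mx intr Q.
have QRu : QR \in unitmx by rewrite unitmxE det_map_mx dQ unitr1.
have Qu : Q \in unitmx by rewrite unitmxE dQ unitr1.
have -> : map_mx intr (invmx Q) = invmx QR.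
  by rewrite -[LHS](mulKmx QRu) -map_mxM mulmxV // map_mx1 mulmx1.
exact: expansive_conj.
Qed.

(** The half points [(1/2, 0)] and [(0, 1/2)] already pick out the halves of
    the two columns. *)
Lemma half_points_even (M : 'M[int]_2) :
  [set map_mx intr M *m v | v in half_points R] `<=` integer_points R 2 <->
  even_mx M.
Proof.
split=> [sub|/even_halve[N ->] _ [v [[l1 _ [l2 _ <-]] _] <-]]; last first.
  exists (N *m col2 l1%:Z l2%:Z) => //.
  rewrite map_mxM map_mxZ -scalemxAl -scalemxAr scalerA mulfV ?pnatr_eq0 // scale1r.
  by congr (_ *m _); apply/matrixP => i j; rewrite !mxE; case: ifP.
have ent (x y : nat) : [set 0; 1]%N x -> [set 0; 1]%N y -> (x, y) != (0, 0)%N ->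
    forall i, (2 %| M i 0%R * x%:Z + M i 1%R * y%:Z)%Z.
  move=> hx hy xy i.
  have /sub[z _ /matrixP/(_ i 0)] :
      [set map_mx intr M *m v | v in half_points R]
        (map_mx intr M *m (2^-1 *: col2 x%:R y%:R)).
    exists (2^-1 *: col2 x%:R y%:R) => //; split; first by exists x => //; exists y.
    have z0 (k : nat) : 2^-1 * k%:R = 0 :> R -> k = 0%N.
      by move/eqP; rewrite mulf_eq0 invr_eq0 !pnatr_eq0 => /eqP.
    move/matrixP => e; move: (e 0 0) (e 1 0) xy; rewrite !mxE /=.
    by move=> /z0 -> /z0 ->.
  rewrite -scalemxAr !mxE => e; apply/dvdzP; exists (z i 0).
  apply: (@intr_inj R); rewrite intrM e mulrAC mulVf ?pnatr_eq0 // mul1r.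
  rewrite !big_ord_recl big_ord0 addr0 !mxE /= intrD !intrM.
  by congr (_ + (M i _)%:~R * _); exact: val_inj.
move=> i j; have := ord2P j.
rewrite !inE => /orP[] /eqP ->.
  by have := ent 1%N 0%N (or_intror erefl) (or_introl erefl) isT i; rewrite mulr1 mulr0 addr0.
by have := ent 0%N 1%N (or_introl erefl) (or_intror erefl) isT i; rewrite mulr1 mulr0 add0r.
Qed.

End Statements.

Theorem theorem1p5 (R : realType) (M : 'M[int]_2)
  (alpha1 alpha2 beta1 beta2 gamma t1 t2 p q : int) (eta : nat)
  (M_expansive : expansive (map_mx intr M : 'M[R]_2))
  (det_neq0 : alpha1 * beta2 - alpha2 * beta1 != 0)
  (gcd_eq1 : gcdz (gcdz alpha1 alpha2) (gcdz beta1 beta2) = 1)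
  (det_eq : alpha1 * beta2 - alpha2 * beta1 = 2 ^+ eta * gamma)
  (gamma_odd : ~~ (2 %| gamma)%Z)
  (alpha_odd : ~~ (2 %| gcdz alpha1 alpha2)%Z)
  (alpha1_eq : alpha1 = gcdz alpha1 alpha2 * t1)
  (alpha2_eq : alpha2 = gcdz alpha1 alpha2 * t2)
  (t_coprime : gcdz t1 t2 = 1)
  (bezout : p * t1 + q * t2 = 1) :
  let Q := Qmx p q t1 t2 in
  let Mt := tilde_mx Q M in
  let Dt := tilde_digits Q (digits alpha1 alpha2 beta1 beta2) in
  forall mu : probability (borelRn R 2) R,
  self_affine_measure (map_mx intr Mt) [fset map_mx intr d | d in Dt] mu ->
  eta = 0%N ->
  [<-> spectral_measure mu;
       even_mx Mt;
       [set map_mx intr Mt *m v | v in half_points R] `<=` integer_points R 2;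
       admissible R Mt Dt].
Proof.
move=> Q Mt Dt mu; rewrite {}/Dt => sa eta0.
set a := gcdz alpha1 alpha2 in alpha_odd alpha1_eq alpha2_eq.
have a0 : a != 0 by apply: contraNneq alpha_odd => ->; rewrite dvdz0.
rewrite eta0 expr0 mul1r in det_eq.
have DtE : tilde_digits Q (digits alpha1 alpha2 beta1 beta2) =
    digits a 0 (p * beta1 + q * beta2) (gamma %/ a)%Z.
  rewrite (@tilde_digitsE _ _ _ _ a _ _ _ _ gamma 0) ?expr0 ?mul1r //.
(* [a] divides [gamma], so the determinant of the normalized digits is [gamma] *)
have det_odd : ~~ (2 %| a * (gamma %/ a)%Z - 0 * (p * beta1 + q * beta2))%Z.
  rewrite mul0r subr0 mulrC divzK // -det_eq.
  by apply/dvdzP; exists (t1 * beta2 - t2 * beta1); rewrite {1}alpha1_eq {1}alpha2_eq; ring.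
rewrite DtE in sa *.
have eMt : expansive (map_mx intr Mt : 'M[R]_2) by exact: tilde_expansive.
have mu_sa (E : set (borelRn R 2)) : measurable E -> mu E =
    (((size (dgs R a 0 (p * beta1 + q * beta2) (gamma %/ a)%Z))%:R^-1)%:E *
    \sum_(d <- dgs R a 0 (p * beta1 + q * beta2) (gamma %/ a)%Z)
       mu (affine_map (map_mx intr Mt) d @^-1` E))%E.
  have per := perm_digits_real R det_odd.
  by move=> mE; rewrite (sa _ mE) -(perm_size per) (perm_big _ per).
tfae.
- by move=> [_ [L _ onb]]; apply: (spectral_even det_odd _ eMt onb).
- by move=> /half_points_even.
- by move=> /half_points_even; exact: admissible_of_even.
- move=> /(even_of_admissible det_odd eMt)/even_halve[Nt MN].
  exact: spectral_of_even det_odd mu_sa eMt MN.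
Qed.
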